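(* Let $V:\mathbb R^3\to\mathbb C^{4\times 4}$ be self-adjoint with $|V(x)|\lesssim\langle x\rangle^{-2-\varepsilon}$ for some $\varepsilon>0$. If $\mathcal H\psi=0$ with $\psi\in L^2(\mathbb R^3)$, then $\phi=Uv\psi\in S_1L^2$, i.e. $T_0\phi=0$.
   Context: Function spaces consist of $\mathbb C^4$-valued functions on $\mathbb R^3$. $\langle x\rangle=(1+|x|^2)^{1/2}$; $|V(x)|\lesssim\langle x\rangle^{-\delta}$ means every entry satisfies this bound. $D_0=-i\alpha\cdot\nabla=-i\sum_{k=1}^3\alpha_k\partial_k$, where $\alpha_k=\begin{pmatrix}0&\sigma_k\\ \sigma_k&0\end{pmatrix}$ with $\sigma_1=\begin{pmatrix}0&-i\\ i&0\end{pmatrix}$, $\sigma_2=\begin{pmatrix}0&1\\1&0\end{pmatrix}$, $\sigma_3=\begin{pmatrix}1&0\\0&-1\end{pmatrix}$, and $\mathcal H=D_0+V$. Since $V(x)$ is Hermitian, write $V=B^*\Lambda B$ with $B(x)$ unitary and $\Lambda=\mathrm{diag}(\lambda_1,\dots,\lambda_4)$ real; set $U=\mathrm{diag}(\mathrm{sign}(\lambda_1),\dots,\mathrm{sign}(\lambda_4))$ (with values in $\{\pm1\}$, say $\mathrm{sign}(0)=1$), $v=|\Lambda|^{1/2}B$, so $V=v^*Uv$. $\mathcal G_0$ is the operator with matrix-valued kernel $\mathcal G_0(x,y)=\dfrac{i\,\alpha\cdot(x-y)}{4\pi|x-y|^3}$, i.e. $\mathcal G_0=-i\alpha\cdot\nabla(-\Delta)^{-1}$,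 and $T_0=U+v\mathcal G_0v^*$ on $L^2(\mathbb R^3)$. $S_1$ is the orthogonal (Riesz) projection of $L^2(\mathbb R^3)$ onto $\ker T_0$. *)

(* Defs.v *)
From mathcomp Require Import all_boot all_order all_algebra.
From mathcomp Require Import sesquilinear spectral.
From mathcomp Require Import complex.
From mathcomp Require Import all_classical all_reals all_analysis.

Set Implicit Arguments.
Unset Strict Implicit.
Unset Printing Implicit Defensive.

Import Order.TTheory GRing.Theory Num.Theory.
Import numFieldNormedType.Exports.

Local Open Scope classical_set_scope.
Local Open Scope complex_scope.
Local Open Scope sesquilinear_scope.
Local Open Scope ring_scope.

Notation R3 R := (R * R * R)%type.

(* The same type with the Borel structure over which the library builds
   lebesgue_measure. *)
Notation R3m R :=
  (measurableTypeR R * measurableTypeR R * measurableTypeR R)%type.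

Section Space.
Variable R : realType.
Implicit Types (x : R3 R) (k : 'I_3).

Definition coord3 k x : R := [:: x.1.1; x.1.2; x.2]`_k.

Definition basis_vec k : R3 R := ((k == 0)%:R, (k == 1)%:R, (k == 2)%:R).

(* The norm that the library puts on a product type is the max norm. *)
Definition enorm x : R := Num.sqrt (\sum_k coord3 k x ^+ 2).

Definition japanese x : R := Num.sqrt (1 + enorm x ^+ 2).

Definition lebesgue3 : {measure set (R3m R) -> \bar R} :=
  (@lebesgue_measure R \x @lebesgue_measure R \x @lebesgue_measure R)%E.

Definition partial k (f : R3 R -> R) : R3 R -> R :=
  fun x => 'D_(basis_vec k) f x.

Definition smooth (f : R3 R -> R) : Prop :=
  forall s : seq 'I_3, let g := foldr partial f s in
    continuous g /\ forall x k, derivable g x (basis_vec k).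

Definition test_function (chi : R3 R -> R) : Prop :=
  smooth chi /\ exists r : R, forall x, r < enorm x -> chi x = 0.

End Space.

(* R[i] carries no Borel structure or integral in the library; both are taken
   on the real and imaginary parts of the entries. *)
Section ComplexIntegration.
Variable R : realType.

Definition measurable_mx m n (F : R3 R -> 'M[R[i]]_(m, n)) : Prop :=
  forall i j, measurable_fun [set: R3m R] (fun x => complex.Re (F x i j)) /\
              measurable_fun [set: R3m R] (fun x => complex.Im (F x i j)).

Definition integrable_mx m n (F : R3 R -> 'M[R[i]]_(m, n)) : Prop :=
  forall i j,
    (lebesgue3 R).-integrable setT (fun x => (complex.Re (F x i j))%:E) /\
    (lebesgue3 R).-integrable setT (fun x => (complex.Im (F x i j))%:E).

Definition integral_mx m n (F : R3 R -> 'M[R[i]]_(m, n)) : 'M[R[i]]_(m, n) :=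
  \matrix_(i, j)
    (Rintegral (lebesgue3 R) setT (fun x => complex.Re (F x i j)) +i*
     Rintegral (lebesgue3 R) setT (fun x => complex.Im (F x i j))).

(* Elements of L^2(R^3; C^4) are represented by functions, so equalities
   between them are stated almost everywhere. *)
Definition L2 (f : R3 R -> 'cV[R[i]]_4) : Prop :=
  measurable_mx f /\
  (\int[lebesgue3 R]_x
     (\sum_i (complex.Re (f x i 0%R) ^+ 2 + complex.Im (f x i 0%R) ^+ 2))%:E
   < +oo)%E.

Definition L2dot (f g : R3 R -> 'cV[R[i]]_4) : R[i] :=
  integral_mx (fun x => (f x)^t* *m g x) 0 0.

Definition in_range_orth_proj (K : (R3 R -> 'cV[R[i]]_4) -> Prop)
    (p : R3 R -> 'cV[R[i]]_4) : Prop :=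
  exists f, [/\ L2 f, K p & forall g, K g -> L2dot g (fun x => f x - p x) = 0].

End ComplexIntegration.

Section Dirac.
Variable R : realType.

Definition mx_of_rows n (s : seq (seq R[i])) : 'M[R[i]]_n :=
  \matrix_(i, j) (nth [::] s i)`_j.

Definition sigma (k : 'I_3) : 'M[R[i]]_2 :=
  nth 0 [:: mx_of_rows 2 [:: [:: 0; - 'i%C]; [:: 'i%C; 0]];
            mx_of_rows 2 [:: [:: 0; 1];      [:: 1; 0]];
            mx_of_rows 2 [:: [:: 1; 0];      [:: 0; -1]]] k.

Definition alpha (k : 'I_3) : 'M[R[i]]_4 :=
  block_mx 0 (sigma k) (sigma k) 0 : 'M[R[i]]_(2 + 2).

Definition alpha_dot (x : R3 R) : 'M[R[i]]_4 :=
  \sum_k (coord3 k x)%:C *: alpha k.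

(* Value of the distribution d_k psi at chi.  Real-valued chi suffice, the
   complex-valued ones being recovered by linearity. *)
Definition distr_partial (k : 'I_3) (psi : R3 R -> 'cV[R[i]]_4)
    (chi : R3 R -> R) : 'cV[R[i]]_4 :=
  - integral_mx (fun x => (partial k chi x)%:C *: psi x).

Definition distr_D0 (psi : R3 R -> 'cV[R[i]]_4) (chi : R3 R -> R)
  : 'cV[R[i]]_4 :=
  - 'i%C *: \sum_k alpha k *m distr_partial k psi chi.

(* (D0 + V) psi = 0 in the sense of distributions.  For psi in L^2 and V
   bounded, this is the same as: psi is in the domain H^1 of D0 + V and
   (D0 + V) psi = 0. *)
Definition dirac_null (V : R3 R -> 'M[R[i]]_4) (psi : R3 R -> 'cV[R[i]]_4)
  : Prop :=
  forall chi, test_function chi ->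
    distr_D0 psi chi + integral_mx (fun x => (chi x)%:C *: (V x *m psi x)) = 0.

(* On the diagonal x = y, a null set for each x, the inverse of 0 is 0 and the
   kernel is 0. *)
Definition G0_kernel (x y : R3 R) : 'M[R[i]]_4 :=
  ('i%C / (4 * pi * enorm (x - y) ^+ 3)%:C) *: alpha_dot (x - y).

Definition G0 (f : R3 R -> 'cV[R[i]]_4) (x : R3 R) : 'cV[R[i]]_4 :=
  integral_mx (fun y => G0_kernel x y *m f y).

Definition G0_converges (f : R3 R -> 'cV[R[i]]_4) (x : R3 R) : Prop :=
  integrable_mx (fun y => G0_kernel x y *m f y).

Definition real_diag (d : 'I_4 -> R) : 'M[R[i]]_4 :=
  diag_mx (\row_i (d i)%:C).

Definition sign_pm (t : R) : R := if 0 <= t then 1 else -1.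

Definition Umx (lam : R3 R -> 'I_4 -> R) (x : R3 R) : 'M[R[i]]_4 :=
  real_diag (fun i => sign_pm (lam x i)).

Definition vmx (lam : R3 R -> 'I_4 -> R) (B : R3 R -> 'M[R[i]]_4) (x : R3 R)
  : 'M[R[i]]_4 :=
  real_diag (fun i => Num.sqrt `|lam x i|) *m B x.

Definition diagonalizes (V B : R3 R -> 'M[R[i]]_4) (lam : R3 R -> 'I_4 -> R)
  : Prop :=
  [/\ measurable_mx B,
      (forall i, measurable_fun [set: R3m R] (fun x => lam x i)),
      (forall x, B x \is unitarymx) &
      (forall x, V x = (B x)^t* *m real_diag (lam x) *m B x)].

Definition T0 (U v : R3 R -> 'M[R[i]]_4) (phi : R3 R -> 'cV[R[i]]_4)
    (x : R3 R) : 'cV[R[i]]_4 :=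
  U x *m phi x + v x *m G0 (fun y => (v y)^t* *m phi y) x.

(* The convergence clause excludes the default value that the library gives to
   the integral of a non-integrable function. *)
Definition ker_T0 (U v : R3 R -> 'M[R[i]]_4) (phi : R3 R -> 'cV[R[i]]_4)
  : Prop :=
  [/\ L2 phi,
      {ae lebesgue3 R, forall x, G0_converges (fun y => (v y)^t* *m phi y) x} &
      {ae lebesgue3 R, forall x, T0 U v phi x = 0}].

Definition S1_range (U v : R3 R -> 'M[R[i]]_4)
  : (R3 R -> 'cV[R[i]]_4) -> Prop :=
  in_range_orth_proj (ker_T0 U v).

End Dirac.

(* Main.v *)
Require Import Defs.
From HB Require Import structures.
From mathcomp Require Import all_boot all_order all_algebra.
From mathcomp Require Import sesquilinear spectral.
From mathcomp Require Import complex.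
From mathcomp Require Import all_classical all_reals all_analysis.
From mathcomp Require Import measurable_realfun.
From mathcomp Require Import ring lra.
Import Order.TTheory GRing.Theory Num.Theory.
Import numFieldNormedType.Exports.
Local Open Scope classical_set_scope.
Local Open Scope complex_scope.
Local Open Scope ring_scope.

Set Implicit Arguments.
Unset Strict Implicit.
Unset Printing Implicit Defensive.

(* Convolving the equation D_0 psi = - f, where f = V psi, with the regularized
   kernel k_b(x, y) = (x - y) (b + |x - y|^2)^(-3/2) of the gradient of the
   Newton potential, and contracting with i alpha / (4 pi), the Clifford
   relations turn alpha_j alpha_k d_k k_b,j into the divergence of k_b, which is
   -4 pi times the approximate identity (3 / (4 pi)) b (b + |x - y|^2)^(-5/2).
   Hence the mollifications of psi equal the regularized - G0 f.  As b tends to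
   0 along 4^-n, the right-hand side converges to - G0 f at every x where the
   Riesz potential of |f| is finite, dominated by that potential.  The latter
   is locally integrable because f is in L^1 (psi and <x>^-2 are in L^2), so
   integrating over boxes and using Fubini gives psi = - G0 f almost
   everywhere, that is, T0 phi = v (psi + G0 v* phi) = 0. *)

(** Only smooth compactly supported functions may be inserted into the equation, and the kernel is
    neither. The parameter [b] removes the singularity; cutoffs provide the support. Their gradients
    need only be bounded and tend to 0 pointwise, because the regularized kernel is dominated by
    [(b + |x - y|^2)^-1], which lies in L^2 like psi. Since psi is merely in L^2, its mollifications
    are not followed pointwise: over a box they converge after integration, the mollifier being
    moved onto the indicator, which is locally constant off six null faces. Boxes form a pi-system
    generating the Borel sets, so equal integrals over them identify two locally integrable
    functions. Integrals over space are iterated line integrals: integrating out one coordinate of a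
    power of [b + |x - y|^2] leaves a power of the same shape in the other coordinates. The sequence
    [4^-n] is chosen because its square roots are powers of 2, which makes the error bounds
    geometric. *)

Section Rescaled.
Context {R : realType}.

(** Both sides have the same difference quotient. Moving to the line makes the one-variable chain
    rule available for directional derivatives without Fréchet differentiability. *)
Lemma is_derive_line (V : normedModType R) (f : V -> R) (x v : V) (d : R) :
  is_derive x v f d <-> is_derive (0 : R) 1 (fun h : R => f (h *: v + x)) d.
Proof.
suff E : (fun h : R => h^-1 *: ((f \o shift x) (h *: v) - f x)) =
  (fun h : R => h^-1 *: (((fun h : R => f (h *: v + x)) \o shift 0) (h *: 1)
     - f (0 *: v + x))).
  split=> -[D <-]; split.
  - by rewrite /derivable -E.
  - by rewrite /derive -E.
  - by rewrite /derivable E.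
  - by rewrite /derive E.
by apply/funext => h /=; rewrite addr0 scale0r add0r [_%:A]mulr1.
Qed.

Lemma is_derive_comp_real (V : normedModType R) (f : V -> R) (F : R -> R)
    (x v : V) (df dF : R) :
  is_derive x v f df -> is_derive (f x) 1 F dF ->
  is_derive x v (F \o f) (dF * df).
Proof.
move=> /is_derive_line f' F'; apply/is_derive_line.
apply: (@is_derive1_comp _ F (fun h : R => f (h *: v + x))) => //.
by rewrite scale0r add0r.
Qed.

Lemma is_derive_addf (V : normedModType R) (f g : V -> R) (x v : V) df dg :
  is_derive x v f df -> is_derive x v g dg ->
  is_derive x v (fun y => f y + g y) (df + dg).
Proof. exact: is_deriveD. Qed.

Lemma is_derive_mulf (V : normedModType R) (f g : V -> R) (x v : V) df dg :
  is_derive x v f df -> is_derive x v g dg ->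
  is_derive x v (fun y => f y * g y) (f x * dg + g x * df).
Proof. exact: is_deriveM. Qed.

Lemma is_derive_expf (V : normedModType R) (f : V -> R) n (x v : V) df :
  is_derive x v f df ->
  is_derive x v (fun y => f y ^+ n) (n%:R * f x ^+ n.-1 * df).
Proof. by move=> f'; have := is_deriveX n f'; rewrite exprfctE. Qed.

(* Junk value: [isqrt b = 0] when [b <= 0]. *)
Definition isqrt (b : R) : R := (Num.sqrt b)^-1.

Lemma isqrt_gt0 b : 0 < b -> 0 < isqrt b.
Proof. by move=> b0; rewrite invr_gt0 sqrtr_gt0. Qed.

Lemma isqrt_ge0 b : 0 <= isqrt b.
Proof. by rewrite invr_ge0 sqrtr_ge0. Qed.

Lemma isqrt_sqr b : 0 <= b -> isqrt b ^+ 2 = b^-1.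
Proof. by move=> b0; rewrite exprVn sqr_sqrtr. Qed.

Lemma is_derive_isqrt (V : normedModType R) (f : V -> R) (x v : V) (d : R) :
  0 < f x -> is_derive x v f d ->
  is_derive x v (fun y => isqrt (f y)) (- (d / 2) * isqrt (f x) ^+ 3).
Proof.
move=> f0 f'.
have s0 : Num.sqrt (f x) != 0 by rewrite gt_eqF// sqrtr_gt0.
have D : is_derive (f x) 1 (isqrt)
    (- (Num.sqrt (f x)) ^- 2 *: (2 * Num.sqrt (f x))^-1).
  have S := is_derive1_sqrt f0.
  split; first by apply: derivableV => //; exact: ex_derive.
  by rewrite (deriveV s0)// derive_val.
apply: is_derive_eq; first exact: (is_derive_comp_real f' D).
rewrite /isqrt -[_ *: _]/(_ * _); field.
by rewrite s0.
Qed.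

Lemma continuous_addf (T : topologicalType) (f g : T -> R) (x : T) :
  {for x, continuous f} -> {for x, continuous g} ->
  {for x, continuous (fun y => f y + g y)}.
Proof. exact: cvgD. Qed.

Lemma continuous_mulf (T : topologicalType) (f g : T -> R) (x : T) :
  {for x, continuous f} -> {for x, continuous g} ->
  {for x, continuous (fun y => f y * g y)}.
Proof. exact: cvgM. Qed.

Lemma continuous_expf (T : topologicalType) (f : T -> R) n (x : T) :
  {for x, continuous f} -> {for x, continuous (fun y => f y ^+ n)}.
Proof.
move=> cf; elim: n => [|n IH]; first exact: cvg_cst.
have -> : (fun y => f y ^+ n.+1) = (fun y => f y * f y ^+ n).
  by apply/funext => y; rewrite exprS.
exact: continuous_mulf.
Qed.

Lemma continuous_isqrt (T : topologicalType) (f : T -> R) (x : T) :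
  0 < f x -> {for x, continuous f} -> {for x, continuous (fun y => isqrt (f y))}.
Proof.
move=> f0 cf; apply: cvgV; first by rewrite gt_eqF// sqrtr_gt0.
by apply: continuous_comp => //; exact: sqrt_continuous.
Qed.

End Rescaled.

(** * Integrals of powers of [(b + t^2)^(-1/2)] over the line *)

Section LineIntegrals.
Context {R : realType}.
Implicit Types b t : R.
Let mu := @lebesgue_measure R.

(** The integrand is even, so a primitive vanishing at 0 and its limit [l] at infinity give the
    integral over the whole line as [2 * l]. *)
Definition antideriv b n (F : R -> R) (l : R) : Prop :=
  [/\ F 0 = 0, forall t, is_derive t 1 F (isqrt (b + t ^+ 2) ^+ n) &
      F t @[t --> +oo] --> l].

Lemma addsqr_gt0 b t : 0 < b -> 0 < b + t ^+ 2.
Proof. by move=> b0; rewrite ltr_wpDr// sqr_ge0. Qed.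

Lemma is_derive_isqrt_line b t : 0 < b ->
  is_derive t 1 (fun t => isqrt (b + t ^+ 2)) (- t * isqrt (b + t ^+ 2) ^+ 3).
Proof.
move=> b0.
have D := is_derive_isqrt (f := fun t => b + t ^+ 2) (addsqr_gt0 t b0)
  (is_derive_addf (is_derive_cst b t 1) (is_derive_expf 2 (is_derive_id t 1))).
by apply: is_derive_eq D _; rewrite /=; field.
Qed.

Lemma cvgy_isqrt2 b : 0 < b ->
  (fun t => isqrt (b + t ^+ 2) ^+ 2) @ +oo --> (0 : R).
Proof.
move=> b0; have bt t := addsqr_gt0 t b0.
apply: (@squeeze_cvgr _ _ _ _ (cst 0) (fun t : R => t^-1)).
- near=> t.
  have t1 : 1 <= t by near: t; exact: nbhs_pinfty_ge.
  rewrite (isqrt_sqr (ltW (bt t))) invr_ge0 (ltW (bt t)) /=.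
  have t0 : 0 < t by exact: lt_le_trans t1.
  rewrite lef_pV2 ?posrE//.
  by rewrite expr2 ler_wpDl ?(ltW b0)// ler_peMl// (le_trans _ t1).
- exact: cvg_cst.
- by apply/gtr0_cvgV0; [exact: nbhs_pinfty_gt|exact: cvg_id].
Unshelve. all: by end_near. Qed.

(** Since [t^2 / (b + t^2) = 1 - b / (b + t^2)], the limit of the left-hand side at infinity reduces
    to the decay of [isqrt (b + t ^+ 2) ^+ 2]. *)
Lemma mul_isqrt_sqrt b t : 0 < b -> 0 <= t ->
  t * isqrt (b + t ^+ 2) = Num.sqrt (1 - b * isqrt (b + t ^+ 2) ^+ 2).
Proof.
move=> b0 t0; have bt := addsqr_gt0 t b0.
have q0 := isqrt_ge0 (b + t ^+ 2).
rewrite -[LHS]ger0_norm ?mulr_ge0// -sqrtr_sqr exprMn; congr Num.sqrt.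
rewrite (isqrt_sqr (ltW bt)); field.
by rewrite gt_eqF.
Qed.

Lemma cvgy_mul_isqrt b : 0 < b ->
  (fun t => t * isqrt (b + t ^+ 2)) @ +oo --> (1 : R).
Proof.
move=> b0.
have C : (fun t => Num.sqrt (1 - b * isqrt (b + t ^+ 2) ^+ 2)) @ +oo -->
    Num.sqrt (1 - b * 0).
  apply: (@cvg_comp _ _ _ (fun t => 1 - b * isqrt (b + t ^+ 2) ^+ 2) Num.sqrt).
    apply: cvgB; first exact: cvg_cst.
    by apply: cvgM; [exact: cvg_cst|exact: cvgy_isqrt2].
  exact: sqrt_continuous.
rewrite mulr0 subr0 sqrtr1 in C; apply: cvg_trans C; apply: near_eq_cvg.
near=> t; rewrite mul_isqrt_sqrt//.
Unshelve. all: by end_near. Qed.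

Lemma cvgy_mul_isqrtX b n : 0 < b ->
  (fun t => t * isqrt (b + t ^+ 2) ^+ n.+2) @ +oo --> (0 : R).
Proof.
move=> b0; have T1 := cvgy_mul_isqrt b0; have Q2 := cvgy_isqrt2 b0.
have Q0 : (fun t => isqrt (b + t ^+ 2)) @ +oo --> (0 : R).
  have E : (fun t => isqrt (b + t ^+ 2)) = (fun t => Num.sqrt (isqrt (b + t ^+ 2) ^+ 2)).
    by apply/funext => t; rewrite sqrtr_sqr ger0_norm// isqrt_ge0.
  rewrite E -sqrtr0; apply: (@cvg_comp _ _ _ _ Num.sqrt _ _ _ Q2).
  exact: sqrt_continuous.
elim: n => [|n IH].
  rewrite [X in X @ _](_ : _ = (fun t => t * isqrt (b + t ^+ 2) * isqrt (b + t ^+ 2))).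
    by rewrite -(mulr0 1); apply: cvgM.
  by apply/funext => t; rewrite expr2 mulrA.
rewrite [X in X @ _](_ : _ =
    (fun t => t * isqrt (b + t ^+ 2) ^+ n.+2 * isqrt (b + t ^+ 2))).
  by rewrite -(mulr0 0); apply: cvgM.
by apply/funext => t; rewrite [in LHS]exprSr mulrA.
Qed.

Lemma antideriv1 b : 0 < b ->
  antideriv b 3 (fun t => b^-1 * (t * isqrt (b + t ^+ 2))) b^-1.
Proof.
move=> b0; split.
- by rewrite mul0r mulr0.
- move=> t.
  have D := is_derive_mulf (is_derive_cst b^-1 t 1)
    (is_derive_mulf (is_derive_id t 1) (is_derive_isqrt_line t b0)).
  apply: is_derive_eq D _.
  have bt := addsqr_gt0 t b0.
  have Q : isqrt (b + t ^+ 2) * isqrt (b + t ^+ 2) = (b + t ^+ 2)^-1.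
    by rewrite -expr2 isqrt_sqr// ltW.
  rewrite /= !exprS !expr0 !mulr1 Q; field.
  by rewrite !gt_eqF.
- rewrite -[X in _ --> X]mulr1; apply: cvgM; first exact: cvg_cst.
  exact: cvgy_mul_isqrt.
Qed.

Lemma antideriv2 b : 0 < b ->
  antideriv b 2 (fun t => isqrt b * atan (isqrt b * t)) (isqrt b * (pi / 2)).
Proof.
move=> b0; split.
- by rewrite mulr0 atan0 mulr0.
- move=> t.
  have D := is_derive_mulf (is_derive_cst (isqrt b) t 1)
    (is_derive_comp_real (is_derive_mulf (is_derive_cst (isqrt b) t 1)
      (is_derive_id t 1)) (is_derive1_atan _)).
  apply: is_derive_eq D _.
  have bt := addsqr_gt0 t b0.
  rewrite /= (isqrt_sqr (ltW bt)) exprMn (isqrt_sqr (ltW b0)).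
  have -> : isqrt b * ((1 + b^-1 * t ^+ 2)^-1 * (isqrt b * 1 + t * 0)) +
     atan (isqrt b * t) * 0 = isqrt b ^+ 2 * (1 + b^-1 * t ^+ 2)^-1 by ring.
  rewrite (isqrt_sqr (ltW b0)); field.
  by rewrite !gt_eqF.
- apply: cvgM; first exact: cvg_cst.
  apply: (@cvg_comp _ _ _ (fun t : R => isqrt b * t) (@atan R)); last exact: cvgy_atan.
  by apply: gt0_cvgMry => //; exact: isqrt_gt0.
Qed.

(** The reduction formula of integration by parts: with [q = (b + t^2)^(-1/2)] and [m = n + 2], the
    derivative of [t q^m] is [(1 - m) q^m + m b q^(m+2)], and adding [(m - 1) F] cancels the first
    term. The boundary term [t q^m] vanishes at infinity. *)
Lemma antiderivSS b n F l : 0 < b -> antideriv b n.+2 F l ->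
  antideriv b n.+4
    (fun t => (n.+2%:R * b)^-1 * (t * isqrt (b + t ^+ 2) ^+ n.+2 + n.+1%:R * F t))
    ((n.+2%:R * b)^-1 * (n.+1%:R * l)).
Proof.
move=> b0 [F0 F' Fl]; split.
- by rewrite F0 mul0r !mulr0 addr0 mulr0.
- move=> t.
  have D := is_derive_mulf (is_derive_cst (n.+2%:R * b)^-1 t 1)
    (is_derive_addf
       (is_derive_mulf (is_derive_id t 1)
         (is_derive_expf n.+2 (is_derive_isqrt_line t b0)))
       (is_derive_mulf (is_derive_cst (n.+1%:R : R) t 1) (F' t))).
  apply: is_derive_eq D _.
  have bt := addsqr_gt0 t b0.
  have Q : isqrt (b + t ^+ 2) * isqrt (b + t ^+ 2) = (b + t ^+ 2)^-1.
    by rewrite -expr2 isqrt_sqr// ltW.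
  have m0 : n.+2%:R != 0 :> R by rewrite pnatr_eq0.
  have -> : n.+1%:R = n.+2%:R - 1 :> R by rewrite -(natrB _ (n := 1)) ?subn1.
  rewrite /cst /=; move: m0 Q (isqrt_gt0 bt).
  set m : R := _%:R; set q := isqrt _; set P := q ^+ n => m0 Q q0.
  rewrite !(exprS q) -/P expr0.
  have -> : m * (q * P) * (- t * (q * (q * (q * 1)))) =
      - m * P * t * (q * q) ^+ 2 by ring.
  have -> : q * (q * (q * (q * P))) = (q * q) ^+ 2 * P by ring.
  have -> : q * (q * P) = (q * q) * P by ring.
  by rewrite Q; clearbody m; field; rewrite m0 !gt_eqF.
- rewrite -(add0r (n.+1%:R * l)); apply: cvgM; first exact: cvg_cst.
  apply: cvgD; first exact: cvgy_mul_isqrtX.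
  by apply: cvgM => //; exact: cvg_cst.
Qed.

Lemma continuous_isqrtX_line b c n : 0 < b ->
  continuous (fun t => isqrt (b + (t - c) ^+ 2) ^+ n).
Proof.
move=> b0 t; apply: (@continuous_expf _ _ (fun t => isqrt (b + (t - c) ^+ 2))).
apply: (@continuous_isqrt _ _ (fun t => b + (t - c) ^+ 2)).
  exact: addsqr_gt0.
apply: continuous_addf; first exact: cvg_cst.
apply: continuous_expf.
by apply: continuous_addf; [exact: cvg_id|exact: cvg_cst].
Qed.

Lemma integral_shift (G : R -> R) c : continuous G -> (forall t, 0 <= G t) ->
  (\int[mu]_t (G (t - c))%:E = \int[mu]_t (G t)%:E)%E.
Proof.
move=> cG G0.
have D (x : R) : is_derive x 1 (fun t : R => t - c) 1.
  have D := is_derive_addf (is_derive_id x 1) (is_derive_cst (- c) x 1).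
  by apply: is_derive_eq D _; rewrite addr0.
have D1 : (fun t => t - c)^`()%classic = cst 1.
  by apply/funext => x; rewrite derive1E; have [_ ->] := D x.
rewrite [RHS](@increasing_ge0_integration_by_substitutionT _ (fun t => t - c) G)//.
- by apply: eq_integral => t _; rewrite D1 /GRing.mul/= mulr1.
- by move=> x y xy; rewrite ltrD2r.
- by rewrite D1; exact: cst_continuous.
- by rewrite D1; exact: is_cvg_cst.
- by rewrite D1; exact: is_cvg_cst.
- by apply: cvg_addrr_Ny.
- by apply: cvg_addrr.
Qed.

Lemma integral_line b n F l c : 0 < b -> antideriv b n F l ->
  (\int[mu]_t (isqrt (b + (t - c) ^+ 2) ^+ n)%:E = (2 * l)%:E)%E.
Proof.
move=> b0 [F0 F' Fl].
have cf : continuous (fun t => isqrt (b + t ^+ 2) ^+ n).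
  by have := @continuous_isqrtX_line b 0 n b0; under eq_fun do rewrite subr0.
have f0 t : 0 <= isqrt (b + t ^+ 2) ^+ n by rewrite exprn_ge0// isqrt_ge0.
rewrite (integral_shift c cf f0) ge0_symfun_integralT//; last first.
  by move=> t /=; rewrite sqrrN.
rewrite -set_itvcy (@ge0_continuous_FTC2y _ _ F _ l)//.
- by rewrite F0 sube0 -EFinM.
- exact: continuous_subspaceT.
- by apply: cvg_at_right_filter; apply/differentiable_continuous/derivable1_diffP.
- by move=> x _; rewrite derive1E; have [_ ->] := F' x.
Qed.

(** The exponent [n.-1] is forced by scaling [t] by the square root of [b]. With [b] replaced by [b]
    plus the squares of other coordinates, the result is again an integrand of this family, with
    exponent one lower. *)
Definition line_power n (k : R) := forall b c : R, 0 < b ->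
  (\int[mu]_t (isqrt (b + (t - c) ^+ 2) ^+ n)%:E = (k * isqrt b ^+ n.-1)%:E)%E.

Lemma line_power2 : line_power 2 pi.
Proof.
move=> b c b0; rewrite (integral_line c b0 (antideriv2 b0)); congr _%:E.
by rewrite expr1; field.
Qed.

Lemma line_power3 : line_power 3 2.
Proof.
move=> b c b0; rewrite (integral_line c b0 (antideriv1 b0)); congr _%:E.
by rewrite /= (isqrt_sqr (ltW b0)).
Qed.

Lemma line_power4 : line_power 4 (pi / 2).
Proof.
move=> b c b0; rewrite (integral_line c b0 (antiderivSS b0 (antideriv2 b0))).
congr _%:E; rewrite /= [isqrt b ^+ 3]exprS (isqrt_sqr (ltW b0)); field.
by rewrite gt_eqF.
Qed.

Lemma line_power5 : line_power 5 (4 / 3).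
Proof.
move=> b c b0; rewrite (integral_line c b0 (antiderivSS b0 (antideriv1 b0))).
congr _%:E; rewrite /= -[4%N]/(2 * 2)%N exprM (isqrt_sqr (ltW b0)); field.
by rewrite gt_eqF.
Qed.

End LineIntegrals.

(** * Lebesgue measure on space as a sigma-finite product *)

Lemma sigma_finite_product d1 d2 (T1 : measurableType d1)
    (T2 : measurableType d2) (R : realType)
    (m1 : {sigma_finite_measure set T1 -> \bar R})
    (m2 : {sigma_finite_measure set T2 -> \bar R}) :
  sigma_finite setT (m1 \x m2)%E.
Proof.
have /sigma_finiteP[F [TF ndF Foo]] := sigma_finiteT m1.
have /sigma_finiteP[G [TG ndG Goo]] := sigma_finiteT m2.
(* Diagonal products suffice because both exhaustions are increasing: a point in [F n] and [G k] is
   covered at index [maxn n k]. *)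
exists (fun n => F n `*` G n); last first.
  move=> k; have [mF Fk] := Foo k; have [mG Gk] := Goo k.
  split; first exact: measurableX.
  by rewrite product_measure1E// lte_mul_pinfty// ge0_fin_numE.
apply/esym; rewrite -subTset => -[x y] _.
have [n _ Fn] : (\bigcup_i F i) x by rewrite -TF.
have [k _ Gk] : (\bigcup_i G i) y by rewrite -TG.
exists (maxn n k) => //; split.
- by move: x Fn; exact/subsetPset/ndF/leq_maxl.
- by move: y Gk; exact/subsetPset/ndG/leq_maxr.
Qed.

(* The library's canonical sigma-finite structure on a product of measures only
   fires for sub-probabilities, hence the aliases. *)
Definition area (R : realType) :=
  (@lebesgue_measure R \x @lebesgue_measure R)%E.
Arguments area : clear implicits.

HB.instance Definition _ (R : realType) := Measure.on (area R).
HB.instance Definition _ (R : realType) :=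
  Measure_isSigmaFinite.Build _ _ _ (area R)
    (sigma_finite_product (@lebesgue_measure R) (@lebesgue_measure R)).

Definition vol (R : realType) := (area R \x @lebesgue_measure R)%E.
Arguments vol : clear implicits.

HB.instance Definition _ (R : realType) := Measure.on (vol R).
HB.instance Definition _ (R : realType) :=
  Measure_isSigmaFinite.Build _ _ _ (vol R)
    (sigma_finite_product (area R) (@lebesgue_measure R)).

(** * Integrals over space by iteration over the coordinates *)

Section SpaceIntegrals.
Context {R : realType}.
Let mu := @lebesgue_measure R.
Local Notation T := (R3m R).
Local Notation vol := (vol R).

Lemma measurable_isqrt : measurable_fun [set: R] (@isqrt R).
Proof.
rewrite (_ : isqrt = (fun t => t `^ (-1)) \o Num.sqrt); last first.
  by apply/funext => t /=; rewrite powR_inv1// sqrtr_ge0.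
apply: measurableT_comp; first exact: measurable_powR.
by apply: continuous_measurable_fun; exact: sqrt_continuous.
Qed.

Lemma measurable_borelR d (U : measurableType d) (f : U -> measurableTypeR R) :
  measurable_fun setT f -> measurable_fun setT (f : U -> R).
Proof. by []. Qed.

Lemma measurable_fun_coord d (U : measurableType d) (f : U -> T) k :
  measurable_fun setT f -> measurable_fun setT (fun u => coord3 k (f u)).
Proof.
move=> mf; apply: measurable_borelR.
have m1 : measurable_fun setT (fun u => (f u).1) by exact: measurableT_comp.
case: k => -[|[|[|//]]] ?; rewrite /coord3/=.
- exact: measurableT_comp m1.
- exact: measurableT_comp m1.
- exact: measurableT_comp mf.
Qed.

Definition dist2 (x y : R3 R) : R := \sum_k (coord3 k x - coord3 k y) ^+ 2.

Lemma dist2E x y : dist2 x y =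
  (x.1.1 - y.1.1) ^+ 2 + (x.1.2 - y.1.2) ^+ 2 + (x.2 - y.2) ^+ 2.
Proof. by rewrite /dist2 !big_ord_recl big_ord0 addr0 addrA. Qed.

Lemma dist2_ge0 x y : 0 <= dist2 x y.
Proof. by apply: sumr_ge0 => k _; exact: sqr_ge0. Qed.

Lemma dist2C x y : dist2 x y = dist2 y x.
Proof. by apply: eq_bigr => k _; rewrite -sqrrN opprB. Qed.

Lemma enorm_sqr (x y : R3 R) : enorm (x - y) ^+ 2 = dist2 x y.
Proof.
rewrite sqr_sqrtr; last by apply: sumr_ge0 => k _; exact: sqr_ge0.
by rewrite dist2E !big_ord_recl big_ord0 addr0 addrA.
Qed.

Lemma measurable_dist2 d (U : measurableType d) (f g : U -> T) :
  measurable_fun setT f -> measurable_fun setT g ->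
  measurable_fun setT (fun u => dist2 (f u) (g u)).
Proof.
move=> mf mg; apply: measurable_sum => k.
apply: measurable_funX; apply: measurable_funB; exact: measurable_fun_coord.
Qed.

Lemma measurable_isqrt_dist2 d (U : measurableType d) (f g : U -> T) b n :
  measurable_fun setT f -> measurable_fun setT g ->
  measurable_fun setT (fun u => isqrt (b + dist2 (f u) (g u)) ^+ n).
Proof.
move=> mf mg; apply: measurable_funX.
apply: (measurableT_comp measurable_isqrt).
by apply: measurable_funD => //; exact: measurable_dist2.
Qed.

Lemma tonelli3 (f : T -> \bar R) : measurable_fun setT f ->
  (forall x, 0 <= f x)%E ->
  (\int[vol]_x f x = \int[mu]_a \int[mu]_b \int[mu]_c f (a, b, c))%E.
Proof.
move=> mf f0; rewrite fubini_tonelli1// fubini_tonelli1//.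
- exact: measurable_fun_fubini_tonelli_F.
- by move=> x; apply: integral_ge0 => y _; exact: f0.
Qed.

(** The coordinates are integrated out one at a time, the remaining squares being absorbed in the
    parameter of [line_power]; the exponent drops from [n.+3] to [n] in three steps. *)
Lemma integral_space b y n k1 k2 k3 : 0 < b -> 0 <= k1 -> 0 <= k2 ->
  line_power n.+3 k1 -> line_power n.+2 k2 -> line_power n.+1 k3 ->
  (\int[vol]_x (isqrt (b + dist2 x y) ^+ n.+3)%:E =
   (k1 * k2 * k3 * isqrt b ^+ n)%:E)%E.
Proof.
move=> b0 k1_ge0 k2_ge0 L1 L2 L3; rewrite tonelli3; last 2 first.
- by apply/measurable_EFinP; exact: measurable_isqrt_dist2.
- by move=> x; rewrite lee_fin exprn_ge0// isqrt_ge0.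
have mI (f : R -> R) m : measurable_fun setT f ->
    measurable_fun [set: measurableTypeR R] (fun t => (isqrt (f t) ^+ m)%:E).
  move=> mf; apply/measurable_EFinP; apply: measurable_funX.
  exact: (measurableT_comp measurable_isqrt).
have mS (a c : R) : measurable_fun setT (fun t : R => a + (t - c) ^+ 2).
  apply: measurable_funD => //; apply: measurable_funX.
  exact: measurable_funB.
have I1 u v : (\int[mu]_w (isqrt (b + dist2 (u, v, w) y) ^+ n.+3)%:E =
    k1%:E * (isqrt (b + (u - y.1.1) ^+ 2 + (v - y.1.2) ^+ 2) ^+ n.+2)%:E)%E.
  under eq_integral => w _ do rewrite dist2E /= !addrA.
  by rewrite L1 ?EFinM// ltr_wpDr ?sqr_ge0// addsqr_gt0.
have I2 u : (\int[mu]_v (k1%:E *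
      (isqrt (b + (u - y.1.1) ^+ 2 + (v - y.1.2) ^+ 2) ^+ n.+2)%:E) =
    (k1 * k2)%:E * (isqrt (b + (u - y.1.1) ^+ 2) ^+ n.+1)%:E)%E.
  rewrite ge0_integralZl_EFin//.
  - by rewrite L2 ?EFinM ?muleA// addsqr_gt0.
  - by move=> v _; rewrite lee_fin exprn_ge0// isqrt_ge0.
  - exact: mI.
transitivity (\int[mu]_u ((k1 * k2)%:E *
    (isqrt (b + (u - y.1.1) ^+ 2) ^+ n.+1)%:E))%E.
  apply: eq_integral => u _; rewrite -I2.
  by apply: eq_integral => v _; exact: I1.
rewrite ge0_integralZl_EFin//.
- by rewrite L3//= !EFinM !muleA.
- by move=> v _; rewrite lee_fin exprn_ge0// isqrt_ge0.
- exact: mI.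
- by rewrite mulr_ge0.
Qed.

Lemma integral_isqrt_dist4 b y : 0 < b ->
  (\int[vol]_x (isqrt (b + dist2 x y) ^+ 4)%:E = (pi ^+ 2 * isqrt b)%:E)%E.
Proof.
move=> b0; have pi0 := pi_ge0 R.
rewrite (integral_space _ b0 _ _ line_power4 line_power3 line_power2)//.
  by rewrite expr1; congr _%:E; field.
by rewrite divr_ge0.
Qed.

Lemma integral_isqrt_dist5 b y : 0 < b ->
  (\int[vol]_x (isqrt (b + dist2 x y) ^+ 5)%:E = (4 * pi / 3 / b)%:E)%E.
Proof.
move=> b0; have pi0 := pi_ge0 R.
rewrite (integral_space _ b0 _ _ line_power5 line_power4 line_power3).
- by rewrite (isqrt_sqr (ltW b0)); congr _%:E; field; rewrite gt_eqF.
- by rewrite divr_ge0.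
- by rewrite divr_ge0.
Qed.

End SpaceIntegrals.

(** * Tonelli for kernels with uniformly bounded column integrals *)

Section KernelBounds.
Local Open Scope ereal_scope.
Context d1 d2 (T1 : measurableType d1) (T2 : measurableType d2) (R : realType).
Variables (m1 : {sigma_finite_measure set T1 -> \bar R})
  (m2 : {sigma_finite_measure set T2 -> \bar R}).

Lemma integral_set_indic (f : T1 -> \bar R) (A : set T1) :
  \int[m1]_(x in A) f x = \int[m1]_x ((\1_A x)%:E * f x).
Proof.
rewrite integral_mkcond; apply: eq_integral => x _.
by rewrite /patch indicE; case: ifPn => _; rewrite ?mul1e ?mul0e.
Qed.

Lemma tonelli_set (f : T1 * T2 -> \bar R) (A : set T1) : measurable A ->
  measurable_fun setT f -> (forall z, 0 <= f z) ->
  \int[m1]_(x in A) \int[m2]_y f (x, y) =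
  \int[m2]_y \int[m1]_(x in A) f (x, y).
Proof.
move=> mA mf f0; pose g z := ((\1_A z.1)%:E * f z).
have mg : measurable_fun setT g.
  apply: emeasurable_funM => //; apply/measurable_EFinP.
  exact: (measurableT_comp (measurable_indic mA)).
have g0 z : 0 <= g z by rewrite mule_ge0// lee_fin indicE ler0n.
rewrite integral_set_indic; transitivity (\int[m1]_x \int[m2]_y g (x, y)).
  apply: eq_integral => x _; rewrite /g/= ge0_integralZl_EFin//.
  exact: measurableT_comp.
rewrite (fubini_tonelli g)//; apply: eq_integral => y _.
by rewrite [RHS]integral_set_indic.
Qed.

(** The L^1 case of the Schur test: after exchanging the integrals, the inner one is a column
    integral of the kernel, bounded by [M] independently of [y]. *)
Lemma integral_kernel_le (k : T1 * T2 -> R) (F : T2 -> R) (A : set T1)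
    (M : R) : measurable A -> measurable_fun setT k -> measurable_fun setT F ->
  (forall z, 0 <= k z)%R -> (forall y, 0 <= F y)%R -> (0 <= M)%R ->
  (forall y, \int[m1]_(x in A) (k (x, y))%:E <= M%:E) ->
  \int[m1]_(x in A) \int[m2]_y (k (x, y) * F y)%:E <=
  M%:E * \int[m2]_y (F y)%:E.
Proof.
move=> mA mk mF k0 F0 M0 kM.
rewrite (tonelli_set (f := fun z => (k z * F z.2)%:E))//; last 2 first.
- apply/measurable_EFinP; apply: measurable_funM => //.
  exact: measurableT_comp.
- by move=> z; rewrite lee_fin mulr_ge0.
have mky y : measurable_fun setT (fun x => (k (x, y))%:E).
  by apply/measurable_EFinP; exact: measurableT_comp.
have E y : \int[m1]_(x in A) (k (x, y) * F y)%:E =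
    (F y)%:E * \int[m1]_(x in A) (k (x, y))%:E.
  rewrite -ge0_integralZl_EFin//.
  - by apply: eq_integral => x _; rewrite -EFinM mulrC.
  - by move=> x _; rewrite lee_fin.
  - exact: measurable_funTS.
rewrite -ge0_integralZl_EFin//; last 2 first.
- by move=> y _; rewrite lee_fin.
- exact/measurable_EFinP.
apply: ge0_le_integral => //=.
- by move=> y _; apply: integral_ge0 => x _; rewrite lee_fin mulr_ge0.
- under eq_fun do rewrite integral_set_indic.
  apply: (measurable_fun_fubini_tonelli_G
    (fun z : T1 * T2 => (\1_A z.1)%:E * (k z * F z.2)%:E)).
  + apply: emeasurable_funM; apply/measurable_EFinP.
      exact: (measurableT_comp (measurable_indic mA)).
    by apply: measurable_funM => //; exact: measurableT_comp.
  + by move=> z; rewrite mule_ge0// lee_fin ?mulr_ge0// indicE ler0n.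
- by apply: measurable_funeM; exact/measurable_EFinP.
- by move=> y _; rewrite E muleC lee_wpmul2r// lee_fin.
Qed.

End KernelBounds.

(** * Local integrability of the inverse squared distance *)

Section LocalIntegrability.
Context {R : realType}.
Local Notation T := (R3m R).
Local Notation vol := (vol R).
Implicit Types (x y : R3 R) (b : R).

(** At [b = 0] this is the true inverse distance, with the default value 0 on the diagonal. *)
Definition invdist b x y : R := isqrt (b + dist2 x y).

Lemma invdist_ge0 b x y : 0 <= invdist b x y.
Proof. exact: isqrt_ge0. Qed.

Lemma invdist_sqr b x y : 0 <= b -> invdist b x y ^+ 2 = (b + dist2 x y)^-1.
Proof. by move=> b0; rewrite isqrt_sqr// addr_ge0// dist2_ge0. Qed.

Lemma invdistC b x y : invdist b x y = invdist b y x.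
Proof. by rewrite /invdist dist2C. Qed.

Lemma measurable_invdistX d (U : measurableType d) (f g : U -> T) b n :
  measurable_fun setT f -> measurable_fun setT g ->
  measurable_fun setT (fun u => invdist b (f u) (g u) ^+ n).
Proof. exact: measurable_isqrt_dist2. Qed.

Lemma measurable_invdistXl b n y : measurable_fun [set: T] (fun x => invdist b x y ^+ n).
Proof. by apply: measurable_invdistX. Qed.

Lemma measurable_invdistXr b n x : measurable_fun [set: T] (fun y => invdist b x y ^+ n).
Proof. by apply: measurable_invdistX. Qed.

(* Telescoped over [b = 4^-n] this bounds the integral of [|x - y|^-2] over a
   set, uniformly in [y], without spherical coordinates. *)
Lemma invdist_step b x y : 0 < b ->
  invdist (b / 4) x y ^+ 2 - invdist b x y ^+ 2 <=
  3 * (b / 4) * invdist (b / 4) x y ^+ 4.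
Proof.
move=> b0; rewrite (exprM _ 2 2).
have b4 : 0 < b / 4 by rewrite divr_gt0.
rewrite !invdist_sqr ?(ltW b0) ?(ltW b4)//; set d := dist2 x y.
have d0 : 0 <= d by exact: dist2_ge0.
have h1 : 0 < b / 4 + d by rewrite ltr_wpDr// divr_gt0.
have h2 : 0 < b + d by rewrite ltr_wpDr.
have -> : (b / 4 + d)^-1 - (b + d)^-1 = 3 * (b / 4) * (b / 4 + d)^-1 * (b + d)^-1.
  by field; rewrite !gt_eqF//; nra.
rewrite expr2 [leRHS]mulrA; apply: ler_wpM2l.
  by rewrite mulr_ge0 ?invr_ge0 ?(ltW h1)// mulr_ge0// (ltW b4).
by rewrite lef_pV2 ?posrE//; lra.
Qed.

Lemma invdist_le b c x y : 0 < c -> c <= b -> invdist b x y ^+ 2 <= invdist c x y ^+ 2.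
Proof.
move=> c0 cb; have b0 := lt_le_trans c0 cb.
have d0 := dist2_ge0 x y.
by rewrite (invdist_sqr _ _ (ltW b0)) (invdist_sqr _ _ (ltW c0)) lef_pV2 ?posrE ?lerD2r// ltr_wpDr.
Qed.

Lemma isqrt_pow4 n : isqrt (4^-1 ^+ n : R) = 2 ^+ n.
Proof.
rewrite /isqrt (_ : 4^-1 ^+ n = (2^-1 ^+ n) ^+ 2); last first.
  by rewrite -exprM mulnC exprM; congr (_ ^+ n); field.
by rewrite sqrtr_sqr ger0_norm ?exprn_ge0// exprVn invrK.
Qed.

Lemma pow4_gt0 n : 0 < 4^-1 ^+ n :> R.
Proof. by rewrite exprn_gt0// invr_gt0. Qed.

Lemma pow4_le1 n : 4^-1 ^+ n <= 1 :> R.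
Proof. by apply: exprn_ile1; lra. Qed.

Lemma cvg_pow4 : (fun n => 4^-1 ^+ n : R) @ \oo --> (0 : R).
Proof. by apply: cvg_expr; rewrite ger0_norm// invf_lt1//; lra. Qed.

(** By [invdist_step] and [integral_isqrt_dist4], passing from [4^-n] to [4^-(n+1)] costs at most [3
    * 4^-(n+1) * pi^2 * 2^(n+1) = 3 * pi^2 * 2^-(n+1)], and these costs sum to the stated bound. *)
Lemma integral_invdist_diff n y :
  (\int[vol]_x (invdist (4^-1 ^+ n) x y ^+ 2 - invdist 1 x y ^+ 2)%:E <=
   (3 * pi ^+ 2 * (1 - 2^-1 ^+ n))%:E)%E.
Proof.
have mD b c : measurable_fun [set: T]
    (fun x => (invdist b x y ^+ 2 - invdist c x y ^+ 2)%:E).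
  by apply/measurable_EFinP; apply: measurable_funB; exact: measurable_invdistXl.
elim: n => [|n IH].
  rewrite subrr mulr0 integral0_eq// => x _.
  by rewrite expr0 subrr.
set b := 4^-1 ^+ n in IH *; have b0 : 0 < b := pow4_gt0 n.
have bS : 4^-1 ^+ n.+1 = b / 4 :> R by rewrite exprSr.
pose F x : \bar R := (invdist b x y ^+ 2 - invdist 1 x y ^+ 2)%:E.
pose S x : \bar R := ((3 * (b / 4))%:E * (invdist (b / 4) x y ^+ 4)%:E)%E.
have F0 x : (0 <= F x)%E.
  by rewrite lee_fin subr_ge0 invdist_le// pow4_le1.
have S0 x : (0 <= S x)%E.
  by rewrite /S -EFinM lee_fin mulr_ge0 ?exprn_even_ge0//; lra.
have mS : measurable_fun [set: T] S.
  by apply: measurable_funeM; apply/measurable_EFinP; exact: measurable_invdistXl.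
apply: (@le_trans _ _ (\int[vol]_x (F x + S x))%E).
  apply: ge0_le_integral => //.
  - move=> x _; rewrite bS lee_fin subr_ge0 invdist_le//; first by rewrite divr_gt0.
    by rewrite ler_pdivrMr// (le_trans (pow4_le1 n))//; lra.
  - by apply: emeasurable_funD => //; exact: mD.
  - move=> x _; rewrite bS /F /S -EFinM -EFinD lee_fin.
    by have := invdist_step x y b0; lra.
rewrite ge0_integralD//; last exact: mD.
rewrite ge0_integralZl_EFin//; last 3 first.
- by move=> x _; rewrite lee_fin exprn_even_ge0.
- by apply/measurable_EFinP; exact: measurable_invdistXl.
- by rewrite mulr_ge0// divr_ge0// ltW.
rewrite integral_isqrt_dist4; last by rewrite divr_gt0.
rewrite -bS isqrt_pow4 -EFinM.
apply: (le_trans (leeD2r _ IH)); rewrite -EFinD lee_fin.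
have -> : 4^-1 ^+ n.+1 = 2^-1 ^+ n.+1 * 2^-1 ^+ n.+1 :> R.
  by rewrite -exprMn; congr (_ ^+ _); field.
have -> : 2 ^+ n.+1 = (2^-1 ^+ n.+1)^-1 :> R by rewrite exprVn invrK.
have -> : 2^-1 ^+ n = 2 * 2^-1 ^+ n.+1 :> R by rewrite exprS mulrA divff ?mul1r.
rewrite le_eqVlt; apply/orP; left; apply/eqP; field.
by rewrite expf_neq0// invr_neq0.
Qed.

(** Subtracting [invdist 1 x y ^+ 2] leaves an excess whose integral over all of space is bounded in
    [n]; the subtracted part is at most 1 and costs the volume of [A]. *)
Lemma integral_invdist_set n y (A : set T) : measurable A ->
  (\int[vol]_(x in A) (invdist (4^-1 ^+ n) x y ^+ 2)%:E <=
   (3 * pi ^+ 2)%:E + vol A)%E.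
Proof.
move=> mA.
pose F x : \bar R := (invdist (4^-1 ^+ n) x y ^+ 2 - invdist 1 x y ^+ 2)%:E.
have F0 x : (0 <= F x)%E.
  by rewrite lee_fin subr_ge0 invdist_le ?pow4_le1 ?pow4_gt0.
have mF : measurable_fun [set: T] F.
  by apply/measurable_EFinP; apply: measurable_funB; exact: measurable_invdistXl.
apply: (@le_trans _ _ (\int[vol]_(x in A) (F x + 1))%E).
  apply: ge0_le_integral => //.
  - by move=> x _; rewrite lee_fin sqr_ge0.
  - by apply/measurable_EFinP; apply: measurable_funTS; exact: measurable_invdistXl.
  - by apply: emeasurable_funD => //; exact: measurable_funTS.
  - move=> x _; rewrite -EFinD lee_fin.
    have : invdist 1 x y ^+ 2 <= 1.
      by rewrite invdist_sqr// invf_le1 ?lerDl ?dist2_ge0// ltr_pwDl ?dist2_ge0.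
    lra.
rewrite ge0_integralD//; last exact: measurable_funTS.
rewrite (integral_cst _ mA) mul1e leeD2r//.
apply: le_trans; last first.
  apply: (le_trans (integral_invdist_diff n y)); rewrite lee_fin.
  have a0 : 0 <= 2^-1 ^+ n :> R by rewrite exprn_ge0.
  by apply: ler_piMr; [rewrite mulr_ge0 ?sqr_ge0|lra].
by apply: ge0_subset_integral.
Qed.

Lemma integral_invdist0_set y (A : set T) : measurable A ->
  (\int[vol]_(x in A) (invdist 0 x y ^+ 2)%:E <= (3 * pi ^+ 2)%:E + vol A)%E.
Proof.
move=> mA.
(* The second factor is the indicator of [x <> y]. It is needed because on the diagonal the
   regularized values increase to infinity, whereas [invdist 0] is 0 there by default. *)
pose f n x : \bar R :=
  (invdist (4^-1 ^+ n) x y ^+ 2 * (dist2 x y * invdist 0 x y ^+ 2))%:E.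
have d1 x : dist2 x y * invdist 0 x y ^+ 2 = (dist2 x y != 0)%:R.
  rewrite invdist_sqr// add0r; have [->|d0] := eqVneq (dist2 x y) 0.
    by rewrite mul0r.
  by rewrite divff.
have f0 n x : A x -> (0 <= f n x)%E.
  by move=> _; rewrite lee_fin d1 mulr_ge0// sqr_ge0.
have mf n : measurable_fun A (f n).
  apply: measurable_funTS; apply/measurable_EFinP; apply: measurable_funM.
    exact: measurable_invdistXl.
  by apply: measurable_funM; [exact: measurable_dist2|exact: measurable_invdistXl].
have nd x : A x -> {homo f^~ x : n m / (n <= m)%N >-> (n <= m)%E}.
  move=> _ n m nm; rewrite lee_fin d1 ler_wpM2r// invdist_le ?pow4_gt0//.
  by apply: ler_wiXn2l => //; lra.
have fl x : f ^~ x @ \oo --> (invdist 0 x y ^+ 2)%:E.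
  rewrite /f d1 invdist_sqr// add0r; have [d0|d0] := eqVneq (dist2 x y) 0.
    by under eq_fun do rewrite mulr0; rewrite d0 invr0; exact: cvg_cst.
  apply: cvg_EFin; first exact: nearW.
  rewrite /comp/=; under eq_fun do rewrite mulr1 invdist_sqr ?ltW ?pow4_gt0//.
  apply: cvgV => //; rewrite -[X in _ --> X]add0r.
  by apply: cvgD; [exact: cvg_pow4|exact: cvg_cst].
have C := cvg_monotone_convergence (mu := vol) mA mf f0 nd.
have -> : (\int[vol]_(x in A) (invdist 0 x y ^+ 2)%:E =
    \int[vol]_(x in A) limn (f ^~ x))%E.
  by apply: eq_integral => x _; apply/esym/cvg_lim.
rewrite -(cvg_lim _ C)//; apply: lime_le; first by apply/cvg_ex; eexists; exact: C.
apply: nearW => n; apply: le_trans (integral_invdist_set n y mA).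
apply: ge0_le_integral => //.
- by move=> x Ax; exact: f0.
- by apply: measurable_funTS; apply/measurable_EFinP; exact: measurable_invdistXl.
- by move=> x _; rewrite lee_fin d1 ler_piMr ?sqr_ge0// lern1 leq_b1.
Qed.

(** The bound on the integral of [|x - y|^-2] over [A] is uniform in [y], so the Schur estimate
    applies to an L^1 density. This yields local integrability of the dominating potential and its
    finiteness almost everywhere. *)
Lemma integral_riesz_lty (F : T -> R) (A : set T) : measurable A ->
  (vol A < +oo)%E -> (forall x, 0 <= F x) -> vol.-integrable setT (EFin \o F) ->
  (\int[vol]_(x in A) \int[vol]_y (invdist 0 x y ^+ 2 * F y)%:E < +oo)%E.
Proof.
move=> mA Afin F0 iF.
have mF : measurable_fun [set: T] F.
  by apply/measurable_EFinP; exact: measurable_int iF.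
have Ar : vol A = (fine (vol A))%:E by rewrite fineK// ge0_fin_numE.
have := @integral_kernel_le _ _ _ _ _ vol vol
  (fun z => invdist 0 z.1 z.2 ^+ 2) F A (3 * pi ^+ 2 + fine (vol A)) mA.
move=> /(_ _ mF _ F0) /=; move/(_ _ _ _ _)/le_lt_trans; apply => //.
- exact: measurable_invdistX.
- by move=> z; exact: sqr_ge0.
- by rewrite addr_ge0 ?fine_ge0// mulr_ge0 ?sqr_ge0.
- by move=> y; rewrite EFinD -Ar; exact: integral_invdist0_set.
- rewrite lte_mul_pinfty//; last exact: (integrable_lty measurableT iF).
  by rewrite lee_fin addr_ge0 ?fine_ge0// mulr_ge0 ?sqr_ge0.
Qed.

End LocalIntegrability.

(** * Measures with a density *)

Section Density.
Context d (T : measurableType d) (R : realType) (mu : {measure set T -> \bar R}).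
Variables (f : T -> \bar R) (f0 : forall x, (0 <= f x)%E)
  (mf : measurable_fun setT f).

(** Packaged as a measure so that uniqueness of measures on a pi-system applies to the positive and
    negative parts of a function. The two proofs are arguments so that the measure structure can be
    attached to the term. *)
Definition density of (forall x, (0 <= f x)%E) & measurable_fun setT f :
  set T -> \bar R := fun A => (\int[mu]_(x in A) f x)%E.

Let density0 : density f0 mf set0 = 0%E.
Proof. by rewrite /density integral_set0. Qed.

Let density_ge0 A : (0 <= density f0 mf A)%E.
Proof. by apply: integral_ge0 => x _. Qed.

Let density_sigma_additive : semi_sigma_additive (density f0 mf).
Proof.
move=> F mF tF mUF; rewrite /density ge0_integral_bigcup//.
- by apply: is_cvg_nneseries => n _ _; apply: integral_ge0.
- exact: measurable_funTS.
Qed.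

HB.instance Definition _ := isMeasure.Build _ _ _ (density f0 mf)
  density0 density_ge0 density_sigma_additive.

End Density.

(** * Boxes as a determining class for locally integrable functions *)

Section Boxes.
Context {R : realType}.
Local Notation T := (R3m R).
Local Notation vol := (vol R).
Implicit Types (a b : 'I_3 -> R) (x y : R3 R).

(** Half-open sides match the intervals that generate the Borel structure of the line, and such
    boxes are stable under intersection. *)
Definition box a b : set T :=
  (`]a 0, b 0] `*` `]a 1, b 1]) `*` `]a 2, b 2].

Lemma boxP a b x : box a b x <-> forall k, a k < coord3 k x <= b k.
Proof.
case: x => -[x0 x1] x2; rewrite /box/= !in_itv /=; split.
  move=> [[h0 h1] h2] [[|[|[|//]]] i]; rewrite /coord3/=.
  - by rewrite (_ : Ordinal i = 0)//; exact/val_inj.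
  - by rewrite (_ : Ordinal i = 1)//; exact/val_inj.
  - by rewrite (_ : Ordinal i = 2)//; exact/val_inj.
by move=> h; split; [split; [exact: (h 0)|exact: (h 1)]|exact: (h 2)].
Qed.

Lemma measurable_box a b : measurable (box a b).
Proof. by apply: measurableX; [apply: measurableX|]; exact: measurable_itv. Qed.

Lemma boxI a b a' b' : box a b `&` box a' b' =
  box (fun k => Num.max (a k) (a' k)) (fun k => Num.min (b k) (b' k)).
Proof.
apply/seteqP; split => x.
  move=> [/boxP h /boxP h']; apply/boxP => k.
  have /andP[h1 h2] := h k; have /andP[h3 h4] := h' k.
  by rewrite gt_max h1 h3 le_min h2 h4.
move/boxP => h; split; apply/boxP => k; have := h k.
  by rewrite gt_max le_min => /andP[/andP[-> _] /andP[-> _]].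
by rewrite gt_max le_min => /andP[/andP[_ ->] /andP[_ ->]].
Qed.

Lemma volX (A B C : set (measurableTypeR R)) :
  measurable A -> measurable B -> measurable C ->
  vol ((A `*` B) `*` C) = (@lebesgue_measure R A * @lebesgue_measure R B *
    @lebesgue_measure R C)%E.
Proof.
move=> mA mB mC; transitivity (area R (A `*` B) * @lebesgue_measure R C)%E.
  by apply: product_measure1E => //; exact: measurableX.
by congr (_ * _)%E; exact: product_measure1E.
Qed.

Lemma vol_box_lty a b : (vol (box a b) < +oo)%E.
Proof.
have fin (c d : R) : (@lebesgue_measure R `]c, d] < +oo)%E.
  by rewrite lebesgue_measure_itv; case: ifP => _; rewrite ?ltry.
rewrite /box volX//; try exact: measurable_itv.
by apply: lte_mul_pinfty => //; rewrite ?mule_ge0// ge0_fin_numE ?mule_ge0//;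
  apply: lte_mul_pinfty => //; rewrite ge0_fin_numE.
Qed.

Definition cube n : set T := box (fun=> - n%:R) (fun=> n%:R).

Lemma cube_cover : \bigcup_n cube n = setT.
Proof.
apply/seteqP; split => // x _.
exists (Num.bound (\sum_k `|coord3 k x|)).+1 => //; apply/boxP => k.
set n := Num.bound _.
have h : `|coord3 k x| < n.+1%:R.
  apply: (@le_lt_trans _ _ (\sum_k `|coord3 k x|)).
    by rewrite (bigD1 k)//= lerDl sumr_ge0.
  apply: lt_le_trans (archi_boundP _) _; first by rewrite sumr_ge0.
  by rewrite ler_nat.
by move: h; rewrite ltr_norml => /andP[-> /ltW ->].
Qed.

Definition boxes : set (set T) := [set A | exists a b, A = box a b].

(** A slab [c < x_k <= e] is a countable union of boxes, so the coordinates are measurable for the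
    sigma-algebra generated by boxes; hence so is the identity into the product structure. *)
Lemma sigma_boxes : @measurable _ T = <<s boxes >>.
Proof.
apply/seteqP; split; last first.
  apply: smallest_sub; first exact: sigma_algebra_measurable.
  by move=> _ [a [b ->]]; exact: measurable_box.
pose T' := g_sigma_algebraType boxes.
have coord_box c e k : <<s boxes >> [set x : T | c < coord3 k x <= e].
  rewrite (_ : [set x | _] = \bigcup_n box
      (fun j => if j == k then c else - n%:R) (fun j => if j == k then e else n%:R)).
    apply: (@bigcupT_measurable _ T') => n; apply: sub_sigma_algebra.
    by do 2 eexists.
  apply/seteqP; split => x.
    move=> /= hx; have : (\bigcup_n cube n) x by rewrite cube_cover.
    move=> [n _ /boxP hn]; exists n => //; apply/boxP => j.
    by case: eqVneq => [->|_].
  by move=> [n _ /boxP /(_ k)]; rewrite eqxx.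
have mcoord k : measurable_fun [set: T'] (coord3 k : T' -> measurableTypeR R).
  apply: (measurability (R.-ocitv.-measurable)) => //.
  move=> _ [_ [[c e] _ <-] <-]; rewrite setTI.
  rewrite (_ : _ @^-1` _ = [set x : T | c < coord3 k x <= e]).
    exact: coord_box.
  by apply/seteqP; split => x; rewrite /= in_itv.
have mid : measurable_fun [set: T'] (id : T' -> T).
  apply/measurable_fun_pairP; split; last exact: (mcoord 2).
  by apply/measurable_fun_pairP; split; [exact: (mcoord 0)|exact: (mcoord 1)].
by move=> A mA; have := mid measurableT A mA; rewrite setTI.
Qed.

(** On a fixed cube the positive and negative parts of [w] are densities of two finite measures that
    agree on the pi-system of boxes, hence on all measurable sets. So [w] integrates to 0 over every
    measurable subset of the cube, and countably many cubes cover space. *)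
Lemma box_ae_zero (w : T -> R) :
  (forall a b, vol.-integrable (box a b) (EFin \o w)) ->
  (forall a b, \int[vol]_(x in box a b) (w x)%:E = 0)%E ->
  {ae vol, forall x, w x = 0}.
Proof.
move=> iw w0.
suff N n : {ae vol, forall x, (w \_ (cube n)) x = 0}.
  have := ae_foralln N; apply: filterS => x h.
  have : (\bigcup_n cube n) x by rewrite cube_cover.
  by move=> [n _ xn]; have := h n; rewrite /patch mem_set.
have mC : measurable (cube n) by exact: measurable_box.
have iW : vol.-integrable setT (EFin \o (w \_ (cube n))).
  by rewrite -restrict_EFin; apply: (integrable_mkcond _ mC).1; exact: iw.
have mW : measurable_fun setT (EFin \o (w \_ (cube n))) by exact: measurable_int iW.
have E A : measurable A ->
    (\int[vol]_(x in A) ((EFin \o (w \_ (cube n)))^\+ x) =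
     \int[vol]_(x in A) ((EFin \o (w \_ (cube n)))^\- x))%E.
  pose m1 := density vol (funepos_ge0 (EFin \o (w \_ (cube n)))) (measurable_funepos mW).
  pose m2 := density vol (funeneg_ge0 (EFin \o (w \_ (cube n)))) (measurable_funeneg mW).
  have iWS B : measurable B -> vol.-integrable B (EFin \o (w \_ (cube n))).
    by move=> mB; exact: integrableS iW.
  apply: (@measure_unique _ _ _ boxes cube sigma_boxes _ _ cube_cover m1 m2).
  - by move=> _ _ [a [b ->]] [a' [b' ->]]; rewrite boxI; do 2 eexists.
  - by move=> k; do 2 eexists.
  - move=> _ [a [b ->]]; rewrite /m1 /m2 /density.
    have mb := measurable_box a b.
    (* A box cut by the cube is again a box, so the hypothesis on [w] covers it. *)
    have : (\int[vol]_(x in box a b) (EFin \o (w \_ (cube n))) x = 0)%E.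
      rewrite -(w0 (fun k => Num.max (a k) (- n%:R)) (fun k => Num.min (b k) n%:R)).
      rewrite -boxI -/(cube n) [RHS]integral_mkcondr; apply: eq_integral => x _.
      by rewrite /patch/=; case: ifP.
    rewrite integralE => /eqP; rewrite sube_eq; [by rewrite add0e => /eqP| |].
    + exact: integrable_pos_fin_num (iWS _ mb).
    + by rewrite fin_num_adde_defr.
  - move=> k; rewrite /m1 /density.
    have mk : measurable (cube k) by exact: measurable_box.
    by apply: integrable_lty => //; exact: integrable_funepos (iWS _ mk).
have Z : ae_eq vol setT (EFin \o (w \_ (cube n))) (cst 0%E).
  apply: integral_ae_eq => // A _ mA.
  rewrite integral0 integralE E// subee//.
  by apply: integrable_neg_fin_num => //; exact: integrableS iW.
by apply: filterS Z => x /(_ I) [].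
Qed.

Lemma vol_hyperplane k (c : R) : vol [set x | coord3 k x = c] = 0%E.
Proof.
have c0 : @lebesgue_measure R [set c] = 0%E by rewrite lebesgue_measure_set1.
case: k => -[|[|[|//]]] i.
- rewrite (_ : [set x | _] = ([set c] `*` setT) `*` setT); last first.
    by apply/seteqP; split => x; rewrite /coord3/= => // -[[]].
  by rewrite volX// c0 !mul0e.
- rewrite (_ : [set x | _] = (setT `*` [set c]) `*` setT); last first.
    by apply/seteqP; split => x; rewrite /coord3/= => // -[[]].
  by rewrite volX// c0 mule0 mul0e.
- rewrite (_ : [set x | _] = (setT `*` setT) `*` [set c]); last first.
    by apply/seteqP; split => x; rewrite /coord3/= => // -[[]].
  by rewrite volX// c0 mule0.
Qed.

Lemma measurable_hyperplane k (c : R) : measurable ([set x | coord3 k x = c] : set T).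
Proof.
have := measurable_fun_coord (f := (id : T -> T)) k (@measurable_id _ _ setT).
by move=> /(_ measurableT [set c] (measurable_set1 c)); rewrite setTI.
Qed.

Lemma ord3_pos_lower_bound (r : 'I_3 -> R) : (forall k, 0 < r k) ->
  exists2 e, 0 < e & forall k, e <= r k.
Proof.
move=> r0; exists (Num.min (r 0) (Num.min (r 1) (r 2))).
  by rewrite lt_min r0 lt_min !r0.
case=> -[|[|[|//]]] i.
- have -> : Ordinal i = 0 :> 'I_3 by exact/val_inj.
  by rewrite !ge_min lexx.
- have -> : Ordinal i = 1 :> 'I_3 by exact/val_inj.
  by rewrite !ge_min lexx orbT.
- have -> : Ordinal i = 2 :> 'I_3 by exact/val_inj.
  by rewrite !ge_min lexx !orbT.
Qed.

(** This says that [y] is not a boundary point of [A]; the radius is a squared distance, as in the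
    tail bound for the mollifier. *)
Definition locally_constant_at (A : set T) y :=
  exists2 r, 0 < r & forall x, dist2 x y < r -> (A x <-> A y).

(** The exceptional points lie on the six hyperplanes carrying the faces, each of volume 0.
    Elsewhere, any point closer to [y] than every such hyperplane satisfies the same coordinate
    inequalities. *)
Lemma box_locally_constant_ae a b :
  {ae vol, forall y : T, locally_constant_at (box a b) y}.
Proof.
have P k : {ae vol, forall y : T, coord3 k y <> a k /\ coord3 k y <> b k}.
  exists ([set x | coord3 k x = a k] `|` [set x | coord3 k x = b k]); split.
  - by apply: measurableU; exact: measurable_hyperplane.
  - by rewrite null_set_setU//; first [exact: measurable_hyperplane|exact: vol_hyperplane].
  - by move=> x /= /not_andP[] /contrapT; [left|right].
(* The three coordinates are reindexed by all natural numbers, vacuously from 3 on, so that the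
   countable intersection of almost sure properties applies. *)
have Q n : {ae vol, forall y : T, forall i : (n < 3)%N,
    coord3 (Ordinal i) y <> a (Ordinal i) /\ coord3 (Ordinal i) y <> b (Ordinal i)}.
  have [n3|n3] := pselect (n < 3)%N; last by apply: aeW => y i.
  apply: filterS (P (Ordinal n3)) => y h i.
  by rewrite (_ : Ordinal i = Ordinal n3)//; exact/val_inj.
apply: filterS (ae_foralln Q) => y hn.
have h k : coord3 k y <> a k /\ coord3 k y <> b k by case: k => n i; exact: hn.
pose r k : R := Num.min (`|coord3 k y - a k|) (`|coord3 k y - b k|).
have r0 k : 0 < r k.
  have [/eqP h1 /eqP h2] := h k.
  by rewrite lt_min !normr_gt0 !subr_eq0 h1 h2.
have [rr rr0 rrk] := ord3_pos_lower_bound r0.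
exists (rr ^+ 2); first exact: exprn_gt0.
move=> x xy.
suff S k : (a k < coord3 k x <= b k) = (a k < coord3 k y <= b k).
  by split=> /boxP g; apply/boxP => k; have := g k; rewrite S.
have xk : `|coord3 k x - coord3 k y| < r k.
  apply: lt_le_trans (rrk k).
  rewrite -(@ltr_pXn2r _ 2)// ?nnegrE ?(ltW rr0)// -normrX ger0_norm ?sqr_ge0//.
  apply: le_lt_trans xy; rewrite /dist2 (bigD1 k)//= lerDl sumr_ge0// => j _.
  exact: sqr_ge0.
move: xk; rewrite lt_min !ltr_norml => /andP[/andP[l1 u1] /andP[l2 u2]].
have [/eqP n1 /eqP n2] := h k.
have D1 : (a k < coord3 k x) = (a k < coord3 k y).
  have [g|g|/esym/eqP] := ltgtP (a k) (coord3 k y); last by rewrite (negbTE n1).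
    by move: l1 u1; rewrite ger0_norm ?subr_ge0 ?(ltW g)// => l1 u1; lra.
  by move: l1 u1; rewrite ltr0_norm ?subr_lt0// => l1 u1; apply/negbTE; rewrite -leNgt; lra.
have D2 : (coord3 k x <= b k) = (coord3 k y <= b k).
  have [g|g|/eqP] := ltgtP (coord3 k y) (b k); last by rewrite (negbTE n2).
    by move: l2 u2; rewrite ltr0_norm ?subr_lt0// => l2 u2; lra.
  by move: l2 u2; rewrite ger0_norm ?subr_ge0 ?(ltW g)// => l2 u2; apply/negbTE; rewrite -ltNge; lra.
by rewrite D1 D2.
Qed.

Lemma box_bounded a b : exists M, forall x, box a b x -> dist2 x 0 <= M.
Proof.
exists (\sum_k (`|a k| + `|b k|) ^+ 2) => x /boxP h.
rewrite /dist2; apply: ler_sum => k _.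
have -> : coord3 k (0 : R3 R) = 0 by case: k => -[|[|[|]]].
rewrite subr0 -real_normK ?num_real// lerXn2r ?nnegrE ?addr_ge0//.
have /andP[h1 h2] := h k; rewrite ler_norml; apply/andP; split.
  by have := ler_norm (- a k); rewrite normrN; have := normr_ge0 (b k); lra.
by have := ler_norm (b k); have := normr_ge0 (a k); lra.
Qed.

End Boxes.

(** * Fubini for a nonnegative kernel against a signed function *)

Section FubiniKernel.
Local Open Scope ereal_scope.
Context d1 d2 (T1 : measurableType d1) (T2 : measurableType d2) (R : realType).
Variables (m1 : {sigma_finite_measure set T1 -> \bar R})
  (m2 : {sigma_finite_measure set T2 -> \bar R}).

Lemma measurable_fun_integral (f : T1 * T2 -> \bar R) :
  measurable_fun setT f -> measurable_fun setT (fun x => \int[m2]_y f (x, y)).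
Proof.
move=> mf; under eq_fun do rewrite integralE.
apply: emeasurable_funB.
- rewrite [X in measurable_fun _ X](_ : _ = fubini_F m2 (f ^\+)).
    by apply: measurable_fun_fubini_tonelli_F => //; exact: measurable_funepos.
  by apply/funext => x; apply: eq_integral => y _; rewrite !funeposE.
- rewrite [X in measurable_fun _ X](_ : _ = fubini_F m2 (f ^\-)).
    by apply: measurable_fun_fubini_tonelli_F => //; exact: measurable_funeneg.
  by apply/funext => x; apply: eq_integral => y _; rewrite !funenegE.
Qed.

(** Integrability on the product comes first: for the absolute value the inner integral is
    [S y * |F y|], whose integral is finite by assumption. *)
Lemma fubini_kernel (k : T1 * T2 -> R) (F S : T2 -> R) (A : set T1) :
  measurable A -> measurable_fun setT k -> measurable_fun setT F ->
  (forall z, 0 <= k z)%R ->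
  (forall y, \int[m1]_(x in A) (k (x, y))%:E = (S y)%:E) ->
  m2.-integrable setT (fun y => (S y * F y)%:E) ->
  \int[m1]_(x in A) \int[m2]_y (k (x, y) * F y)%:E =
  \int[m2]_y (S y * F y)%:E.
Proof.
move=> mA mk mF k0 kS iSF.
have S0 y : (0 <= S y)%R.
  by rewrite -lee_fin -kS; apply: integral_ge0 => x _; rewrite lee_fin.
pose g z := (\1_A z.1 * (k z * F z.2))%:E.
have mg : measurable_fun setT g.
  apply/measurable_EFinP; apply: measurable_funM.
    exact: (measurableT_comp (measurable_indic mA)).
  by apply: measurable_funM => //; exact: measurableT_comp.
have iky y : m1.-integrable A (fun x => (k (x, y))%:E).
  apply/integrableP; split.
    by apply: measurable_funTS; apply/measurable_EFinP; exact: measurableT_comp.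
  under eq_integral => x _ do rewrite gee0_abs ?lee_fin//.
  by rewrite kS ltry.
have ig : (m1 \x m2).-integrable setT g.
  apply/(integrable21ltyP _ _ mg).
  rewrite [ltLHS](_ : _ = \int[m2]_y `|(S y * F y)%:E|).
    by move/integrableP : iSF => [].
  apply: eq_integral => y _; rewrite /g /=.
  transitivity (\int[m1]_(x in A) (`|F y|%:E * (k (x, y))%:E)).
    rewrite [RHS]integral_mkcond; apply: eq_integral => x _.
    rewrite /patch indicE; case: ifPn => _; rewrite ?mul0r ?normr0 ?mul1r//.
    by rewrite -EFinM normrM mulrC (ger0_norm (k0 _)).
  by rewrite integralZl// kS -EFinM normrM mulrC (ger0_norm (S0 _)).
have FB := Fubini ig.
transitivity (\int[m1]_x \int[m2]_y g (x, y)).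
  rewrite integral_mkcond; apply: eq_integral => x _.
  rewrite /g /= /patch indicE; case: ifPn => _.
    by apply: eq_integral => y _; rewrite mul1r.
  by rewrite integral0_eq// => y _; rewrite mul0r.
rewrite FB; apply: eq_integral => y _.
transitivity (\int[m1]_(x in A) ((F y)%:E * (k (x, y))%:E)).
  rewrite [RHS]integral_mkcond; apply: eq_integral => x _.
  rewrite /g /patch indicE/=; case: ifPn => _; rewrite ?mul0r ?mul1r//.
  by rewrite -EFinM mulrC.
by rewrite integralZl// kS -EFinM mulrC.
Qed.

End FubiniKernel.

(** * The approximate identity and the mollified indicators *)

Section Mollifier.
Context {R : realType}.
Local Notation T := (R3m R).
Local Notation vol := (vol R).
Implicit Types (x y : R3 R) (b : R).

Definition moll b x y : R := 3 / (4 * pi) * b * invdist b x y ^+ 5.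

Lemma moll_const_gt0 : 0 < 3 / (4 * pi) :> R.
Proof. by rewrite divr_gt0// mulr_gt0// pi_gt0. Qed.

Lemma moll_ge0 b x y : 0 <= b -> 0 <= moll b x y.
Proof.
move=> b0; rewrite mulr_ge0 ?exprn_ge0 ?invdist_ge0// mulr_ge0//.
exact: ltW moll_const_gt0.
Qed.

Lemma measurable_moll b : measurable_fun [set: T * T] (fun z => moll b z.1 z.2).
Proof.
by apply: measurable_funM => //; exact: measurable_invdistX.
Qed.

Lemma measurable_moll_l b y : measurable_fun [set: T] (fun x => moll b x y).
Proof. by apply: measurable_funM => //; exact: measurable_invdistXl. Qed.

Lemma integral_moll b y : 0 < b -> (\int[vol]_x (moll b x y)%:E = 1)%E.
Proof.
move=> b0; under eq_integral do rewrite EFinM.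
rewrite ge0_integralZl_EFin//.
- rewrite integral_isqrt_dist5// -EFinM; congr _%:E.
  have p0 : pi != 0 :> R by rewrite gt_eqF// pi_gt0.
  by move: (pi : R) p0 => p p0; field; rewrite p0 gt_eqF.
- by move=> x _; rewrite lee_fin exprn_ge0// invdist_ge0.
- by apply/measurable_EFinP; exact: measurable_invdistXl.
- by rewrite mulr_ge0 ?(ltW b0)// (ltW moll_const_gt0).
Qed.

(** With [d = dist2 x y >= r] one has [1 / (b + d) <= 1 / d <= (1 + 1 / r) / (1 + d)], so away from
    [y] the mollifier is at most a multiple of the one at [b = 1], and the factor [b] makes its mass
    there vanish in the limit. *)
Lemma moll_far b x y r : 0 < b -> 0 < r -> r <= dist2 x y ->
  moll b x y <= b * (1 + r^-1) ^+ 5 * moll 1 x y.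
Proof.
move=> b0 r0 rd; have d0 := lt_le_trans r0 rd.
have q : invdist b x y <= (1 + r^-1) * invdist 1 x y.
  have c0 : 0 <= r^-1 by rewrite invr_ge0 ltW.
  rewrite -(@ler_pXn2r _ 2)// ?nnegrE ?mulr_ge0 ?invdist_ge0 ?addr_ge0//.
  rewrite exprMn !invdist_sqr ?(ltW b0)//.
  apply: (@le_trans _ _ (dist2 x y)^-1).
    by rewrite lef_pV2 ?posrE ?lerDr ?(ltW b0)// ltr_pwDl// ltW.
  apply: (@le_trans _ _ ((1 + r^-1) * (1 + dist2 x y)^-1)); last first.
    rewrite ler_wpM2r ?invr_ge0 ?addr_ge0 ?(ltW d0)//.
    by rewrite expr2 ler_peMr ?lerDl// addr_ge0.
  rewrite ler_pdivlMr ?ltr_pwDl ?(ltW d0)//.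
  rewrite mulrDr mulr1 mulVf ?gt_eqF// addrC lerD2l.
  by rewrite lef_pV2 ?posrE.
have q5 : invdist b x y ^+ 5 <= (1 + r^-1) ^+ 5 * invdist 1 x y ^+ 5.
  by rewrite -exprMn lerXn2r ?nnegrE ?mulr_ge0 ?invdist_ge0// ?addr_ge0 ?invr_ge0// ltW.
have := ler_wpM2l (mulr_ge0 (ltW moll_const_gt0) (ltW b0)) q5.
by rewrite /moll; set u := 3 / (4 * pi); lra.
Qed.

Lemma integral_moll_far b y r (E : set T) : 0 < b -> 0 < r -> measurable E ->
  (forall x, E x -> r <= dist2 x y) ->
  (\int[vol]_(x in E) (moll b x y)%:E <= (b * (1 + r^-1) ^+ 5)%:E)%E.
Proof.
move=> b0 r0 mE far; set K := b * _.
have K0 : 0 <= K.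
  by rewrite mulr_ge0 ?(ltW b0)// exprn_ge0// addr_ge0// invr_ge0 ltW.
apply: (@le_trans _ _ (\int[vol]_(x in E) (K%:E * (moll 1 x y)%:E))%E).
  apply: ge0_le_integral => //.
  - by move=> x _; rewrite lee_fin moll_ge0// ltW.
  - by apply: measurable_funTS; apply/measurable_EFinP; exact: measurable_moll_l.
  - apply: measurable_funeM; apply: measurable_funTS; apply/measurable_EFinP.
    exact: measurable_moll_l.
  - by move=> x Ex; rewrite -EFinM lee_fin moll_far//; exact: far.
rewrite ge0_integralZl_EFin//; last 2 first.
- by move=> x _; rewrite lee_fin moll_ge0.
- by apply: measurable_funTS; apply/measurable_EFinP; exact: measurable_moll_l.
rewrite -[leRHS]mule1 lee_wpmul2l ?lee_fin//.
rewrite -(integral_moll y (@ltr01 R)); apply: ge0_subset_integral => //.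
- by apply/measurable_EFinP; exact: measurable_moll_l.
- by move=> x _; rewrite lee_fin moll_ge0.
Qed.

(** The mollification of the indicator of [A], on which the mollifier lands when Fubini is applied
    to a mollified function integrated over [A]. *)
Definition smear b (A : set T) y : R :=
  fine (\int[vol]_(x in A) (moll b x y)%:E)%E.

Lemma smear_le1_aux b (A : set T) y : 0 < b -> measurable A ->
  (\int[vol]_(x in A) (moll b x y)%:E <= 1)%E.
Proof.
move=> b0 mA; rewrite -(integral_moll y b0); apply: ge0_subset_integral => //.
- by apply/measurable_EFinP; exact: measurable_moll_l.
- by move=> x _; rewrite lee_fin moll_ge0// ltW.
Qed.

Lemma smearE b (A : set T) y : 0 < b -> measurable A ->
  (\int[vol]_(x in A) (moll b x y)%:E = (smear b A y)%:E)%E.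
Proof.
move=> b0 mA; rewrite fineK// ge0_fin_numE; last first.
  by apply: integral_ge0 => x _; rewrite lee_fin moll_ge0// ltW.
by apply: le_lt_trans (smear_le1_aux y b0 mA) _; rewrite ltry.
Qed.

Lemma smear_ge0 b (A : set T) y : 0 < b -> 0 <= smear b A y.
Proof.
move=> b0; apply: fine_ge0; apply: integral_ge0 => x _.
by rewrite lee_fin moll_ge0// ltW.
Qed.

Lemma smearC b (A : set T) y : 0 < b -> measurable A ->
  smear b A y + smear b (~` A) y = 1.
Proof.
move=> b0 mA; have mC := measurableC mA.
apply: EFin_inj; rewrite EFinD -!smearE// -(integral_moll y b0).
rewrite -ge0_integral_setU//.
- by rewrite setUv.
- by rewrite setUv; apply/measurable_EFinP; exact: measurable_moll_l.
- by move=> x _; rewrite lee_fin moll_ge0// ltW.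
- exact/disj_setPCl.
Qed.

(** The error is the mass that the mollifier puts on the side of [A] not containing [y], by [smearC]
    when [y] is in [A]; that side is at squared distance at least [r]. *)
Lemma smear_near b (A : set T) y r : 0 < b -> measurable A -> 0 < r ->
  (forall x, dist2 x y < r -> (A x <-> A y)) ->
  `|smear b A y - \1_A y| <= b * (1 + r^-1) ^+ 5.
Proof.
move=> b0 mA r0 lc; have mC := measurableC mA.
have far (E : set T) : measurable E -> (forall x, E x -> ~ (A x <-> A y)) ->
    smear b E y <= b * (1 + r^-1) ^+ 5.
  move=> mE En; rewrite -lee_fin -smearE//; apply: integral_moll_far => // x Ex.
  by rewrite leNgt; apply/negP => /lc; exact: En.
rewrite indicE; have [Ay|Ay] := pselect (A y).
  rewrite mem_set//=.
  have -> : smear b A y - 1 = - smear b (~` A) y by have := smearC y b0 mA; lra.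
  rewrite normrN ger0_norm ?smear_ge0//; apply: far => // x nAx h; exact/nAx/h.
rewrite memNset// subr0 ger0_norm ?smear_ge0//; apply: far => // x Ax h.
exact/Ay/h.
Qed.

Lemma cvg_smear (A : set T) y : measurable A -> locally_constant_at A y ->
  (fun n => smear (4^-1 ^+ n) A y) @ \oo --> (\1_A y : R).
Proof.
move=> mA [r r0 lc]; apply/cvgrPdist_le => e e0.
have K0 : 0 < (1 + r^-1) ^+ 5 by rewrite exprn_gt0// addr_gt0// invr_gt0.
have /cvgrPdist_le /(_ (e / (1 + r^-1) ^+ 5) (divr_gt0 e0 K0)) := @cvg_pow4 R.
apply: filterS => n; rewrite sub0r normrN ger0_norm ?(ltW (pow4_gt0 n))//.
rewrite ler_pdivlMr// => h; rewrite distrC; apply: le_trans h.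
by apply: smear_near => //; exact: pow4_gt0.
Qed.

(** For squared distance [d <= 1] the weight is at most 2. For [d > 1] the fifth power of [invdist]
    is at most [1 / d], which absorbs the weight [1 + d] up to a factor 2. *)
Lemma moll_weight b x y : 0 < b -> b <= 1 ->
  (1 + dist2 x y) * moll b x y <= 2 * moll b x y + 2 * (3 / (4 * pi)).
Proof.
move=> b0 b1; have d0 := dist2_ge0 x y; have c0 := moll_const_gt0.
have m0 := moll_ge0 x y (ltW b0).
have [d1|d1] := leP (dist2 x y) 1; first by nra.
have q2 : invdist b x y ^+ 2 <= (dist2 x y)^-1.
  rewrite invdist_sqr ?(ltW b0)// lef_pV2 ?posrE ?lerDr ?(ltW b0)//; last exact: lt_trans d1.
  by rewrite ltr_pwDl// ltW.
have q1 : invdist b x y <= 1.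
  rewrite -(@ler_pXn2r _ 2)// ?nnegrE ?invdist_ge0// expr1n (le_trans q2)//.
  by rewrite invf_le1 ?(ltW d1)// (lt_trans _ d1).
have q5 : invdist b x y ^+ 5 <= (dist2 x y)^-1.
  rewrite -[5%N]/(2 + 3)%N exprD -[leRHS]mulr1.
  by apply: ler_pM; rewrite ?exprn_ge0 ?invdist_ge0// exprn_ile1// invdist_ge0.
have : (1 + dist2 x y) * (dist2 x y)^-1 <= 2.
  by rewrite ler_pdivrMr ?(lt_trans _ d1)//; lra.
have q50 : 0 <= invdist b x y ^+ 5 by rewrite exprn_ge0// invdist_ge0.
move=> h; have h2 : (1 + dist2 x y) * invdist b x y ^+ 5 <= 2.
  by apply: le_trans h; rewrite ler_wpM2l// addr_ge0.
have h3 : 3 / (4 * pi) * b * ((1 + dist2 x y) * invdist b x y ^+ 5) <=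
    3 / (4 * pi) * 1 * 2.
  apply: ler_pM => //; first by rewrite mulr_ge0// ltW.
    by rewrite mulr_ge0// addr_ge0.
  by rewrite ler_wpM2l// ltW.
rewrite [leLHS](_ : _ = 3 / (4 * pi) * b * ((1 + dist2 x y) * invdist b x y ^+ 5)).
  by apply: (le_trans h3); lra.
by rewrite /moll; ring.
Qed.

Lemma dist2_le x y z : dist2 y z <= 2 * dist2 x z + 2 * dist2 x y.
Proof.
rewrite /dist2 !mulr_sumr -big_split/=; apply: ler_sum => k _.
move: (coord3 k x) (coord3 k y) (coord3 k z) => u v w.
by rewrite -subr_ge0 (_ : _ - _ = (2 * u - v - w) ^+ 2) ?sqr_ge0//; ring.
Qed.

(** For [x] in the bounded set [A] one has [1 + |y|^2 <= 2 (1 + |M|) (1 + |x - y|^2)], so the weight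
    moves onto the mollifier, where [moll_weight] bounds it. The resulting majorant does not depend
    on [b] and is square integrable, hence usable against L^2 functions. *)
Lemma smear_decay (A : set T) : measurable A -> (vol A < +oo)%E ->
  (exists M, forall x, A x -> dist2 x 0 <= M) ->
  exists C, forall b y, 0 < b -> b <= 1 -> smear b A y <= C * invdist 1 y 0 ^+ 2.
Proof.
move=> mA Afin [M AM]; pose M1 : R := 1 + `|M|.
have Ar : vol A = (fine (vol A))%:E by rewrite fineK// ge0_fin_numE.
have c0 := moll_const_gt0; move: Ar; set V := fine (vol A) => Ar.
exists (2 * M1 * (2 + 2 * (3 / (4 * pi)) * V)) => b y b0 b1.
have y0 : 0 < 1 + dist2 y 0 by rewrite ltr_pwDl// dist2_ge0.
rewrite invdist_sqr// ler_pdivlMr// mulrC -lee_fin EFinM -smearE//.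
have mm : measurable_fun A (fun x => (moll b x y)%:E).
  by apply: measurable_funTS; apply/measurable_EFinP; exact: measurable_moll_l.
rewrite -ge0_integralZl_EFin//; last 2 first.
- by move=> x _; rewrite lee_fin moll_ge0// ltW.
- exact: ltW.
pose c : R := 2 * (3 / (4 * pi)).
have M10 : 0 <= 2 * M1 by rewrite mulr_ge0// addr_ge0.
have cc : 0 <= c by rewrite mulr_ge0// ltW.
apply: (@le_trans _ _ (\int[vol]_(x in A)
    ((2 * M1)%:E * (2%:E * (moll b x y)%:E + c%:E)))%E).
  apply: ge0_le_integral => //.
  - by move=> x _; rewrite -EFinM lee_fin mulr_ge0 ?moll_ge0// ltW.
  - exact: measurable_funeM.
  - by apply: measurable_funeM; apply: emeasurable_funD => //; exact: measurable_funeM.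
  - move=> x Ax; rewrite -EFinM [leRHS](_ : _ = (2 * M1 * (2 * moll b x y + c))%:E)// lee_fin.
    apply: le_trans (ler_wpM2l M10 (moll_weight x y b0 b1)).
    rewrite [leRHS]mulrA; apply: ler_wpM2r; first by rewrite moll_ge0// ltW.
    have P := dist2_le x y 0.
    have := AM x Ax; have := ler_norm M; have := dist2_ge0 x y.
    by rewrite /M1; have := normr_ge0 M; nra.
rewrite ge0_integralZl_EFin//; last 2 first.
- by move=> x _; rewrite -EFinM -EFinD lee_fin addr_ge0// mulr_ge0// moll_ge0// ltW.
- by apply: emeasurable_funD => //; exact: measurable_funeM.
rewrite [leRHS]EFinM lee_wpmul2l ?lee_fin//.
rewrite ge0_integralD//; last 2 first.
- by move=> x _; rewrite -EFinM lee_fin mulr_ge0// moll_ge0// ltW.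
- exact: measurable_funeM.
rewrite (integral_cst _ mA) ge0_integralZl_EFin//; last first.
  by move=> x _; rewrite lee_fin moll_ge0// ltW.
rewrite [leLHS](_ : _ = (2 * smear b A y + c * V)%:E); last first.
  rewrite smearE//.
  exact: (congr1 (fun t => (2%:E * (smear b A y)%:E + c%:E * t)%E) Ar).
rewrite lee_fin lerD2r ler_piMr//.
by rewrite -lee_fin -smearE// smear_le1_aux.
Qed.

Lemma square_integrableM (f g : T -> R) :
  measurable_fun [set: T] f -> measurable_fun [set: T] g ->
  vol.-integrable setT (fun x => (f x ^+ 2)%:E) ->
  vol.-integrable setT (fun x => (g x ^+ 2)%:E) ->
  vol.-integrable setT (fun x => (f x * g x)%:E).
Proof.
move=> mf mg if2 ig2.
apply: (le_integrable measurableT _ _ (integrableD measurableT if2 ig2)).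
  by apply/measurable_EFinP; exact: measurable_funM.
move=> x _ /=; rewrite lee_fin [leRHS]ger0_norm ?addr_ge0 ?sqr_ge0// normrM.
rewrite -(real_normK (num_real (f x))) -(real_normK (num_real (g x))).
have := normr_ge0 (f x); have := normr_ge0 (g x).
move: `|f x| `|g x| => u v; nra.
Qed.

Lemma invdist4_integrable b y : 0 < b ->
  vol.-integrable setT (fun x => ((invdist b x y ^+ 2) ^+ 2)%:E).
Proof.
move=> b0; apply/integrableP; split.
  by apply/measurable_EFinP; apply: measurable_funX; exact: measurable_invdistXl.
under eq_integral => x _ do rewrite gee0_abs ?lee_fin ?sqr_ge0// -exprM.
by rewrite integral_isqrt_dist4// ltry.
Qed.

End Mollifier.

(** * Weak convergence of mollifications over boxes *)

Section Mollified.
Context {R : realType}.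
Local Notation T := (R3m R).
Local Notation vol := (vol R).
Implicit Types (x y : R3 R).

Lemma vol_ae_imply (P Q : T -> Prop) : (forall x, P x -> Q x) ->
  {ae vol, forall x : T, P x} -> {ae vol, forall x : T, Q x}.
Proof.
move=> PQ [N [mN N0 PN]]; exists N; split=> // x nQ; apply: PN => h.
by apply: nQ; exact: PQ.
Qed.

Definition mollified n (g : T -> R) x : \bar R :=
  (\int[vol]_y (moll (4^-1 ^+ n) x y * g y)%:E)%E.

Lemma measurable_mollified n (g : T -> R) :
  measurable_fun [set: T] g -> measurable_fun [set: T] (mollified n g).
Proof.
move=> mg.
apply: (@measurable_fun_integral _ _ _ _ _ vol
  (fun z : T * T => (moll (4^-1 ^+ n) z.1 z.2 * g z.2)%:E)).
apply/measurable_EFinP; apply: measurable_funM; first exact: measurable_moll.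
exact: measurableT_comp.
Qed.

Lemma smear_mul_le (A : set T) (C : R) (g : T -> R) :
  (forall (b : R) y, 0 < b -> b <= 1 -> smear b A y <= C * invdist 1 y 0 ^+ 2) ->
  forall n y, `|smear (4^-1 ^+ n) A y * g y| <=
    `|C| * (invdist 1 y 0 ^+ 2 * `|g y|).
Proof.
move=> h n y; rewrite normrM mulrA ler_wpM2r// ger0_norm ?smear_ge0 ?pow4_gt0//.
apply: (le_trans (h _ y (pow4_gt0 n) (pow4_le1 n))).
by rewrite ler_wpM2r ?sqr_ge0// ler_norm.
Qed.

Section Approximation.
Variables (g : T -> R).
Hypothesis mg : measurable_fun [set: T] g.
Hypothesis ig2 : vol.-integrable setT (fun x => (g x ^+ 2)%:E).

Let weighted_integrable C :
  vol.-integrable setT (fun y => (C * (invdist 1 y 0 ^+ 2 * `|g y|))%:E).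
Proof.
have ig : vol.-integrable setT (fun y => (invdist 1 y 0 ^+ 2 * `|g y|)%:E).
  apply: square_integrableM => //.
  - exact: measurable_invdistXl.
  - exact: measurableT_comp.
  - exact: invdist4_integrable.
  - by under eq_fun do rewrite real_normK ?num_real//.
by under eq_fun do rewrite EFinM; exact: integrableZl.
Qed.

Lemma measurable_smear (b : R) (A : set T) : 0 < b -> measurable A ->
  measurable_fun [set: T] (smear b A).
Proof.
move=> b0 mA; apply/measurable_EFinP.
rewrite (_ : EFin \o _ = fun y => \int[vol]_x ((\1_A x)%:E * (moll b x y)%:E))%E.
  apply: (@measurable_fun_integral _ _ _ _ _ vol
    (fun z : T * T => (\1_A z.2)%:E * (moll b z.2 z.1)%:E)%E).
  apply: emeasurable_funM; apply/measurable_EFinP.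
    exact: (measurableT_comp (measurable_indic mA)).
  by apply: measurable_funM => //; exact: measurable_invdistX.
by apply/funext => y; rewrite -integral_set_indic /= smearE.
Qed.

Lemma integral_mollified (A : set T) n : measurable A -> (vol A < +oo)%E ->
  (exists M, forall x, A x -> dist2 x 0 <= M) ->
  (\int[vol]_(x in A) mollified n g x =
   \int[vol]_y (smear (4^-1 ^+ n) A y * g y)%:E)%E.
Proof.
move=> mA Afin /(smear_decay mA Afin)[C SC].
apply: (@fubini_kernel _ _ _ _ _ vol vol
  (fun z : T * T => moll (4^-1 ^+ n) z.1 z.2)) => //.
- exact: measurable_moll.
- by move=> z; rewrite moll_ge0// ltW// pow4_gt0.
- by move=> y; rewrite smearE//; exact: pow4_gt0.
- apply: (le_integrable measurableT _ _ (weighted_integrable `|C|)).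
    apply/measurable_EFinP; apply: measurable_funM => //.
    by apply: measurable_smear => //; exact: pow4_gt0.
  move=> y _ /=; rewrite lee_fin (le_trans (smear_mul_le g SC n y))//.
  by rewrite ler_norm.
Qed.

(** After Fubini the convergence is that of [smear] to the indicator, pointwise off the boundary of
    [A], with the majorant of [smear_decay] times [|g|]. The integrability of [g] on [A] is a
    by-product of the dominated convergence. *)
Lemma cvg_integral_mollified (A : set T) : measurable A -> (vol A < +oo)%E ->
  (exists M, forall x, A x -> dist2 x 0 <= M) ->
  {ae vol, forall y : T, locally_constant_at A y} ->
  vol.-integrable A (EFin \o g) /\
  (fun n => \int[vol]_(x in A) mollified n g x)%E @ \oo -->
    (\int[vol]_(x in A) (g x)%:E)%E.
Proof.
move=> mA Afin bA lcA; have [C SC] := smear_decay mA Afin bA.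
have [] := @dominated_convergence _ _ _ vol setT measurableT
  (fun n y => (smear (4^-1 ^+ n) A y * g y)%:E)
  (fun y => (\1_A y * g y)%:E)
  (fun y => (`|C| * (invdist 1 y 0 ^+ 2 * `|g y|))%:E).
- move=> n; apply/measurable_EFinP; apply: measurable_funM => //.
  by apply: measurable_smear => //; exact: pow4_gt0.
- by apply/measurable_EFinP; apply: measurable_funM.
- apply: vol_ae_imply lcA => y lcy _.
  apply: cvg_EFin; first exact: nearW.
  by apply: cvgM; [exact: cvg_smear|exact: cvg_cst].
- exact: weighted_integrable.
- by apply: aeW => y n _; rewrite lee_fin; exact: smear_mul_le.
have E : (fun y => (\1_A y * g y)%:E) = (EFin \o g) \_ A.
  by apply/funext => x; rewrite /patch indicE; case: ifPn => _ /=; rewrite ?mul1r ?mul0r.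
rewrite E => iA _ CV; split; first exact/integrable_mkcond.
have -> : (\int[vol]_(x in A) (g x)%:E = \int[vol]_x ((EFin \o g) \_ A) x)%E.
  by rewrite integral_mkcond.
by under eq_fun do rewrite integral_mollified//.
Qed.

(** The integrals of the mollifications over a box have two limits: the integral of [g] by weak
    convergence, and that of [h] by domination. Hence [g - h] integrates to 0 over every box. *)
Lemma mollified_limit_ae (h : T -> R) (J : T -> \bar R) :
  measurable_fun [set: T] h ->
  (forall a b, vol.-integrable (box a b) J) ->
  {ae vol, forall x : T, forall n, (`|mollified n g x| <= J x)%E} ->
  {ae vol, forall x : T, mollified n g x @[n --> \oo] --> (h x)%:E} ->
  {ae vol, forall x : T, g x = h x}.
Proof.
move=> mh iJ bJ lh.
have D a b : vol.-integrable (box a b) (EFin \o g) /\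
    vol.-integrable (box a b) (EFin \o h) /\
    (\int[vol]_(x in box a b) (g x)%:E = \int[vol]_(x in box a b) (h x)%:E)%E.
  have mA := measurable_box a b.
  have [igA cg] := cvg_integral_mollified mA (vol_box_lty a b) (box_bounded a b)
    (box_locally_constant_ae a b).
  have [ihA _ ch] := @dominated_convergence _ _ _ vol (box a b) mA
    (fun n => mollified n g) (EFin \o h) J
    (fun n => measurable_funTS (measurable_mollified n mg))
    (measurable_funTS ((measurable_EFinP _ _).2 mh))
    (vol_ae_imply (fun x H _ => H) lh) (iJ a b)
    (vol_ae_imply (fun x H n _ => H n) bJ).
  split=> //; split=> //.
  exact: cvg_unique cg ch.
have Z := @box_ae_zero R (fun x => g x - h x).
suff : {ae vol, forall x : T, g x - h x = 0}.
  by apply: vol_ae_imply => x /eqP; rewrite subr_eq0 => /eqP.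
apply: Z => a b; have [ig [ih E]] := D a b; have mA := measurable_box a b.
  by apply: eq_integrable (integrableB mA ig ih) => // x _.
transitivity (\int[vol]_(x in box a b) ((g x)%:E - (h x)%:E))%E; first by [].
rewrite integralB_EFin// E subee// integrable_fin_num//.
Qed.

End Approximation.

End Mollified.

(** * Finite-order smoothness and its closure properties *)

Section Smoothness.
Context {R : realType}.
Implicit Types (f g : R3 R -> R) (x y : R3 R) (k j : 'I_3).

(** A recursion on the order matching the iterated partial derivatives in [smooth], so that products
    and compositions are handled by induction. *)
Fixpoint Cn n f : Prop :=
  if n is m.+1 then
    continuous f /\ forall k, (forall x, derivable f x (basis_vec R k)) /\
      Cn m (partial k f)
  else continuous f.

Lemma Cn_continuous n f : Cn n f -> continuous f.
Proof. by case: n => [|n] // []. Qed.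

Lemma CnW n f : Cn n.+1 f -> Cn n f.
Proof.
elim: n f => [|n IH] f; first by case.
by move=> [cf df]; split=> // k; have [d1 d2] := df k; split=> //; exact: IH.
Qed.

Lemma CnS n f (df : 'I_3 -> R3 R -> R) : continuous f ->
  (forall k x, is_derive x (basis_vec R k) f (df k x)) ->
  (forall k, Cn n (df k)) -> Cn n.+1 f.
Proof.
move=> cf f' cdf; split=> // k; split=> [x|]; first by have [] := f' k x.
rewrite (_ : partial k f = df k); first exact: cdf.
by apply/funext => x; have [_ <-] := f' k x.
Qed.

Lemma is_derive_partial n f k x : Cn n.+1 f ->
  is_derive x (basis_vec R k) f (partial k f x).
Proof. by move=> [_ /(_ k)[+ _]]; move=> /(_ x) /derivableP. Qed.

Lemma smooth_Cn f : (forall n, Cn n f) -> smooth f.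
Proof.
move=> cf s; suff H n : Cn n (foldr (@partial R) f s).
  split; first exact: Cn_continuous (H 0%N).
  by move=> x k; have [_ /(_ k)[+ _]] := H 1%N; apply.
elim: s n => [|k s IH] n //=.
by have [_ /(_ k)[]] := IH n.+1.
Qed.

Lemma Cn_cst n (c : R) : Cn n (fun=> c).
Proof.
elim: n c => [|n IH] c; first exact: cst_continuous.
by apply: (@CnS _ _ (fun _ _ => 0)) => //; exact: cst_continuous.
Qed.

Lemma CnD n f g : Cn n f -> Cn n g -> Cn n (fun x => f x + g x).
Proof.
elim: n f g => [|n IH] f g Cf Cg.
  by move=> x; apply: continuous_addf; [exact: Cf|exact: Cg].
apply: (@CnS _ _ (fun k x => partial k f x + partial k g x)).
- move=> x; apply: continuous_addf; first exact: (Cn_continuous Cf).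
  exact: (Cn_continuous Cg).
- by move=> k x; apply: is_derive_addf; exact: (@is_derive_partial n).
- by move=> k; apply: IH; [have [_ /(_ k)[]] := Cf|have [_ /(_ k)[]] := Cg].
Qed.

Lemma CnM n f g : Cn n f -> Cn n g -> Cn n (fun x => f x * g x).
Proof.
elim: n f g => [|n IH] f g Cf Cg.
  by move=> x; apply: continuous_mulf; [exact: Cf|exact: Cg].
apply: (@CnS _ _ (fun k x => f x * partial k g x + g x * partial k f x)).
- move=> x; apply: continuous_mulf; first exact: (Cn_continuous Cf).
  exact: (Cn_continuous Cg).
- by move=> k x; apply: is_derive_mulf; exact: (@is_derive_partial n).
- move=> k; apply: CnD; apply: IH; try exact: CnW.
  + by have [_ /(_ k)[]] := Cg.
  + by have [_ /(_ k)[]] := Cf.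
Qed.

Lemma CnX n f m : Cn n f -> Cn n (fun x => f x ^+ m).
Proof.
move=> Cf; elim: m => [|m IH]; first exact: Cn_cst.
by under eq_fun do rewrite exprS; exact: CnM.
Qed.

Lemma is_derive_coord3 k j x :
  is_derive x (basis_vec R k) (coord3 j) (j == k)%:R.
Proof.
apply/is_derive_line.
have D := is_derive_addf (is_derive_mulf (is_derive_id (0 : R) 1)
  (is_derive_cst ((j == k)%:R : R) (0 : R) 1)) (is_derive_cst (coord3 j x) (0 : R) 1).
rewrite (_ : (fun h => _) = (fun h => h * (j == k)%:R + coord3 j x)).
  by apply: is_derive_eq D _; rewrite mul0r add0r mulr1 addr0.
apply/funext => h; rewrite [j == k]eq_sym.
case: j {D} => -[|[|[|//]]] i; rewrite /coord3/=; congr (_ * (k == _)%:R + _); exact/val_inj.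
Qed.

Lemma continuous_coord3 j : continuous (coord3 j : R3 R -> R).
Proof.
move=> x; case: j => -[|[|[|//]]] i; rewrite /coord3/=.
- by apply: cvg_comp; exact: cvg_fst.
- by apply: cvg_comp; [exact: cvg_fst|exact: cvg_snd].
- exact: cvg_snd.
Qed.

Lemma Cn_coord3 n j : Cn n (coord3 j).
Proof.
case: n => [|n]; first exact: continuous_coord3.
apply: (@CnS _ _ (fun k _ => (j == k)%:R)); first exact: continuous_coord3.
- by move=> k x; exact: is_derive_coord3.
- by move=> k; exact: Cn_cst.
Qed.

Lemma Cn_dist2 n y : Cn n (dist2^~ y).
Proof.
rewrite (_ : dist2^~ y = fun x => (coord3 0 x + - coord3 0 y) ^+ 2 +
  ((coord3 1 x + - coord3 1 y) ^+ 2 + (coord3 2 x + - coord3 2 y) ^+ 2)).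
  have C k : Cn n (fun x => (coord3 k x + - coord3 k y) ^+ 2).
    by apply: CnX; apply: CnD; [exact: Cn_coord3|exact: Cn_cst].
  by apply: CnD; [exact: C|apply: CnD; exact: C].
apply/funext => x; rewrite /dist2 !big_ord_recl big_ord0 addr0.
by congr (_ + (_ + _)); congr ((coord3 _ _ - coord3 _ _) ^+ 2); exact/val_inj.
Qed.

Lemma is_derive_dist2 k x y :
  is_derive x (basis_vec R k) (dist2^~ y) (2 * (coord3 k x - coord3 k y)).
Proof.
have D j := is_derive_expf 2 (is_derive_addf (is_derive_coord3 k j x)
  (is_derive_cst (- coord3 j y) x (basis_vec R k))).
have E := is_derive_sum D.
rewrite (_ : dist2^~ y = \sum_j (fun x => (coord3 j x - coord3 j y) ^+ 2)); last first.
  by apply/funext => z; rewrite fct_sumE.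
apply: is_derive_eq E _; rewrite (bigD1 k)//= eqxx big1 ?addr0 ?expr1 ?mulr1//.
by move=> j /negbTE ->; rewrite addr0 mulr0.
Qed.

(** The derivative is a partial derivative of [g] times the cube of the function itself, so the
    induction on [n] closes; the partial derivative is where one more order of [g] is consumed. *)
Lemma Cn_isqrt n g : (forall x, 0 < g x) -> (forall m, Cn m g) ->
  Cn n (fun x => isqrt (g x)).
Proof.
move=> g0 Cg; elim: n => [|n IH].
  by move=> x; apply: continuous_isqrt => //; exact: (Cg 0%N).
apply: (@CnS _ _ (fun k x => - 2^-1 * partial k g x * isqrt (g x) ^+ 3)).
- by move=> x; apply: continuous_isqrt => //; exact: (Cg 0%N).
- move=> k x.
  have D := is_derive_isqrt (g0 x) (is_derive_partial k x (Cg 1%N)).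
  by apply: is_derive_eq D _; rewrite -mulNr mulrC [_ / 2]mulrC; ring.
- move=> k; apply: CnM; last exact: CnX.
  by apply: CnM; [exact: Cn_cst|have [_ /(_ k)[]] := Cg n.+1].
Qed.

Lemma Cn_invdist n b y : 0 < b -> Cn n (fun x => invdist b x y).
Proof.
move=> b0; apply: Cn_isqrt => [x|m]; first by rewrite ltr_pwDl// dist2_ge0.
by apply: CnD; [exact: Cn_cst|exact: Cn_dist2].
Qed.

Lemma is_derive_invdist b k x y : 0 < b ->
  is_derive x (basis_vec R k) (fun x => invdist b x y)
    ((coord3 k y - coord3 k x) * invdist b x y ^+ 3).
Proof.
move=> b0; have p : 0 < b + dist2 x y by rewrite ltr_pwDl// dist2_ge0.
have D := is_derive_isqrt (f := fun x => b + dist2 x y) p (is_derive_addf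
  (is_derive_cst b x (basis_vec R k)) (is_derive_dist2 k x y)).
by apply: is_derive_eq D _; rewrite /invdist; field.
Qed.

End Smoothness.

(** * Flat functions built from [exp(-1/t)] *)

Section Bump.
Context {R : realType}.
Implicit Types (p : {poly R}) (t u : R).

(** The polynomial factor makes the family stable under differentiation, so smoothness follows from
    the first derivative alone. *)
Definition flatbump p t : R := if 0 < t then p.[t^-1] * expR (- t^-1) else 0.

(** For [u >= 1] every monomial of [p] is at most [u ^+ d.+1] with [d] the size of [p], and one term
    of the exponential series bounds [u ^+ d.+1 * expR (- u)] by [(d.+1)!]. *)
Lemma poly_expR_bound p : exists2 C, 0 <= C &
  forall u, 1 <= u -> `|p.[u]| * expR (- u) <= C.
Proof.
pose d := size p.
exists (\sum_(i < d) `|p`_i| * (d.+1)`!%:R).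
  by apply: sumr_ge0 => i _; rewrite mulr_ge0.
move=> u u1; have u0 : 0 <= u by exact: le_trans u1.
have E : u ^+ d.+1 * expR (- u) <= (d.+1)`!%:R.
  rewrite expRN ler_pdivrMr ?expR_gt0// mulrC -ler_pdivrMr ?ltr0n ?fact_gt0//.
  by apply: le_trans (expR_ge1Dxn d u0); rewrite lerDr.
rewrite horner_coef -/d (le_trans (ler_wpM2r (expR_ge0 _) (ler_norm_sum _ _ _)))//.
rewrite mulr_suml; apply: ler_sum => i _.
rewrite normrM -mulrA ler_wpM2l// (le_trans _ E)// ler_wpM2r ?expR_ge0//.
by rewrite normrX ger0_norm// ler_weXn2l// (leq_trans (ltnW (ltn_ord i))).
Qed.

Lemma flatbump_bound p : exists2 C, 0 <= C & forall t, t <= 1 -> `|flatbump p t| <= C.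
Proof.
have [C C0 h] := poly_expR_bound p; exists C => // t t1; rewrite /flatbump.
case: ifPn => [t0|_]; last by rewrite normr0.
by rewrite normrM (gtr0_norm (expR_gt0 _)) h// invf_ge1.
Qed.

Definition flatbump_deriv p : {poly R} := 'X ^+ 2 * (p - p^`()).

Lemma is_derive_flatbump p t : is_derive t 1 (flatbump p) (flatbump (flatbump_deriv p) t).
Proof.
have [t0|t0|->] := ltgtP t 0.
- apply: (near_eq_is_derive (f := cst 0)).
    near=> s; rewrite /flatbump ifN// -leNgt ltW//.
    by near: s; exact: lt_nbhsl.
  by rewrite /flatbump ifN ?ltNge ?(ltW t0)//; exact: is_derive_cst.
- apply: (@near_eq_is_derive _ _ _ (fun s : R => p.[s^-1] * expR (- s^-1)) (flatbump p)).
    near=> s; rewrite /flatbump ifT//.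
    by near: s; exact: lt_nbhsr.
  rewrite /flatbump t0.
  have I : is_derive t 1 (fun s : R => s^-1) (- t ^- 2).
    have tn : t != 0 by rewrite gt_eqF.
    split; first exact: (derivableV (f := id)).
    by rewrite (deriveV (f := id) tn)// derive_id -[_ *: _]/(_ * _) mulr1.
  have I2 : is_derive t 1 (fun s : R => - s^-1) (t ^- 2).
    by apply: is_derive_eq (is_deriveN I) _; rewrite opprK.
  have D := is_derive_mulf (is_derive_comp_real I (is_derive_poly p t^-1))
    (is_derive_comp_real I2 (is_derive_expR _)).
  apply: is_derive_eq D _.
  rewrite /flatbump_deriv hornerM horner_exp hornerX hornerD hornerN /=.
  move: (expR _) (p^`().[_]) (p.[_]) => X Y Z; field.
  by rewrite gt_eqF.
(* At 0, for [h > 0], the difference quotient is [h] times the value at [1 / h] of ['X ^+ 2 * p]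
   times [exp(-1/h)]. The latter product is bounded, so the quotient tends to 0. *)
- have [C C0 hC] := poly_expR_bound ('X ^+ 2 * p).
  have b0 q : flatbump q 0 = 0 by rewrite /flatbump ltxx.
  rewrite b0.
  have L : (fun h : R => h^-1 *: ((flatbump p \o shift 0) (h *: 1) - flatbump p 0)) @ 0^' --> (0 : R).
    apply/cvgrPdist_le => e e0; near=> h.
    have h1 : `|h| <= 1 by near: h; exact: dnbhs0_le.
    have h2 : `|h| <= e / (C + 1).
      by near: h; apply: dnbhs0_le; rewrite divr_gt0// ltr_wpDl.
    rewrite sub0r normrN /= b0 subr0 addr0 -[h *: 1]/(h * 1) mulr1.
    rewrite -[_ *: _]/(_ * _) /flatbump; case: ifPn => [hp|_]; last by rewrite mulr0 normr0 ltW.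
    have u1 : 1 <= h^-1 by rewrite invf_ge1// (le_trans (ler_norm h)).
    have := hC _ u1; rewrite hornerM horner_exp hornerX [X in X * _]normrM.
    rewrite (ger0_norm (sqr_ge0 _)) => H.
    rewrite normrM (normrM p.[_]) gtr0_norm ?invr_gt0// (gtr0_norm (expR_gt0 _)).
    have -> : h^-1 * (`|p.[h^-1]| * expR (- h^-1)) =
        h * (h^-1 ^+ 2 * `|p.[h^-1]| * expR (- h^-1)) by field; rewrite gt_eqF.
    move: h2; rewrite gtr0_norm// ler_pdivlMr ?ltr_wpDl// => h2.
    apply: le_trans h2; rewrite ler_pM2l//; lra.
  by split; [apply/cvg_ex; exists 0|exact: cvg_lim L].
Unshelve. all: by end_near. Qed.

Lemma continuous_flatbump p : continuous (flatbump p).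
Proof.
move=> t; apply/differentiable_continuous/derivable1_diffP.
by have [] := is_derive_flatbump p t.
Qed.

Lemma Cn_flatbump n p (g : R3 R -> R) : (forall m, Cn m g) ->
  Cn n (fun x => flatbump p (g x)).
Proof.
move=> Cg; elim: n p => [|n IH] p.
  by move=> x; apply: continuous_comp; [exact: (Cg 0%N)|exact: continuous_flatbump].
apply: (@CnS _ _ _ (fun k x => flatbump (flatbump_deriv p) (g x) * partial k g x)).
- by move=> x; apply: continuous_comp; [exact: (Cg 0%N)|exact: continuous_flatbump].
- move=> k x; apply: is_derive_comp_real (is_derive_partial k x (Cg 1%N)) _.
  exact: is_derive_flatbump.
- by move=> k; apply: CnM; [exact: IH|have [_ /(_ k)[]] := Cg n.+1].
Qed.

End Bump.

(** * Cutoffs, the regularized gradient kernel and its derivatives *)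

Section Cutoff.
Context {R : realType}.
Local Notation T := (R3m R).
Local Notation vol := (vol R).
Implicit Types (x y : R3 R) (b : R) (k j : 'I_3) (n : nat).

Definition cutoff_scale n : R := (n.+1%:R ^+ 2)^-1.

(** Supported in the ball of radius [n.+1]. The factor [expR 1] compensates
    [flatbump 1 1 = exp(-1)], so that the pointwise limit is 1. *)
Definition cutoff n y : R := expR 1 * flatbump 1 (1 - cutoff_scale n * dist2 y 0).

Definition dcutoff n k y : R := expR 1 *
  (flatbump (flatbump_deriv 1) (1 - cutoff_scale n * dist2 y 0) *
   (- cutoff_scale n * (2 * coord3 k y))).

Lemma cutoff_scale_gt0 n : 0 < cutoff_scale n.
Proof. by rewrite invr_gt0 exprn_gt0. Qed.

Lemma cutoff_scale_le1 n : cutoff_scale n <= 1.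
Proof. by rewrite invf_le1 ?exprn_gt0// exprn_ege1// ler1n. Qed.

Lemma cvg_cutoff_scale : cutoff_scale @ \oo --> (0 : R).
Proof.
have C := @cvg_harmonic R.
rewrite (_ : cutoff_scale = fun n => n.+1%:R^-1 * n.+1%:R^-1).
  by rewrite -(mulr0 0); apply: cvgM; exact: C.
by apply/funext => n; rewrite /cutoff_scale expr2 invfM.
Qed.

Lemma cutoff_arg_le1 n y : 1 - cutoff_scale n * dist2 y 0 <= 1.
Proof.
by rewrite gerBl mulr_ge0 ?(ltW (cutoff_scale_gt0 n))// dist2_ge0.
Qed.

Lemma cvg_cutoff_arg y :
  (fun n => 1 - cutoff_scale n * dist2 y 0) @ \oo --> (1 : R).
Proof.
rewrite -[X in _ --> X]subr0 -[in X in _ --> X](mul0r (dist2 y 0)).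
apply: cvgB; first exact: cvg_cst.
by apply: cvgM; [exact: cvg_cutoff_scale|exact: cvg_cst].
Qed.

Lemma Cn_cutoff_arg m n : Cn m (fun y => 1 - cutoff_scale n * dist2 y 0).
Proof.
under eq_fun do rewrite -mulNr.
apply: CnD; first exact: Cn_cst.
by apply: CnM; [exact: Cn_cst|exact: Cn_dist2].
Qed.

Lemma Cn_cutoff m n : Cn m (cutoff n).
Proof.
apply: CnM; first exact: Cn_cst.
by apply: Cn_flatbump => i; exact: Cn_cutoff_arg.
Qed.

Lemma coord30 k : coord3 k (0 : R3 R) = 0.
Proof. by case: k => -[|[|[|]]]. Qed.

Lemma is_derive_cutoff n k y :
  is_derive y (basis_vec R k) (cutoff n) (dcutoff n k y).
Proof.
have D := is_derive_mulf (is_derive_cst (expR 1 : R) y (basis_vec R k))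
  (is_derive_comp_real
    (is_derive_addf (is_derive_cst (1 : R) y (basis_vec R k))
      (is_derive_mulf (is_derive_cst (- cutoff_scale n) y (basis_vec R k))
        (is_derive_dist2 k y 0)))
    (is_derive_flatbump 1 _)).
rewrite (_ : cutoff n = fun y => expR 1 *
    flatbump 1 (1 + - cutoff_scale n * dist2 y 0)); last first.
  by apply/funext => z; rewrite /cutoff mulNr.
apply: is_derive_eq D _; rewrite coord30 subr0 /dcutoff /cst mulNr /=.
by rewrite !mulr0 !addr0 add0r.
Qed.

Lemma cutoff_ge0 n y : 0 <= cutoff n y.
Proof.
rewrite mulr_ge0 ?expR_ge0// /flatbump; case: ifP => // _.
by rewrite hornerC mul1r expR_ge0.
Qed.

Lemma cutoff_le1 n y : cutoff n y <= 1.
Proof.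
rewrite /cutoff /flatbump; case: ifPn => [t0|_]; last by rewrite mulr0.
rewrite hornerC mul1r -expRD -[leRHS]expR0 ler_expR subr_le0.
by rewrite invf_ge1// cutoff_arg_le1.
Qed.

Lemma cvg_cutoff y : (fun n => cutoff n y) @ \oo --> (1 : R).
Proof.
have -> : (1 : R) = expR 1 * flatbump 1 1.
  by rewrite /flatbump ltr01 hornerC mul1r invr1 -expRD subrr expR0.
apply: cvgM; first exact: cvg_cst.
apply: (@cvg_comp _ _ _ _ (flatbump 1) _ _ _ (cvg_cutoff_arg y)).
exact: continuous_flatbump.
Qed.

Lemma cvg_dcutoff k y : (fun n => dcutoff n k y) @ \oo --> (0 : R).
Proof.
have -> : (0 : R) = expR 1 * (flatbump (flatbump_deriv 1) 1 * (- 0 * (2 * coord3 k y))).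
  by rewrite oppr0 mul0r !mulr0.
apply: cvgM; first exact: cvg_cst.
apply: cvgM.
  apply: (@cvg_comp _ _ _ _ (flatbump (flatbump_deriv 1)) _ _ _ (cvg_cutoff_arg y)).
  exact: continuous_flatbump.
apply: cvgM; last exact: cvg_cst.
by apply: cvgN; exact: cvg_cutoff_scale.
Qed.

Lemma coord3_sqr_le k x y : (coord3 k x - coord3 k y) ^+ 2 <= dist2 x y.
Proof. by rewrite /dist2 (bigD1 k)//= lerDl sumr_ge0// => j _; exact: sqr_ge0. Qed.

(** Where the cutoff is nonzero, the scale times [|y|^2] is below 1 and the scale is at most 1, so
    the scale times [2 |y_k|] is at most 2. *)
Lemma dcutoff_bound : exists2 C : R, 0 <= C &
  forall n k y, `|dcutoff n k y| <= C.
Proof.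
have [C C0 h] := flatbump_bound (flatbump_deriv (1 : {poly R})).
exists (expR 1 * (C * 2)); first by rewrite !mulr_ge0 ?expR_ge0.
move=> n k y; have c0 := cutoff_scale_gt0 n; have c1 := cutoff_scale_le1 n.
rewrite /dcutoff !normrM (gtr0_norm (expR_gt0 1)) ler_wpM2l ?expR_ge0//.
rewrite normrN (gtr0_norm c0) (ger0_norm (ler0n _ 2)).
have [t0|t0] := leP (1 - cutoff_scale n * dist2 y 0) 0.
  by rewrite /flatbump ltNge t0 /= normr0 mul0r mulr_ge0.
apply: ler_pM => //; first by rewrite !mulr_ge0// ltW.
  exact: h (cutoff_arg_le1 n y).
have := coord3_sqr_le k y 0; rewrite coord30 subr0 -[_ ^+ 2]real_normK ?num_real//.
have := normr_ge0 (coord3 k y); move: `|_| => u u0 ud.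
have : cutoff_scale n * u ^+ 2 <= cutoff_scale n * dist2 y 0 by rewrite ler_wpM2l// ltW.
nra.
Qed.

Lemma cutoff_support n y : n.+1%:R < enorm y -> cutoff n y = 0.
Proof.
move=> h; rewrite /cutoff /flatbump ifN ?mulr0// -leNgt subr_le0.
have E : enorm y ^+ 2 = dist2 y 0 by rewrite -enorm_sqr subr0.
rewrite -E /cutoff_scale ler_pdivlMl ?exprn_gt0// mulr1.
by rewrite lerXn2r ?nnegrE ?ler0n ?sqrtr_ge0// ltW.
Qed.

Lemma measurable_dist2_0 : measurable_fun [set: T] (fun y => dist2 y 0).
Proof. exact: measurable_dist2. Qed.

Lemma measurable_flatbump p d (U : measurableType d) (f : U -> R) :
  measurable_fun setT f -> measurable_fun setT (fun u => flatbump p (f u)).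
Proof.
move=> mf; apply: (measurableT_comp _ mf).
by apply: continuous_measurable_fun; exact: continuous_flatbump.
Qed.

Lemma measurable_cutoff_arg n :
  measurable_fun [set: T] (fun y => 1 - cutoff_scale n * dist2 y 0).
Proof.
apply: measurable_funB => //; apply: measurable_funM => //.
exact: measurable_dist2_0.
Qed.

Lemma measurable_cutoff n : measurable_fun [set: T] (cutoff n).
Proof.
apply: measurable_funM => //; apply: measurable_flatbump.
exact: measurable_cutoff_arg.
Qed.

Lemma measurable_dcutoff n k : measurable_fun [set: T] (dcutoff n k).
Proof.
apply: measurable_funM => //; apply: measurable_funM.
  by apply: measurable_flatbump; exact: measurable_cutoff_arg.
apply: measurable_funM => //; apply: measurable_funM => //.
exact: measurable_fun_coord.
Qed.

Definition kern b j x y : R := (coord3 j x - coord3 j y) * invdist b x y ^+ 3.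

(** As functions of [y], [kern b j x] is the [j]-th partial derivative of [invdist b x], and this is
    its Hessian. Hence the symmetry in [j] and [k] on which the Clifford contraction relies. *)
Definition dkern b j k x y : R := - (j == k)%:R * invdist b x y ^+ 3 +
  3 * (coord3 j x - coord3 j y) * (coord3 k x - coord3 k y) *
  invdist b x y ^+ 5.

Lemma dkernC b j k x y : dkern b j k x y = dkern b k j x y.
Proof. by rewrite /dkern eq_sym; congr (_ + _); ring. Qed.

(** With [q = invdist b x y] the trace is [- 3 q^3 + 3 |x - y|^2 q^5], and [|x - y|^2 = q^-2 - b].
    The remainder measures how far the regularized Newton potential is from harmonic. *)
Lemma dkern_trace b x y : 0 < b ->
  \sum_j dkern b j j x y = - (3 * b * invdist b x y ^+ 5).
Proof.
move=> b0; have p : 0 < b + dist2 x y by rewrite ltr_pwDl// dist2_ge0.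
have Q : invdist b x y ^+ 3 = invdist b x y ^+ 5 * (b + dist2 x y).
  rewrite -[5%N]/(3 + 2)%N exprD invdist_sqr ?(ltW b0)//.
  by rewrite mulfVK ?gt_eqF.
rewrite /dkern !big_ord_recl big_ord0 !eqxx Q dist2E /=.
rewrite /coord3 /=; ring.
Qed.

Lemma is_derive_kern b j k x y : 0 < b ->
  is_derive y (basis_vec R k) (kern b j x) (dkern b j k x y).
Proof.
move=> b0.
have D := is_derive_mulf
  (is_derive_addf (is_derive_cst (coord3 j x) y (basis_vec R k))
    (is_derive_mulf (is_derive_cst (-1 : R) y (basis_vec R k))
      (is_derive_coord3 k j y)))
  (is_derive_expf 3 (is_derive_invdist k y x b0)).
rewrite (_ : kern b j x = fun y => (coord3 j x + -1 * coord3 j y) * invdist b y x ^+ 3).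
  by apply: is_derive_eq D _; rewrite /dkern /cst /= (invdistC b x y); ring.
by apply/funext => z; rewrite /kern invdistC mulN1r.
Qed.

Lemma Cn_kern m b j x : 0 < b -> Cn m (kern b j x).
Proof.
move=> b0.
rewrite (_ : kern b j x = fun y => (coord3 j x + -1 * coord3 j y) * invdist b y x ^+ 3).
  apply: CnM; last by apply: CnX; exact: Cn_invdist.
  apply: CnD; first exact: Cn_cst.
  by apply: CnM; [exact: Cn_cst|exact: Cn_coord3].
by apply/funext => z; rewrite /kern invdistC mulN1r.
Qed.

Lemma coord3_invdist_le1 b j x y : 0 <= b ->
  `|coord3 j x - coord3 j y| * invdist b x y <= 1.
Proof.
move=> b0; rewrite -(@ler_pXn2r _ 2)// ?nnegrE ?mulr_ge0 ?invdist_ge0//.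
rewrite exprMn expr1n invdist_sqr// real_normK ?num_real//.
have c := coord3_sqr_le j x y; have d0 := dist2_ge0 x y.
have [->|p] := eqVneq (b + dist2 x y) 0; first by rewrite invr0 mulr0.
have p0 : 0 < b + dist2 x y by rewrite lt_neqAle eq_sym p addr_ge0.
by rewrite ler_pdivrMr// mul1r; lra.
Qed.

Lemma kern_le b j x y : 0 <= b -> `|kern b j x y| <= invdist b x y ^+ 2.
Proof.
move=> b0; rewrite normrM exprS normrM (ger0_norm (invdist_ge0 _ _ _)).
rewrite (ger0_norm (sqr_ge0 _)) mulrA ler_piMl ?sqr_ge0//.
exact: coord3_invdist_le1.
Qed.

(** A majorant independent of [b], for the limit [b] to 0. On the diagonal both sides are 0: the
    coordinate difference vanishes on the left, the default value applies on the right. *)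
Lemma kern_le0 b j x y : 0 <= b -> `|kern b j x y| <= invdist 0 x y ^+ 2.
Proof.
move=> b0; have [d0|d0] := eqVneq (dist2 x y) 0.
  have c := coord3_sqr_le j x y; rewrite d0 in c.
  have /eqP : (coord3 j x - coord3 j y) ^+ 2 = 0.
    by apply/eqP; rewrite eq_le c sqr_ge0.
  by rewrite sqrf_eq0 /kern => /eqP ->; rewrite mul0r normr0 sqr_ge0.
have p : 0 < dist2 x y by rewrite lt_neqAle eq_sym d0 dist2_ge0.
apply: le_trans (kern_le j x y b0) _.
by rewrite !invdist_sqr// add0r lef_pV2 ?posrE ?lerDr// ltr_wpDl.
Qed.

(** Each coordinate difference is absorbed by one factor [invdist], which leaves
    [(1 + 3) * invdist ^+ 3]; one more factor is bounded by [isqrt b], so that the same weight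
    [invdist ^+ 2] serves for [kern] and [dkern]. *)
Lemma dkern_le b j k x y : 0 < b ->
  `|dkern b j k x y| <= 4 * isqrt b * invdist b x y ^+ 2.
Proof.
move=> b0; have b0' := ltW b0.
have q0 := invdist_ge0 b x y.
have qb : invdist b x y <= isqrt b.
  rewrite -(@ler_pXn2r _ 2)// ?nnegrE ?isqrt_ge0// invdist_sqr// isqrt_sqr//.
  by rewrite lef_pV2 ?posrE ?lerDl ?dist2_ge0// ltr_pwDl// dist2_ge0.
apply: (@le_trans _ _ (4 * invdist b x y ^+ 3)); last first.
  by rewrite exprS mulrA ler_wpM2r ?sqr_ge0// ler_wpM2l.
apply: le_trans (ler_normD _ _) _.
have -> : 4 * invdist b x y ^+ 3 = invdist b x y ^+ 3 + 3 * invdist b x y ^+ 3 by ring.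
apply: lerD.
  rewrite normrM normrN (ger0_norm (exprn_ge0 _ q0)) ler_piMl ?exprn_ge0//.
  by rewrite normr_nat lern1 leq_b1.
have -> : 3 * (coord3 j x - coord3 j y) * (coord3 k x - coord3 k y) * invdist b x y ^+ 5
    = 3 * (((coord3 j x - coord3 j y) * invdist b x y) *
        (((coord3 k x - coord3 k y) * invdist b x y) * invdist b x y ^+ 3)) by ring.
rewrite normrM (ger0_norm (ler0n _ 3)) ler_wpM2l// normrM.
rewrite -[leRHS]mul1r; apply: ler_pM => //.
  by rewrite normrM (ger0_norm q0) coord3_invdist_le1.
rewrite normrM -[leRHS]mul1r; apply: ler_pM => //.
  by rewrite normrM (ger0_norm q0) coord3_invdist_le1.
by rewrite ger0_norm// exprn_ge0.
Qed.

Lemma measurable_kern d (U : measurableType d) (f g : U -> T) b j :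
  measurable_fun setT f -> measurable_fun setT g ->
  measurable_fun setT (fun u => kern b j (f u) (g u)).
Proof.
move=> mf mg; apply: measurable_funM; last exact: measurable_invdistX.
by apply: measurable_funB; exact: measurable_fun_coord.
Qed.

Lemma measurable_dkern b j k x : measurable_fun [set: T] (dkern b j k x).
Proof.
apply: measurable_funD.
  by apply: measurable_funM => //; exact: measurable_invdistXr.
apply: measurable_funM; last exact: measurable_invdistXr.
by apply: measurable_funM; [apply: measurable_funM => //|];
  apply: measurable_funB => //; exact: measurable_fun_coord.
Qed.

Lemma cvg_kern j x y : (fun n => kern (4^-1 ^+ n) j x y) @ \oo --> kern 0 j x y.
Proof.
have [d0|d0] := eqVneq (dist2 x y) 0.
  have E b : 0 <= b -> kern b j x y = 0.
    move=> b0; have := kern_le0 j x y b0.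
    by rewrite invdist_sqr// d0 addr0 invr0 normr_le0 => /eqP.
  rewrite E//; under eq_fun do rewrite E ?(ltW (pow4_gt0 _))//.
  exact: cvg_cst.
have p : 0 < dist2 x y by rewrite lt_neqAle eq_sym d0 dist2_ge0.
apply: cvgM; first exact: cvg_cst.
have C : (fun n => 4^-1 ^+ n + dist2 x y) @ \oo --> 0 + dist2 x y.
  by apply: cvgD; [exact: cvg_pow4|exact: cvg_cst].
have K : {for (0 + dist2 x y), continuous (fun t : R => isqrt t ^+ 3)}.
  apply: continuous_expf; apply: (@continuous_isqrt _ _ id); first by rewrite add0r.
  exact: cvg_id.
exact: (cvg_comp _ _ C K).
Qed.

Definition chi_test n b j x y : R := cutoff n y * kern b j x y.

Lemma chi_test_function n b j x : 0 < b -> test_function (chi_test n b j x).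
Proof.
move=> b0; split.
  by apply: smooth_Cn => m; apply: CnM; [exact: Cn_cutoff|exact: Cn_kern].
by exists n.+1%:R => y yn; rewrite /chi_test cutoff_support// mul0r.
Qed.

Lemma partial_chi_test n b j k x y : 0 < b -> partial k (chi_test n b j x) y =
  cutoff n y * dkern b j k x y + kern b j x y * dcutoff n k y.
Proof.
move=> b0; have [_ E] := is_derive_mulf (is_derive_cutoff n k y) (is_derive_kern j k x y b0).
exact: E.
Qed.

End Cutoff.

(** * Complex scalars through real and imaginary parts *)

Section ComplexScalars.
Context {R : realType}.
Local Notation C := R[i].
Local Notation Re := (@complex.Re R).
Local Notation Im := (@complex.Im R).
Implicit Types z c : C.

Lemma Re_add z c : Re (z + c) = Re z + Re c. Proof. by case: z; case: c. Qed.
Lemma Im_add z c : Im (z + c) = Im z + Im c. Proof. by case: z; case: c. Qed.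
Lemma Re_mul z c : Re (z * c) = Re z * Re c - Im z * Im c.
Proof. by case: z; case: c. Qed.
Lemma Im_mul z c : Im (z * c) = Re z * Im c + Im z * Re c.
Proof. by case: z; case: c. Qed.
Lemma Re_opp z : Re (- z) = - Re z. Proof. by case: z. Qed.
Lemma Im_opp z : Im (- z) = - Im z. Proof. by case: z. Qed.

Lemma eq_ReIm z c : Re z = Re c -> Im z = Im c -> z = c.
Proof. by case: z; case: c => a b a' b' /= -> ->. Qed.

Lemma Re_real_mul (a : R) z : Re (a%:C * z) = a * Re z.
Proof. by rewrite Re_mul /= mul0r subr0. Qed.
Lemma Im_real_mul (a : R) z : Im (a%:C * z) = a * Im z.
Proof. by rewrite Im_mul /= mul0r addr0. Qed.

(** Used instead of the modulus because it is real-valued and splits additively over the two parts,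
    on which measurability and integrals are defined. *)
Definition norm1 z : R := `|Re z| + `|Im z|.

Lemma norm1_ge0 z : 0 <= norm1 z. Proof. by rewrite addr_ge0. Qed.

Lemma norm1_0 : norm1 0 = 0. Proof. by rewrite /norm1 /= normr0 addr0. Qed.

Lemma Re_le_norm1 z : `|Re z| <= norm1 z. Proof. by rewrite lerDl. Qed.

Lemma Im_le_norm1 z : `|Im z| <= norm1 z. Proof. by rewrite lerDr. Qed.

Lemma norm1D z c : norm1 (z + c) <= norm1 z + norm1 c.
Proof.
rewrite /norm1 Re_add Im_add addrACA.
by apply: lerD; exact: ler_normD.
Qed.

Lemma norm1N z : norm1 (- z) = norm1 z.
Proof. by rewrite /norm1 Re_opp Im_opp !normrN. Qed.

Lemma norm1M z c : norm1 (z * c) <= norm1 z * norm1 c.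
Proof.
rewrite /norm1 Re_mul Im_mul.
apply: (le_trans (lerD (ler_normB _ _) (ler_normD _ _))).
by rewrite !normrM le_eqVlt; apply/orP; left; apply/eqP; ring.
Qed.

Lemma norm1_sum (I : Type) (r : seq I) (P : pred I) (F : I -> C) :
  norm1 (\sum_(i <- r | P i) F i) <= \sum_(i <- r | P i) norm1 (F i).
Proof.
elim/big_ind2 : _ => [|u z v c uz vc|//]; first by rewrite norm1_0.
by apply: (le_trans (norm1D _ _)); exact: lerD.
Qed.

Lemma norm1_sqr z : norm1 z ^+ 2 <= 2 * (Re z ^+ 2 + Im z ^+ 2).
Proof.
rewrite /norm1 -(real_normK (num_real (Re z))) -(real_normK (num_real (Im z))).
by rewrite -subr_ge0 (_ : _ - _ = (`|Re z| - `|Im z|) ^+ 2) ?sqr_ge0//; ring.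
Qed.

Definition cvgC (u : nat -> C) c : Prop :=
  (fun n => Re (u n)) @ \oo --> Re c /\ (fun n => Im (u n)) @ \oo --> Im c.

Lemma cvgC_cst c : cvgC (fun=> c) c.
Proof. by split; exact: cvg_cst. Qed.

Lemma cvgCD u v z c : cvgC u z -> cvgC v c -> cvgC (fun n => u n + v n) (z + c).
Proof.
move=> [u1 u2] [v1 v2]; split; rewrite ?Re_add ?Im_add.
  by under eq_fun do rewrite Re_add; exact: cvgD.
by under eq_fun do rewrite Im_add; exact: cvgD.
Qed.

Lemma cvgCM u z c : cvgC u z -> cvgC (fun n => c * u n) (c * z).
Proof.
move=> [u1 u2]; split; rewrite ?Re_mul ?Im_mul.
  under eq_fun do rewrite Re_mul.
  by apply: cvgB; apply: cvgM => //; exact: cvg_cst.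
under eq_fun do rewrite Im_mul.
by apply: cvgD; apply: cvgM => //; exact: cvg_cst.
Qed.

Lemma cvgC_sum (I : Type) (r : seq I) (u : I -> nat -> C) (z : I -> C) :
  (forall i, cvgC (u i) (z i)) ->
  cvgC (fun n => \sum_(i <- r) u i n) (\sum_(i <- r) z i).
Proof.
move=> uz; elim: r => [|i r IH].
  by rewrite big_nil; under [X in cvgC X]eq_fun do rewrite big_nil; exact: cvgC_cst.
by rewrite big_cons; under [X in cvgC X]eq_fun do rewrite big_cons; exact: cvgCD.
Qed.

Lemma cvgC_unique u z c : cvgC u z -> cvgC u c -> z = c.
Proof.
move=> [z1 z2] [c1 c2]; apply: eq_ReIm.
  exact: cvg_unique z1 c1.
exact: cvg_unique z2 c2.
Qed.

Section MeasurableComplex.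
Context d (U : measurableType d).

Definition measC (f : U -> C) : Prop :=
  measurable_fun setT (fun x => Re (f x)) /\
  measurable_fun setT (fun x => Im (f x)).

Lemma measC_cst c : measC (fun=> c).
Proof. by split; exact: measurable_cst. Qed.

Lemma measCD f g : measC f -> measC g -> measC (fun x => f x + g x).
Proof.
move=> [f1 f2] [g1 g2]; split.
  by under eq_fun do rewrite Re_add; exact: measurable_funD.
by under eq_fun do rewrite Im_add; exact: measurable_funD.
Qed.

Lemma measCM f g : measC f -> measC g -> measC (fun x => f x * g x).
Proof.
move=> [f1 f2] [g1 g2]; split.
  under eq_fun do rewrite Re_mul.
  by apply: measurable_funB; exact: measurable_funM.
under eq_fun do rewrite Im_mul.
by apply: measurable_funD; exact: measurable_funM.
Qed.

Lemma measC_sum (I : Type) (r : seq I) (f : I -> U -> C) :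
  (forall i, measC (f i)) -> measC (fun x => \sum_(i <- r) f i x).
Proof.
move=> mf; elim: r => [|i r IH].
  by under [X in measC X]eq_fun do rewrite big_nil; exact: measC_cst.
by under [X in measC X]eq_fun do rewrite big_cons; exact: measCD.
Qed.

Lemma measC_real (f : U -> R) : measurable_fun setT f -> measC (fun x => (f x)%:C).
Proof. by move=> mf; split => //; exact: measurable_cst. Qed.

Lemma measurable_norm1 f : measC f -> measurable_fun setT (fun x => norm1 (f x)).
Proof. by move=> [f1 f2]; apply: measurable_funD; exact: measurableT_comp. Qed.

End MeasurableComplex.

End ComplexScalars.

Lemma sum3E (V : nmodType) (f : 'I_3 -> V) : \sum_j f j = f 0 + (f 1 + f 2).
Proof.
rewrite !big_ord_recl big_ord0 addr0.
by congr (f _ + (f _ + f _)); exact/val_inj.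
Qed.

(* Sealed, because failed unifications of two such integrals diverge. *)
HB.lock Definition wint (R : realType) (a : R3 R -> R)
    (F : R3 R -> 'cV[R[i]]_4) : 'cV[R[i]]_4 :=
  integral_mx (fun y => (a y)%:C *: F y).

(** * Vector integrals against real weights *)

Section WeightedIntegral.
Context {R : realType}.
Local Notation T := (R3m R).
Local Notation vol := (vol R).

Lemma dominated_integrable_mul (w a h : T -> R) (M : R) :
  measurable_fun [set: T] a -> measurable_fun [set: T] h ->
  vol.-integrable setT (fun y => (w y * `|h y|)%:E) ->
  (forall y, `|a y| <= M * w y) ->
  vol.-integrable setT (fun y => (a y * h y)%:E).
Proof.
move=> ma mh iw aw.
apply: (le_integrable measurableT _ _ (integrableZl measurableT M iw)).
  by apply/measurable_EFinP; exact: measurable_funM.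
move=> y _ /=; rewrite lee_fin normrM mulrA.
by apply: (le_trans (ler_wpM2r (normr_ge0 _) (aw y))); exact: ler_norm.
Qed.

Lemma cvg_Rintegral_mul (w h : T -> R) (M : R) (a_ : nat -> T -> R) (a : T -> R) :
  (forall n, measurable_fun [set: T] (a_ n)) -> measurable_fun [set: T] a ->
  measurable_fun [set: T] h ->
  vol.-integrable setT (fun y => (w y * `|h y|)%:E) ->
  (forall n y, `|a_ n y| <= M * w y) ->
  (forall y, (fun n => a_ n y) @ \oo --> a y) ->
  (fun n => Rintegral vol setT (fun y => a_ n y * h y)) @ \oo -->
    Rintegral vol setT (fun y => a y * h y).
Proof.
move=> ma_ ma mh iw aw al.
have [] := @dominated_convergence _ _ _ vol setT measurableT
  (fun n y => (a_ n y * h y)%:E) (fun y => (a y * h y)%:E)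
  (fun y => M%:E * (w y * `|h y|)%:E)%E.
- by move=> n; apply/measurable_EFinP; exact: measurable_funM.
- by apply/measurable_EFinP; exact: measurable_funM.
- apply: aeW => y _; apply: cvg_EFin; first exact: nearW.
  by apply: cvgM; [exact: al|exact: cvg_cst].
- exact: integrableZl.
- apply: aeW => y n _; rewrite -EFinM lee_fin normrM mulrA.
  exact: ler_wpM2r.
move=> ia _ C; apply: fine_cvg; rewrite fineK; first exact: C.
exact: integrable_fin_num.
Qed.

Lemma wint_integral (a : R3 R -> R) (F : R3 R -> 'cV[R[i]]_4) :
  wint a F = integral_mx (fun y => (a y)%:C *: F y).
Proof. by rewrite wint.unlock. Qed.

Lemma wintE a F l : wint a F l 0 =
  Rintegral vol setT (fun y => a y * complex.Re (F y l 0)) +i*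
  Rintegral vol setT (fun y => a y * complex.Im (F y l 0)).
Proof.
rewrite wint_integral mxE; congr (_ +i* _); apply: eq_Rintegral => y _.
  by rewrite mxE Re_real_mul.
by rewrite mxE Im_real_mul.
Qed.

Lemma Re_wint a F l : complex.Re (wint a F l 0) =
  Rintegral vol setT (fun y => a y * complex.Re (F y l 0)).
Proof. by rewrite wintE. Qed.

Lemma Im_wint a F l : complex.Im (wint a F l 0) =
  Rintegral vol setT (fun y => a y * complex.Im (F y l 0)).
Proof. by rewrite wintE. Qed.

(** One integrability condition that covers every real coefficient bounded by a multiple of [w]:
    integrals against [F] are then linear in the coefficient and pass to dominated limits. *)
Definition admissible (w : T -> R) (F : R3 R -> 'cV[R[i]]_4) : Prop :=
  [/\ forall y, 0 <= w y, measurable_fun [set: T] w, measurable_mx F &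
  forall l, vol.-integrable setT (fun y => (w y * norm1 (F y l 0))%:E)].

Lemma admissible_Re w F l : admissible w F ->
  measurable_fun [set: T] (fun y => complex.Re (F y l 0)) /\
  vol.-integrable setT (fun y => (w y * `|complex.Re (F y l 0)|)%:E).
Proof.
move=> [w0 mw mF iF]; have [m1 m2] := mF l 0; split=> //.
apply: (le_integrable measurableT _ _ (iF l)).
  by apply/measurable_EFinP; apply: measurable_funM => //; exact: measurableT_comp.
move=> y _ /=; rewrite lee_fin (ger0_norm (mulr_ge0 (w0 y) (normr_ge0 _))).
rewrite (ger0_norm (mulr_ge0 (w0 y) (norm1_ge0 _))).
by apply: ler_wpM2l => //; exact: Re_le_norm1.
Qed.

Lemma admissible_Im w F l : admissible w F ->
  measurable_fun [set: T] (fun y => complex.Im (F y l 0)) /\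
  vol.-integrable setT (fun y => (w y * `|complex.Im (F y l 0)|)%:E).
Proof.
move=> [w0 mw mF iF]; have [m1 m2] := mF l 0; split=> //.
apply: (le_integrable measurableT _ _ (iF l)).
  by apply/measurable_EFinP; apply: measurable_funM => //; exact: measurableT_comp.
move=> y _ /=; rewrite lee_fin (ger0_norm (mulr_ge0 (w0 y) (normr_ge0 _))).
rewrite (ger0_norm (mulr_ge0 (w0 y) (norm1_ge0 _))).
by apply: ler_wpM2l => //; exact: Im_le_norm1.
Qed.

Section Admissible.
Variables (w : T -> R) (F : R3 R -> 'cV[R[i]]_4).
Hypothesis wF : admissible w F.

Lemma integrable_wint (a : T -> R) M l : measurable_fun [set: T] a ->
  (forall y, `|a y| <= M * w y) ->
  vol.-integrable setT (fun y => (a y * complex.Re (F y l 0))%:E) /\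
  vol.-integrable setT (fun y => (a y * complex.Im (F y l 0))%:E).
Proof.
move=> ma aw; have [m1 i1] := admissible_Re l wF; have [m2 i2] := admissible_Im l wF.
by split; [exact: dominated_integrable_mul i1 aw|exact: dominated_integrable_mul i2 aw].
Qed.

Lemma cvgC_wint (a_ : nat -> T -> R) (a : T -> R) M l :
  (forall n, measurable_fun [set: T] (a_ n)) -> measurable_fun [set: T] a ->
  (forall n y, `|a_ n y| <= M * w y) ->
  (forall y, (fun n => a_ n y) @ \oo --> a y) ->
  cvgC (fun n => wint (a_ n) F l 0) (wint a F l 0).
Proof.
move=> ma_ ma aw al.
have [m1 i1] := admissible_Re l wF; have [m2 i2] := admissible_Im l wF.
split; [rewrite Re_wint|rewrite Im_wint].
  under eq_fun do rewrite Re_wint.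
  exact: cvg_Rintegral_mul i1 aw al.
under eq_fun do rewrite Im_wint.
exact: cvg_Rintegral_mul i2 aw al.
Qed.

Lemma wintD (a b : T -> R) M N : measurable_fun [set: T] a ->
  measurable_fun [set: T] b ->
  (forall y, `|a y| <= M * w y) -> (forall y, `|b y| <= N * w y) ->
  wint (fun y => a y + b y) F = wint a F + wint b F.
Proof.
move=> ma mb aw bw; apply/matrixP => l j; rewrite ord1 [RHS]mxE !wintE.
have [ia1 ia2] := integrable_wint l ma aw.
have [ib1 ib2] := integrable_wint l mb bw.
apply: eq_ReIm; rewrite ?Re_add ?Im_add /=.
  by rewrite -RintegralD//; apply: eq_Rintegral => y _; rewrite mulrDl.
by rewrite -RintegralD//; apply: eq_Rintegral => y _; rewrite mulrDl.
Qed.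

Lemma wintZ (c : R) (a : T -> R) M : measurable_fun [set: T] a ->
  (forall y, `|a y| <= M * w y) ->
  wint (fun y => c * a y) F = c%:C *: wint a F.
Proof.
move=> ma aw; apply/matrixP => l j; rewrite ord1 [RHS]mxE !wintE.
have [ia1 ia2] := integrable_wint l ma aw.
apply: eq_ReIm; rewrite ?Re_real_mul ?Im_real_mul /=.
  by rewrite -RintegralZl//; apply: eq_Rintegral => y _; rewrite mulrA.
by rewrite -RintegralZl//; apply: eq_Rintegral => y _; rewrite mulrA.
Qed.

Lemma wint_sum (a : 'I_3 -> T -> R) M : (forall j, measurable_fun [set: T] (a j)) ->
  (forall j y, `|a j y| <= M * w y) ->
  wint (fun y => \sum_j a j y) F = \sum_j wint (a j) F.
Proof.
move=> ma aw.
under [X in wint X]eq_fun do rewrite sum3E.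
rewrite sum3E.
rewrite (@wintD _ _ M (M + M))//.
- by rewrite (@wintD _ _ M M).
- exact: measurable_funD.
- by move=> y; rewrite mulrDl (le_trans (ler_normD _ _))// lerD.
Qed.

Lemma norm1_wint_le (a : T -> R) l : measurable_fun [set: T] a ->
  (forall y, `|a y| <= w y) ->
  ((norm1 (wint a F l 0))%:E <= \int[vol]_y (w y * norm1 (F y l 0))%:E)%E.
Proof.
move=> ma aw.
have aw1 y : `|a y| <= 1 * w y by rewrite mul1r.
have [i1 i2] := integrable_wint l ma aw1.
have [w0 mw mF iF] := wF.
rewrite wintE /norm1 /= EFinD.
have B (h : T -> R) : measurable_fun [set: T] h ->
    vol.-integrable setT (fun y => (a y * h y)%:E) ->
    ((`|Rintegral vol setT (fun y => (a y * h y)%R)|%R)%:E <=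
     \int[vol]_y (w y * `|h y|)%:E)%E.
  move=> mh ih; rewrite EFin_normr_Rintegral//.
  apply: (le_trans (le_abse_integral _ measurableT (measurable_int _ ih))).
  apply: ge0_le_integral => //.
  - by apply: measurableT_comp => //; exact: measurable_int ih.
  - apply/measurable_EFinP; apply: measurable_funM => //.
    exact: measurableT_comp.
  - by move=> y _; rewrite lee_fin normrM ler_wpM2r.
have [m1 m2] := mF l 0.
apply: (le_trans (leeD (B _ m1 i1) (B _ m2 i2))).
rewrite -ge0_integralD//.
- by rewrite le_eqVlt; apply/orP; left; apply/eqP; apply: eq_integral => y _;
    rewrite -EFinD -mulrDr.
- by move=> y _; rewrite lee_fin mulr_ge0.
- apply/measurable_EFinP; apply: measurable_funM => //.
  exact: measurableT_comp.
- by move=> y _; rewrite lee_fin mulr_ge0.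
- apply/measurable_EFinP; apply: measurable_funM => //.
  exact: measurableT_comp.
Qed.

End Admissible.

End WeightedIntegral.

(** * Clifford relations of the Dirac matrices *)

Section Clifford.
Context {R : realType}.

Lemma sigma_anticommute (j k : 'I_3) :
  sigma R j *m sigma R k + sigma R k *m sigma R j = ((j == k)%:R *+ 2)%:M.
Proof.
apply/matrixP => a c; rewrite !mxE !big_ord_recl !big_ord0.
case: j => -[|[|[|//]]] hj; case: k => -[|[|[|//]]] hk;
  case: a => -[|[|//]] ha; case: c => -[|[|//]] hc;
  rewrite /sigma /mx_of_rows !mxE /=; apply: eq_ReIm;
  rewrite ?Re_add ?Im_add ?Re_mul ?Im_mul ?Re_opp ?Im_opp /=; ring.
Qed.

Lemma alpha_anticommute (j k : 'I_3) :
  alpha R j *m alpha R k + alpha R k *m alpha R j = ((j == k)%:R *+ 2)%:M.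
Proof.
have A p q : alpha R p *m alpha R q =
    block_mx (sigma R p *m sigma R q) 0 0 (sigma R p *m sigma R q) :> 'M[R[i]]_(2 + 2).
  apply: etrans (@mulmx_block _ 2 2 2 2 2 2 0 (sigma R p) (sigma R p) 0 0
    (sigma R q) (sigma R q) 0) _.
  by rewrite !mul0mx !mulmx0 !addr0 !add0r.
rewrite !A; apply: etrans (@add_block_mx _ 2 2 2 2 _ _ _ _ _ _ _ _) _.
by rewrite !addr0 sigma_anticommute; apply/esym; exact: (@scalar_mx_block _ 2 2).
Qed.

(** Adding the double sum to itself with the indices exchanged turns products into anticommutators,
    since [S] is symmetric; these vanish off the diagonal and are 2 on it. *)
Lemma clifford_contraction (S : 'I_3 -> 'I_3 -> 'cV[R[i]]_4) :
  (forall j k, S j k = S k j) ->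
  \sum_j \sum_k alpha R j *m (alpha R k *m S j k) = \sum_j S j j.
Proof.
move=> Ssym; set X := \sum_j _.
have X2 : X + X = (\sum_j S j j) + (\sum_j S j j).
  rewrite {2}/X exchange_big /= /X -!big_split/=; apply: eq_bigr => j _.
  rewrite -big_split/= (bigD1 j)//= big1 ?addr0.
    rewrite !mulmxA -mulmxDl alpha_anticommute eqxx mul_scalar_mx.
    by rewrite scaler_nat mulr2n.
  move=> k kj; rewrite (Ssym k j) !mulmxA -mulmxDl alpha_anticommute.
  by rewrite eq_sym (negbTE kj) mul0rn mul_scalar_mx scale0r.
have two : (2%:R : R[i]) != 0 by rewrite pnatr_eq0.
apply: (scalerI two); rewrite !scaler_nat !mulr2n; exact: X2.
Qed.

End Clifford.

(** * Bounds on the potential and its diagonalization *)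

Section VectorFields.
Context {R : realType}.
Local Notation T := (R3m R).
Local Notation vol := (vol R).
Local Notation C := R[i].
Local Notation Re := (@complex.Re R).
Local Notation Im := (@complex.Im R).

Lemma norm1_le_norm (z : C) (r : R) : `|z| <= r%:C -> norm1 z <= 2 * r.
Proof.
rewrite normc_def lecR => h.
have s a : `|a| = Num.sqrt (a ^+ 2) :> R by rewrite sqrtr_sqr.
rewrite mulr_natl mulr2n /norm1 !s.
by apply: lerD; apply: le_trans h; rewrite ler_wsqrtr// ?lerDl ?lerDr sqr_ge0.
Qed.

Lemma Re_conj (z : C) : Re (Num.conj z) = Re z.
Proof. by case: z. Qed.

Lemma Im_conj (z : C) : Im (Num.conj z) = - Im z.
Proof. by case: z. Qed.

Lemma measurable_mxM m n p (A : R3 R -> 'M[C]_(m, n)) (F : R3 R -> 'M[C]_(n, p)) :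
  measurable_mx A -> measurable_mx F -> measurable_mx (fun x => A x *m F x).
Proof.
move=> mA mF i j.
have : measC (fun x : T => \sum_k A x i k * F x k j).
  apply: measC_sum => k; apply: measCM; [exact: mA|exact: mF].
rewrite (_ : (fun x => _) = fun x => (A x *m F x) i j)//.
by apply/funext => x; rewrite mxE.
Qed.

Lemma L2_norm1 (psi : R3 R -> 'cV[C]_4) l : L2 psi ->
  vol.-integrable setT (fun y => (norm1 (psi y l 0) ^+ 2)%:E).
Proof.
move=> [mpsi ipsi].
have m2 : measurable_fun [set: T] (fun y => norm1 (psi y l 0) ^+ 2).
  by apply: measurable_funX; apply: measurable_norm1; exact: mpsi.
pose S y := \sum_i (Re (psi y i 0) ^+ 2 + Im (psi y i 0) ^+ 2).
have S0 y : 0 <= S y by apply: sumr_ge0 => i _; rewrite addr_ge0// sqr_ge0.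
have iS : vol.-integrable setT (fun y => (S y)%:E).
  apply/integrableP; split.
    apply/measurable_EFinP; apply: measurable_sum => i.
    by apply: measurable_funD; apply: measurable_funX; have [] := mpsi i 0.
  by under eq_integral => y _ do rewrite gee0_abs ?lee_fin ?S0//.
apply: (le_integrable measurableT _ _ (integrableZl measurableT 2 iS)).
  exact/measurable_EFinP.
move=> y _ /=; rewrite lee_fin !ger0_norm ?sqr_ge0 ?mulr_ge0//.
apply: (le_trans (norm1_sqr _)); rewrite ler_wpM2l//.
by rewrite /S (bigD1 l)//= lerDl sumr_ge0// => i _; rewrite addr_ge0// sqr_ge0.
Qed.

Lemma L2_dominated (psi F : R3 R -> 'cV[C]_4) K : L2 psi -> measurable_mx F ->
  (forall x l, norm1 (F x l 0) <= K * \sum_m norm1 (psi x m 0)) -> L2 F.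
Proof.
move=> psi2 mF FK; split=> //.
pose G y := \sum_m norm1 (psi y m 0) ^+ 2.
have iG : vol.-integrable setT (fun y => (G y)%:E).
  under eq_fun do rewrite /G -sumEFin.
  by apply: integrable_sum => // i _; exact: L2_norm1.
have G0 y : 0 <= G y by apply: sumr_ge0 => i _; exact: sqr_ge0.
(* The inner 4 is Cauchy-Schwarz for a sum of four components, the outer 4 counts the rows of
   [F]. *)
have iKG := integrableZl measurableT (4 * (K ^+ 2 * 4)) iG.
have [_ KGoo] := integrableP _ _ _ iKG.
apply: le_lt_trans KGoo; apply: ge0_le_integral => //.
- by move=> y _; rewrite lee_fin sumr_ge0// => i _; rewrite addr_ge0// sqr_ge0.
- apply/measurable_EFinP; apply: measurable_sum => i.
  by apply: measurable_funD; apply: measurable_funX; have [] := mF i 0.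
- by apply: measurableT_comp => //; exact: measurable_int iKG.
move=> y _ /=; rewrite lee_fin [leRHS]ger0_norm; last first.
  by rewrite mulr_ge0// mulr_ge0// mulr_ge0// sqr_ge0.
have sq (z : C) : Re z ^+ 2 + Im z ^+ 2 <= norm1 z ^+ 2.
  rewrite /norm1 -(real_normK (num_real (Re z))) -(real_normK (num_real (Im z))).
  by have := normr_ge0 (Re z); have := normr_ge0 (Im z); nra.
have cs : (\sum_m norm1 (psi y m 0)) ^+ 2 <= 4 * G y.
  rewrite /G !big_ord_recl !big_ord0.
  set a := norm1 _; set b := norm1 _; set c := norm1 _; set d := norm1 _.
  rewrite -subr_ge0 (_ : _ - _ = (a - b) ^+ 2 + (a - c) ^+ 2 + (a - d) ^+ 2 +
    (b - c) ^+ 2 + (b - d) ^+ 2 + (c - d) ^+ 2); last by ring.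
  by rewrite !addr_ge0// sqr_ge0.
have row i : Re (F y i 0) ^+ 2 + Im (F y i 0) ^+ 2 <= K ^+ 2 * 4 * G y.
  apply: (le_trans (sq _)); rewrite -mulrA; apply: le_trans (ler_wpM2l (sqr_ge0 K) cs).
  have h := FK y i; rewrite -exprMn lerXn2r ?nnegrE ?norm1_ge0//.
  exact: le_trans (norm1_ge0 _) h.
apply: le_trans (ler_sum _ (fun i _ => row i)) _.
by rewrite sumr_const card_ord -(mulr_natl (K ^+ 2 * 4 * G y)) mulrA.
Qed.

Lemma norm1_mulmx_le (A : 'M[C]_4) (v : 'cV[C]_4) K l :
  (forall i j, norm1 (A i j) <= K) ->
  norm1 ((A *m v) l 0) <= K * \sum_m norm1 (v m 0).
Proof.
move=> AK; rewrite mxE (le_trans (norm1_sum _ _ _))// mulr_sumr.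
apply: ler_sum => m _; apply: (le_trans (norm1M _ _)).
by rewrite ler_wpM2r ?norm1_ge0.
Qed.

Lemma japanese_decay (eps : R) x : 0 < eps ->
  japanese x `^ (- 2 - eps) <= invdist 1 x 0 ^+ 2.
Proof.
move=> e0; have j2 : japanese x ^+ 2 = 1 + dist2 x 0.
  by rewrite sqr_sqrtr ?addr_ge0 ?sqr_ge0// -enorm_sqr subr0.
have j1 : 1 <= japanese x.
  rewrite -(@ler_pXn2r _ 2)// ?nnegrE ?sqrtr_ge0// expr1n j2.
  by rewrite lerDl dist2_ge0.
apply: (@le_trans _ _ (japanese x `^ (- 2))).
  by apply: ler_powR => //; rewrite gerBl ltW.
by rewrite powRN powR_mulrn ?sqrtr_ge0// j2 invdist_sqr.
Qed.

Section Dirac.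
Variables (V B : R3 R -> 'M[C]_4) (lam : R3 R -> 'I_4 -> R) (eps : R).
Hypothesis eps_gt0 : 0 < eps.
Hypothesis V_decay : exists C : R, forall (x : R3 R) (i j : 'I_4),
  `|V x i j| <= (C * japanese x `^ (- 2 - eps))%:C.
Hypothesis V_diag : diagonalizes V B lam.

Lemma potential_decay : exists2 M : R, 0 <= M &
  forall x i j, norm1 (V x i j) <= M * invdist 1 x 0 ^+ 2.
Proof.
have [M VM] := V_decay; exists (2 * `|M|); first by rewrite mulr_ge0.
move=> x i j; apply: (le_trans (norm1_le_norm (VM x i j))).
rewrite -mulrA ler_wpM2l//; apply: (@le_trans _ _ (`|M| * japanese x `^ (- 2 - eps))).
  by rewrite ler_wpM2r ?powR_ge0// ler_norm.
by rewrite ler_wpM2l// japanese_decay.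
Qed.

Lemma potential_bounded : exists2 M : R, 0 <= M &
  forall x i j, norm1 (V x i j) <= M.
Proof.
have [M M0 VM] := potential_decay; exists M => // x i j.
apply: (le_trans (VM x i j)); rewrite ler_piMr// invdist_sqr// invf_le1.
  by rewrite lerDl dist2_ge0.
by rewrite ltr_pwDl// dist2_ge0.
Qed.

Lemma unitary_norm1_le x i j : norm1 (B x i j) <= 2.
Proof.
have [_ _ uB _] := V_diag; have /unitarymxP /matrixP /(_ i i) := uB x.
rewrite !mxE eqxx /= => E.
have {}E : \sum_k (Re (B x i k) ^+ 2 + Im (B x i k) ^+ 2) = 1 :> R.
  have /(congr1 Re) := E; rewrite (big_morph Re Re_add (erefl : Re 0 = 0)) => {}E.
  rewrite -[RHS]/(Re 1) -E.
  by apply: eq_bigr => k _; rewrite !mxE Re_mul Re_conj Im_conj mulrN opprK -!expr2.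
rewrite -(@ler_pXn2r _ 2)// ?nnegrE ?norm1_ge0//.
apply: (le_trans (norm1_sqr _)).
apply: (@le_trans _ _ (2 * 1)); last by rewrite expr2 ler_wpM2l// ler1n.
rewrite ler_wpM2l// -E (bigD1 j)//= lerDl sumr_ge0// => k _.
by rewrite addr_ge0// sqr_ge0.
Qed.

(** The decay is assumed for the entries of [V], whereas [v] involves the eigenvalues. These are the
    diagonal entries of [B V B^*], with [B] unitary. *)
Lemma eigenvalue_bounded : exists2 M : R, 0 <= M & forall x i, `|lam x i| <= M.
Proof.
have [M M0 VM] := potential_bounded; have [_ _ uB VE] := V_diag.
(* Each 4 is the number of terms in a matrix product, each 2 bounds an entry of [B] in [norm1], and
   [M] bounds an entry of [V]. *)
exists (4 * (4 * (2 * M)) * 2); first by rewrite !mulr_ge0.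
move=> x i.
have D : real_diag (lam x) = B x *m V x *m (B x)^t*%sesqui.
  have /unitarymxP u := uB x.
  by rewrite VE !mulmxA u mul1mx -mulmxA u mulmx1.
have {}D : (lam x i)%:C = \sum_k (\sum_l B x i l * V x l k) * Num.conj (B x i k).
  have /matrixP /(_ i i) := D; rewrite !mxE eqxx mulr1n => ->.
  by apply: eq_bigr => k _; rewrite !mxE.
have : norm1 (lam x i)%:C <= 4 * (4 * (2 * M)) * 2.
  rewrite D; apply: (le_trans (norm1_sum _ _ _)).
  apply: (@le_trans _ _ (\sum_(k < 4) 4 * (2 * M) * 2)); last first.
    by rewrite sumr_const card_ord -(mulr_natl (4 * _ * _)) !mulrA.
  apply: ler_sum => k _; apply: (le_trans (norm1M _ _)).
  apply: ler_pM; rewrite ?norm1_ge0//; last first.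
    have -> : norm1 (Num.conj (B x i k)) = norm1 (B x i k).
      by rewrite /norm1 Re_conj Im_conj normrN.
    exact: unitary_norm1_le.
  apply: (le_trans (norm1_sum _ _ _)).
  apply: (@le_trans _ _ (\sum_(l < 4) 2 * M)); last first.
    by rewrite sumr_const card_ord -(mulr_natl (2 * M)).
  apply: ler_sum => l _; apply: (le_trans (norm1M _ _)).
  by apply: ler_pM; rewrite ?norm1_ge0 ?unitary_norm1_le.
by rewrite /norm1 /= normr0 addr0.
Qed.

End Dirac.

End VectorFields.

(** * From the weak equation to the mollified identity *)

Section WeakIdentity.
Context {R : realType}.
Local Notation T := (R3m R).
Local Notation vol := (vol R).
Local Notation C := R[i].
Variables (psi f : R3 R -> 'cV[C]_4).

(* [D_0 psi = - f] tested against [chi], with [D_0] moved onto [chi]. *)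
Hypothesis weak : forall chi, test_function chi ->
  'i *: (\sum_k alpha R k *m wint (partial k chi) psi) + wint chi f = 0.
Hypothesis adm_psi : forall (b : R) x, 0 < b ->
  admissible (fun y => invdist b x y ^+ 2) psi.
Hypothesis adm_f : forall (b : R) x, 0 < b ->
  admissible (fun y => invdist b x y ^+ 2) f.

Lemma weak_entry (a : 'I_3 -> R3 R -> R) (c : R3 R -> R) l :
  ('i *: (\sum_k alpha R k *m wint (a k) psi) + wint c f) l 0 =
  'i * (\sum_k \sum_m alpha R k l m * wint (a k) psi m 0) + wint c f l 0.
Proof.
rewrite mxE mxE summxE; congr (_ * _ + _).
by apply: eq_bigr => k _; rewrite mxE.
Qed.

(** The cut-off kernel is an admissible test function, and the cutoff is then sent to 1 by dominated
    convergence. The term carrying its gradient disappears because the gradient tends to 0 pointwise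
    and stays bounded. *)
Lemma weak_identity (b : R) j x : 0 < b ->
  'i *: (\sum_k alpha R k *m wint (dkern b j k x) psi) + wint (kern b j x) f = 0.
Proof.
move=> b0; apply/matrixP => l o; rewrite ord1 weak_entry [RHS]mxE.
have [D D0 hD] := @dcutoff_bound R.
have P k n : partial k (chi_test n b j x) = fun y =>
    cutoff n y * dkern b j k x y + kern b j x y * dcutoff n k y.
  by apply/funext => y; exact: partial_chi_test.
have C1 k m : cvgC (fun n => wint (partial k (chi_test n b j x)) psi m 0)
    (wint (dkern b j k x) psi m 0).
  (* The first summand is the bound of [dkern_le], with the cutoff at most 1; the second bounds
     [dcutoff], with [kern_le] supplying the weight. *)
  apply: (cvgC_wint (M := 4 * isqrt b + D) (adm_psi x b0)).
  - move=> n; rewrite P.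
    apply: measurable_funD; apply: measurable_funM.
    + exact: measurable_cutoff.
    + exact: measurable_dkern.
    + exact: measurable_kern.
    + exact: measurable_dcutoff.
  - exact: measurable_dkern.
  - move=> n y; rewrite P mulrDl.
    apply: (le_trans (ler_normD _ _)); apply: lerD.
      apply: le_trans (dkern_le j k x y b0); rewrite normrM ler_piMl//.
      by rewrite ger0_norm ?cutoff_ge0 ?cutoff_le1.
    by rewrite normrM mulrC ler_pM// kern_le// ltW.
  - move=> y; under eq_fun do rewrite P.
    suff : (fun n => cutoff n y * dkern b j k x y + kern b j x y * dcutoff n k y)
        @ \oo --> 1 * dkern b j k x y + kern b j x y * 0.
      by rewrite mul1r mulr0 addr0.
    apply: cvgD; apply: cvgM.
    + exact: cvg_cutoff.
    + exact: cvg_cst.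
    + exact: cvg_cst.
    + exact: cvg_dcutoff.
have C2 : cvgC (fun n => wint (chi_test n b j x) f l 0) (wint (kern b j x) f l 0).
  apply: (cvgC_wint (M := 1) (adm_f x b0)).
  - by move=> n; apply: measurable_funM; [exact: measurable_cutoff|exact: measurable_kern].
  - exact: measurable_kern.
  - move=> n y; rewrite mul1r normrM.
    apply: le_trans (kern_le j x y (ltW b0)); rewrite ler_piMl//.
    by rewrite ger0_norm ?cutoff_ge0 ?cutoff_le1.
  - move=> y.
    suff : (fun n => chi_test n b j x y) @ \oo --> 1 * kern b j x y.
      by rewrite mul1r.
    by apply: cvgM; [exact: cvg_cutoff|exact: cvg_cst].
apply: (@cvgC_unique _ (fun n => ('i *: (\sum_k alpha R k *m
    wint (partial k (chi_test n b j x)) psi) + wint (chi_test n b j x) f) l 0)).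
  under [X in cvgC X]eq_fun do rewrite weak_entry.
  apply: cvgCD => //; apply: cvgCM; apply: cvgC_sum => k.
  by apply: cvgC_sum => m; exact: cvgCM.
under [X in cvgC X]eq_fun do rewrite (weak (chi_test_function _ j x b0)) mxE.
exact: cvgC_cst.
Qed.

Lemma mollE (b : R) (x y : R3 R) : 0 < b -> moll b x y = - (4 * pi)^-1 * \sum_j dkern b j j x y.
Proof. by move=> b0; rewrite dkern_trace// /moll invfM; ring. Qed.

Definition green_coef : C := 'i * ((4 * pi)^-1)%:C.

Lemma mollified_identity (b : R) x : 0 < b ->
  wint (moll b x) psi = - \sum_j green_coef *: (alpha R j *m wint (kern b j x) f).
Proof.
move=> b0.
have W j : \sum_k alpha R k *m wint (dkern b j k x) psi = 'i *: wint (kern b j x) f.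
  have /eqP := weak_identity j x b0; rewrite addr_eq0 => /eqP.
  move=> /(congr1 (fun v => - 'i *: v)).
  by rewrite scalerA mulNr -expr2 sqr_i opprK scale1r scalerN scaleNr opprK.
have md j k := measurable_dkern b j k x.
rewrite (_ : moll b x = fun y => - (4 * pi)^-1 * \sum_j dkern b j j x y); last first.
  by apply/funext => y; exact: mollE.
(* Three diagonal terms of the trace, each bounded by [dkern_le]. *)
rewrite (@wintZ _ _ _ (adm_psi x b0) _ _ (3 * (4 * isqrt b))).
- rewrite (wint_sum (M := 4 * isqrt b) (adm_psi x b0))//.
    rewrite -(clifford_contraction (S := fun j k => wint (dkern b j k x) psi)).
      rewrite -sumrN scaler_sumr; apply: eq_bigr => j _.
      rewrite -mulmx_sumr W -scalemxAr scalerA -scaleNr; congr (_ *: _).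
      by rewrite /green_coef rmorphN/= mulNr mulrC.
    move=> j k; rewrite (_ : dkern b j k x = dkern b k j x)//.
    by apply/funext => y; exact: dkernC.
  by move=> j y; exact: dkern_le.
- exact: measurable_sum.
- move=> y; apply: (le_trans (ler_norm_sum _ _ _)).
  have d j := dkern_le j j x y b0.
  by rewrite sum3E; have := d 0; have := d 1; have := d 2; lra.
Qed.

End WeakIdentity.

Lemma vol_ae_and (R : realType) (P Q : R3m R -> Prop) :
  {ae vol R, forall x : R3m R, P x} -> {ae vol R, forall x : R3m R, Q x} ->
  {ae vol R, forall x : R3m R, P x /\ Q x}.
Proof.
move=> aP aQ; apply: (negligibleS _ (negligibleU aP aQ)) => x /= nPQ.
by have [Px|] := pselect (P x); [right => Qx; exact: nPQ|left].
Qed.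

(** * Riesz potentials of integrable densities *)

Section RieszPotential.
Context {R : realType}.
Local Notation T := (R3m R).
Local Notation vol := (vol R).

Definition riesz (F : T -> R) (x : T) : \bar R :=
  (\int[vol]_y (invdist 0 x y ^+ 2 * F y)%:E)%E.

Variable F : T -> R.
Hypothesis F0 : forall x, 0 <= F x.
Hypothesis iF : vol.-integrable setT (EFin \o F).

Lemma riesz_ge0 x : (0 <= riesz F x)%E.
Proof. by apply: integral_ge0 => y _; rewrite lee_fin mulr_ge0// sqr_ge0. Qed.

Lemma measurable_riesz : measurable_fun [set: T] (riesz F).
Proof.
apply: (@measurable_fun_integral _ _ _ _ _ vol
  (fun z : T * T => (invdist 0 z.1 z.2 ^+ 2 * F z.2)%:E)).
apply/measurable_EFinP; apply: measurable_funM; first exact: measurable_invdistX.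
have mF : measurable_fun [set: T] F by apply/measurable_EFinP; exact: measurable_int iF.
exact: (measurableT_comp mF).
Qed.

Lemma riesz_integrable_box a b : vol.-integrable (box a b) (riesz F).
Proof.
apply/integrableP; split; first exact: measurable_funTS measurable_riesz.
under eq_integral => x _ do rewrite gee0_abs ?riesz_ge0//.
apply: integral_riesz_lty => //; [exact: measurable_box|exact: vol_box_lty].
Qed.

Lemma riesz_ae_fin : {ae vol, forall x : T, riesz F x \is a fin_num}.
Proof.
have H n := integrable_ae (measurable_box (R := R) _ _)
  (riesz_integrable_box (fun=> - n%:R) (fun=> n%:R)).
apply: vol_ae_imply (ae_foralln H) => x Hx.
have [n _ xn] : (\bigcup_n cube n) x by rewrite cube_cover.
exact: (Hx n xn).
Qed.

End RieszPotential.

(** * Removal of the regularization *)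

Section GreenFunction.
Context {R : realType}.
Local Notation T := (R3m R).
Local Notation vol := (vol R).
Local Notation C := R[i].
Local Notation Re := (@complex.Re R).
Local Notation Im := (@complex.Im R).
Variables (psi f : R3 R -> 'cV[C]_4).
Hypothesis weak : forall chi, test_function chi ->
  'i *: (\sum_k alpha R k *m wint (partial k chi) psi) + wint chi f = 0.
Hypothesis psi2 : L2 psi.
Hypothesis mf : measurable_mx f.
Hypothesis if1 : forall m, vol.-integrable setT (fun y => (norm1 (f y m 0))%:E).

(** The weight is itself square integrable by [integral_isqrt_dist4], so its product with a
    component of psi is integrable. *)
Lemma admissible_L2 (b : R) x : 0 < b -> admissible (fun y => invdist b x y ^+ 2) psi.
Proof.
move=> b0; split.
- by move=> y; exact: sqr_ge0.
- exact: measurable_invdistXr.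
- by have [] := psi2.
- move=> l; apply: square_integrableM; last exact: L2_norm1.
  + exact: measurable_invdistXr.
  + by apply: measurable_norm1; have [m _] := psi2; exact: m.
  + under eq_fun do rewrite invdistC.
    exact: invdist4_integrable.
Qed.

(** Here the weight is simply bounded, by [b^-1]. *)
Lemma admissible_L1 (b : R) x : 0 < b -> admissible (fun y => invdist b x y ^+ 2) f.
Proof.
move=> b0; split => //.
- by move=> y; exact: sqr_ge0.
- exact: measurable_invdistXr.
- move=> l; apply: (le_integrable measurableT _ _ (integrableZl measurableT b^-1 (if1 l))).
    apply/measurable_EFinP; apply: measurable_funM; first exact: measurable_invdistXr.
    by apply: measurable_norm1; exact: mf.
  have b1 : 0 <= b^-1 by rewrite invr_ge0 ltW.
  move=> y _ /=; rewrite lee_fin normrM [leRHS]normrM ler_wpM2r//.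
  rewrite (ger0_norm (sqr_ge0 _)) (ger0_norm b1) invdist_sqr ?(ltW b0)//.
  by rewrite lef_pV2 ?posrE ?lerDl ?dist2_ge0// ltr_pwDl// dist2_ge0.
Qed.

Definition density_norm (y : T) : R := \sum_m norm1 (f y m 0).

Lemma density_norm_ge0 y : 0 <= density_norm y.
Proof. by apply: sumr_ge0 => m _; exact: norm1_ge0. Qed.

Lemma integrable_density_norm : vol.-integrable setT (EFin \o density_norm).
Proof.
rewrite (_ : _ \o _ = fun y => (\sum_m (norm1 (f y m 0))%:E)%E).
  by apply: integrable_sum => // m _; exact: if1.
by apply/funext => y; rewrite /= sumEFin.
Qed.

Lemma density_norm_le y m : norm1 (f y m 0) <= density_norm y.
Proof.
by rewrite /density_norm (bigD1 m)//= lerDl sumr_ge0// => i _; exact: norm1_ge0.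
Qed.

Lemma measurable_norm1_density m : measurable_fun [set: T] (fun y => norm1 (f y m 0)).
Proof. by apply: measurable_norm1; exact: mf. Qed.

Lemma riesz_density_le x m :
  (\int[vol]_y (invdist 0 x y ^+ 2 * norm1 (f y m 0))%:E <= riesz density_norm x)%E.
Proof.
apply: ge0_le_integral => //.
- by move=> y _; rewrite lee_fin mulr_ge0 ?sqr_ge0 ?norm1_ge0.
- apply/measurable_EFinP; apply: measurable_funM; first exact: measurable_invdistXr.
  exact: measurable_norm1_density.
- apply/measurable_EFinP; apply: measurable_funM; first exact: measurable_invdistXr.
  by apply/measurable_EFinP; exact: measurable_int integrable_density_norm.
- by move=> y _; rewrite lee_fin ler_wpM2l ?sqr_ge0// density_norm_le.
Qed.

Lemma admissible_riesz x : riesz density_norm x \is a fin_num ->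
  admissible (fun y => invdist 0 x y ^+ 2) f.
Proof.
move=> fin; split => //.
- by move=> y; exact: sqr_ge0.
- exact: measurable_invdistXr.
- move=> m; apply/integrableP; split.
    apply/measurable_EFinP; apply: measurable_funM; first exact: measurable_invdistXr.
    exact: measurable_norm1_density.
  rewrite (_ : integral _ _ _ =
      \int[vol]_y (invdist 0 x y ^+ 2 * norm1 (f y m 0))%:E)%E; last first.
    apply: eq_integral => y _.
    by rewrite gee0_abs// lee_fin mulr_ge0 ?sqr_ge0 ?norm1_ge0.
  apply: (le_lt_trans (riesz_density_le x m)).
  by rewrite -ge0_fin_numE//; apply: riesz_ge0; exact: density_norm_ge0.
Qed.

(** Minus the regularized [G0 f]; the value [b = 0] is included and gives the limit. *)
Definition dirac_green (b : R) x : 'cV[C]_4 :=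
  - \sum_j green_coef *: (alpha R j *m wint (kern b j x) f).

Lemma dirac_greenE b x l : dirac_green b x l 0 =
  -1 * \sum_j \sum_m (green_coef * alpha R j l m) * wint (kern b j x) f m 0.
Proof.
rewrite mulN1r mxE summxE; congr (- _); apply: eq_bigr => j _.
by rewrite !mxE mulr_sumr; apply: eq_bigr => m _; rewrite mulrA.
Qed.

(** A real integral is [fine] of an extended one, which is measurable in the parameter even at the
    points where the integral is infinite or undefined; no exceptional set has to be removed. *)
Lemma measC_dirac_green l : measC (fun x : T => dirac_green 0 x l 0).
Proof.
have mw j m : measC (fun x : T => wint (kern 0 j x) f m 0).
  have [mR mI] := mf m 0.
  have K (h : T -> R) : measurable_fun [set: T] h -> measurable_fun [set: T]
      (fun x : T => Rintegral vol setT (fun y => kern 0 j x y * h y)).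
    move=> mh; apply: (@measurableT_comp _ _ _ _ _ _ (@fine R)).
      exact: fine_measurable.
    apply: (@measurable_fun_integral _ _ _ _ _ vol
      (fun z : T * T => (kern 0 j z.1 z.2 * h z.2)%:E)).
    apply/measurable_EFinP; apply: measurable_funM; first exact: measurable_kern.
    exact: (measurableT_comp mh).
  split.
    by under eq_fun do rewrite Re_wint; exact: K.
  by under eq_fun do rewrite Im_wint; exact: K.
under [X in measC X]eq_fun do rewrite dirac_greenE.
apply: measCM; first exact: measC_cst.
by apply: measC_sum => j; apply: measC_sum => m; apply: measCM => //; exact: measC_cst.
Qed.

Lemma cvgC_dirac_green x l : riesz density_norm x \is a fin_num ->
  cvgC (fun n => dirac_green (4^-1 ^+ n) x l 0) (dirac_green 0 x l 0).
Proof.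
move=> /admissible_riesz ad.
under [X in cvgC X]eq_fun do rewrite dirac_greenE.
rewrite dirac_greenE; apply: cvgCM; apply: cvgC_sum => j.
apply: cvgC_sum => m; apply: cvgCM; apply: (cvgC_wint (M := 1) ad).
- by move=> n; exact: measurable_kern.
- exact: measurable_kern.
- by move=> n y; rewrite mul1r kern_le0// ltW// pow4_gt0.
- by move=> y; exact: cvg_kern.
Qed.

Definition green_const : R := \sum_j \sum_l \sum_m norm1 (green_coef * alpha R j l m).

Lemma dirac_green_le (b : R) x l : 0 <= b -> riesz density_norm x \is a fin_num ->
  ((norm1 (dirac_green b x l 0))%:E <= green_const%:E * riesz density_norm x)%E.
Proof.
move=> b0 fin; have ad := admissible_riesz fin.
rewrite -(fineK fin) -EFinM lee_fin dirac_greenE mulN1r norm1N.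
have wle j m : norm1 (wint (kern b j x) f m 0) <= fine (riesz density_norm x).
  rewrite -lee_fin fineK//; apply: le_trans (riesz_density_le x m).
  apply: norm1_wint_le => //; first exact: measurable_kern.
  by move=> y; exact: kern_le0.
apply: (le_trans (norm1_sum _ _ _)); rewrite mulr_suml; apply: ler_sum => j _.
apply: (le_trans (norm1_sum _ _ _)).
apply: (@le_trans _ _ (\sum_m norm1 (green_coef * alpha R j l m) * fine (riesz density_norm x))).
  apply: ler_sum => m _; apply: (le_trans (norm1M _ _)).
  by rewrite ler_wpM2l ?norm1_ge0.
rewrite -mulr_suml ler_wpM2r//.
  by apply: fine_ge0; apply: riesz_ge0; exact: density_norm_ge0.
rewrite [leRHS](bigD1 l)//= lerDl; apply: sumr_ge0 => k _; apply: sumr_ge0 => m _.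
exact: norm1_ge0.
Qed.

Lemma moll_le (b : R) (x y : R3 R) : 0 < b ->
  `|moll b x y| <= (4 * pi)^-1 * (3 * (4 * isqrt b)) * invdist b x y ^+ 2.
Proof.
move=> b0; have c0 : 0 <= (4 * pi)^-1 :> R by rewrite invr_ge0 mulr_ge0 ?pi_ge0.
rewrite mollE// normrM normrN (ger0_norm c0) -mulrA ler_wpM2l//.
apply: (le_trans (ler_norm_sum _ _ _)).
have d j := dkern_le j j x y b0.
by rewrite sum3E; have := d 0; have := d 1; have := d 2; lra.
Qed.

(** The map [p] stands for either part, so that the approximation results for real functions apply
    to each real component of psi by one argument. *)
Lemma mollified_part (p : C -> R) n x l : p = Re \/ p = Im ->
  mollified n (fun y => p (psi y l 0)) x = (p (dirac_green (4^-1 ^+ n) x l 0))%:E.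
Proof.
have b0 : 0 < 4^-1 ^+ n :> R := pow4_gt0 n.
have mm : measurable_fun [set: T] (moll (4^-1 ^+ n) x).
  by apply: measurable_funM => //; exact: measurable_invdistXr.
have [iR iI] := integrable_wint (admissible_L2 x b0) l mm (fun y => moll_le x y b0).
rewrite /dirac_green -(mollified_identity weak admissible_L2 admissible_L1)//.
case=> ->.
  by rewrite Re_wint /Rintegral fineK// integrable_fin_num.
by rewrite Im_wint /Rintegral fineK// integrable_fin_num.
Qed.

Lemma eq_part_ae (p : C -> R) l : p = Re \/ p = Im ->
  {ae vol, forall x : T, p (psi x l 0) = p (dirac_green 0 x l 0)}.
Proof.
move=> pRI; have [mpsi _] := psi2.
have mp (u : T -> C) : measC u -> measurable_fun [set: T] (fun x => p (u x)).
  by move=> [u1 u2]; case: pRI => ->.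
have pn z : `|p z| <= norm1 z.
  by case: pRI => ->; [exact: Re_le_norm1|exact: Im_le_norm1].
have mpp : measurable_fun [set: T] (fun x => p (psi x l 0)) by apply: mp; exact: mpsi.
have fin := riesz_ae_fin density_norm_ge0 integrable_density_norm.
apply: (@mollified_limit_ae _ _ mpp _ _
  (fun x => (green_const%:E * riesz density_norm x)%E)).
- apply: (le_integrable measurableT _ _ (L2_norm1 l psi2)).
    by apply/measurable_EFinP; exact: measurable_funX.
  move=> x _ /=; rewrite lee_fin !ger0_norm ?sqr_ge0//.
  rewrite -[leLHS]real_normK ?num_real// lerXn2r ?nnegrE ?norm1_ge0//.
- by apply: mp; exact: measC_dirac_green.
- move=> a b; apply: integrableZl; first exact: measurable_box.
  exact: riesz_integrable_box density_norm_ge0 integrable_density_norm a b.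
- apply: vol_ae_imply fin => x fx n; rewrite mollified_part//.
  apply: le_trans (dirac_green_le l (ltW (pow4_gt0 n)) fx).
  by rewrite lee_fin.
- apply: vol_ae_imply fin => x fx; under eq_fun do rewrite mollified_part//.
  have [c1 c2] := cvgC_dirac_green l fx.
  by apply: cvg_EFin; [exact: nearW|case: pRI => ->].
Qed.

Lemma eq_dirac_green_ae : {ae vol, forall x : T, psi x = dirac_green 0 x}.
Proof.
(* Indexing the four components by [inord n] allows the countable intersection of almost sure
   properties. *)
have H n := vol_ae_and (eq_part_ae (inord n) (or_introl erefl))
  (eq_part_ae (inord n) (or_intror erefl)).
apply: vol_ae_imply (ae_foralln H) => x Hx; apply/matrixP => l o.
by rewrite ord1 -[l]inord_val; have [] := Hx l; exact: eq_ReIm.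
Qed.

End GreenFunction.

(** * Complex integrals with convergence, and the operator [G0] *)

Section HasIntegral.
Context {R : realType}.
Local Notation T := (R3m R).
Local Notation vol := (vol R).
Local Notation C := R[i].
Local Notation Re := (@complex.Re R).
Local Notation Im := (@complex.Im R).

(** Convergence and value are carried together through linear combinations, since membership in
    [ker_T0] demands both. *)
Definition has_integral (g : T -> C) (z : C) : Prop :=
  [/\ vol.-integrable setT (fun y => (Re (g y))%:E),
      vol.-integrable setT (fun y => (Im (g y))%:E) &
      z = Rintegral vol setT (fun y => Re (g y)) +i*
          Rintegral vol setT (fun y => Im (g y))].

Lemma integral_lincomb (a b : R) (u v : T -> R) :
  vol.-integrable setT (fun y => (u y)%:E) ->
  vol.-integrable setT (fun y => (v y)%:E) ->
  vol.-integrable setT (fun y => (a * u y + b * v y)%:E) /\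
  Rintegral vol setT (fun y => a * u y + b * v y) =
  a * Rintegral vol setT u + b * Rintegral vol setT v.
Proof.
move=> iu iv.
have iau : vol.-integrable setT (fun y => (a * u y)%:E).
  exact: (integrableZl measurableT a iu).
have ibv : vol.-integrable setT (fun y => (b * v y)%:E).
  exact: (integrableZl measurableT b iv).
split; first exact: (integrableD measurableT iau ibv).
by rewrite RintegralD// !RintegralZl.
Qed.

Lemma has_integralM (c : C) g z : has_integral g z ->
  has_integral (fun y => c * g y) (c * z).
Proof.
move=> [iR iI ->].
have [i1 e1] := integral_lincomb (Re c) (- Im c) iR iI.
have [i2 e2] := integral_lincomb (Im c) (Re c) iR iI.
have E1 : (fun y => Re (c * g y)) = fun y => Re c * Re (g y) + - Im c * Im (g y).
  by apply/funext => y; rewrite Re_mul mulNr.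
have E2 : (fun y => Im (c * g y)) = fun y => Im c * Re (g y) + Re c * Im (g y).
  by apply/funext => y; rewrite Im_mul addrC.
split.
- by rewrite (_ : (fun y => _) = EFin \o (fun y => Re (c * g y)))// E1.
- by rewrite (_ : (fun y => _) = EFin \o (fun y => Im (c * g y)))// E2.
- rewrite E1 E2 e1 e2; apply: eq_ReIm; rewrite ?Re_mul ?Im_mul /=.
    by rewrite mulNr.
  by rewrite addrC.
Qed.

Lemma has_integral0 : has_integral (fun=> 0) 0.
Proof.
split; try exact: integrable0.
by rewrite /Rintegral integral0.
Qed.

Lemma has_integralD g h z w : has_integral g z -> has_integral h w ->
  has_integral (fun y => g y + h y) (z + w).
Proof.
move=> [iR iI ->] [jR jI ->].
have E1 : (fun y => Re (g y + h y)) = fun y => Re (g y) + Re (h y).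
  by apply/funext => y; rewrite Re_add.
have E2 : (fun y => Im (g y + h y)) = fun y => Im (g y) + Im (h y).
  by apply/funext => y; rewrite Im_add.
split.
- rewrite (_ : (fun y => _) = EFin \o (fun y => Re (g y + h y)))// E1.
  exact: (integrableD measurableT iR jR).
- rewrite (_ : (fun y => _) = EFin \o (fun y => Im (g y + h y)))// E2.
  exact: (integrableD measurableT iI jI).
- by rewrite E1 E2 !RintegralD.
Qed.

Lemma has_integral_sum (I : Type) (r : seq I) (g : I -> T -> C) (z : I -> C) :
  (forall i, has_integral (g i) (z i)) ->
  has_integral (fun y => \sum_(i <- r) g i y) (\sum_(i <- r) z i).
Proof.
move=> gz; elim: r => [|i r IH].
  rewrite big_nil; under [X in has_integral X]eq_fun do rewrite big_nil.
  exact: has_integral0.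
rewrite big_cons; under [X in has_integral X]eq_fun do rewrite big_cons.
exact: has_integralD.
Qed.

Lemma enorm_dist2 (x y : R3 R) : enorm (x - y) = Num.sqrt (dist2 x y).
Proof. by rewrite -enorm_sqr sqrtr_sqr ger0_norm// sqrtr_ge0. Qed.

(** The identity holds on the diagonal as well, where both sides take the value 0. *)
Lemma G0_kernelE (x y : R3 R) :
  G0_kernel x y = \sum_j (green_coef * (kern 0 j x y)%:C) *: alpha R j.
Proof.
rewrite /G0_kernel /alpha_dot scaler_sumr; apply: eq_bigr => j _.
rewrite scalerA; congr (_ *: _).
have -> : coord3 j (x - y) = coord3 j x - coord3 j y.
  by case: j => -[|[|[|//]]] ?.
rewrite /kern /invdist /isqrt add0r enorm_dist2 -fmorphV /green_coef -!mulrA.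
congr (_ * _); rewrite -!rmorphM/=; congr (_%:C).
rewrite (invfM 4 (pi * _)) (invfM pi) (invfM 4) exprVn; move: (_ ^- 3) => s.
by move: (4^-1 : R) (pi^-1 : R) => a b; ring.
Qed.

Lemma G0_kernel_mulE (f : R3 R -> 'cV[C]_4) (x y : R3 R) l :
  (G0_kernel x y *m f y) l 0 =
  \sum_j \sum_m (green_coef * alpha R j l m) * ((kern 0 j x y)%:C * f y m 0).
Proof.
rewrite G0_kernelE mulmx_suml summxE; apply: eq_bigr => j _.
rewrite -scalemxAl mxE mxE mulr_sumr; apply: eq_bigr => m _; ring.
Qed.

Lemma G0_dirac_green (f : R3 R -> 'cV[C]_4) x :
  admissible (fun y => invdist 0 x y ^+ 2) f ->
  G0_converges f x /\ G0 f x = - dirac_green f 0 x.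
Proof.
move=> ad.
have H l : has_integral (fun y => (G0_kernel x y *m f y) l 0) (- dirac_green f 0 x l 0).
  rewrite dirac_greenE mulN1r opprK.
  under [X in has_integral X]eq_fun do rewrite G0_kernel_mulE.
  apply: has_integral_sum => j; apply: has_integral_sum => m; apply: has_integralM.
  have mk := measurable_kern 0 j (@measurable_cst _ _ T T setT x) (@measurable_id _ T setT).
  have kw y : `|kern 0 j x y| <= 1 * invdist 0 x y ^+ 2 by rewrite mul1r kern_le0.
  have [i1 i2] := integrable_wint ad m mk kw.
  have E1 : (fun y => Re ((kern 0 j x y)%:C * f y m 0)) = fun y => kern 0 j x y * Re (f y m 0).
    by apply/funext => y; rewrite Re_real_mul.
  have E2 : (fun y => Im ((kern 0 j x y)%:C * f y m 0)) = fun y => kern 0 j x y * Im (f y m 0).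
    by apply/funext => y; rewrite Im_real_mul.
  split.
  - by rewrite (_ : (fun y => _) = EFin \o (fun y => Re ((kern 0 j x y)%:C * f y m 0)))// E1.
  - by rewrite (_ : (fun y => _) = EFin \o (fun y => Im ((kern 0 j x y)%:C * f y m 0)))// E2.
  - by rewrite E1 E2 wintE.
split; first by move=> l o; rewrite ord1; have [] := H l.
apply/matrixP => l o; rewrite ord1 [RHS]mxE; have [_ _ ->] := H l.
by rewrite mxE.
Qed.

End HasIntegral.

(** * Passage from psi to phi *)

Section MainTheorem.
Context {R : realType}.
Local Notation T := (R3m R).
Local Notation vol := (vol R).
Local Notation C := R[i].
Local Notation Re := (@complex.Re R).
Local Notation Im := (@complex.Im R).
Variables (V B : R3 R -> 'M[C]_4) (lam : R3 R -> 'I_4 -> R) (eps : R)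
  (psi : R3 R -> 'cV[C]_4).
Hypothesis V_meas : measurable_mx V.
Hypothesis eps_gt0 : 0 < eps.
Hypothesis V_decay : exists C : R, forall (x : R3 R) (i j : 'I_4),
  `|V x i j| <= (C * japanese x `^ (- 2 - eps))%:C.
Hypothesis V_diag : diagonalizes V B lam.
Hypothesis psi_L2 : L2 psi.
Hypothesis psi_null : dirac_null V psi.

Let f x := V x *m psi x.

Let mf : measurable_mx f.
Proof. by apply: measurable_mxM => //; have [] := psi_L2. Qed.

Let if1 m : vol.-integrable setT (fun y => (norm1 (f y m 0))%:E).
Proof.
have [M M0 VM] := potential_decay eps_gt0 V_decay.
(* At center 0 and [b = 1] the weight is [(1 + |y|^2)^-1], exactly the majorant of the entries of
   [V]. *)
have ad := admissible_L2 psi_L2 0 (@ltr01 R).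
have iS : vol.-integrable setT
    (fun y => (\sum_k (invdist 1 0 y ^+ 2 * norm1 (psi y k 0))%:E)%E).
  by apply: integrable_sum => // k _; have [_ _ _ h] := ad; exact: h.
apply: (le_integrable measurableT _ _ (integrableZl measurableT M iS)).
  by apply/measurable_EFinP; apply: measurable_norm1; exact: mf.
move=> y _; rewrite sumEFin -EFinM /= lee_fin.
rewrite (ger0_norm (norm1_ge0 _)) ger0_norm; last first.
  rewrite mulr_ge0// sumr_ge0// => k _; rewrite mulr_ge0 ?sqr_ge0 ?norm1_ge0//.
apply: (le_trans (norm1_mulmx_le (psi y) m (VM y))).
by rewrite -mulrA mulr_sumr invdistC.
Qed.

(** The minus sign of [- i] in the Dirac operator cancels the one from the distributional
    derivative. *)
Let weak chi : test_function chi ->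
  'i *: (\sum_k alpha R k *m wint (partial k chi) psi) + wint chi f = 0.
Proof.
move=> /psi_null h; rewrite -[RHS]h wint_integral; congr (_ + _).
rewrite /distr_D0 scaleNr -scalerN -sumrN; congr (_ *: _).
by apply: eq_bigr => k _; rewrite /distr_partial mulmxN opprK wint_integral.
Qed.

Lemma vmx_factorization x :
  (vmx lam B x)^t*%sesqui *m Umx lam x *m vmx lam B x = V x.
Proof.
have conj_real (a : R) : Num.conj a%:C = a%:C :> C.
  by apply: eq_ReIm; rewrite ?Re_conj ?Im_conj //= oppr0.
have [_ _ _ ->] := V_diag.
rewrite /vmx trmx_mul map_mxM /= -!mulmxA; congr (_ *m _).
rewrite !mulmxA; congr (_ *m _).
rewrite /Umx /real_diag tr_diag_mx map_diag_mx !mulmx_diag; congr diag_mx.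
apply/rowP => i; rewrite !mxE.
apply: (etrans (congr1 (fun z => z * _ * _) (conj_real _))).
rewrite -!rmorphM/=; congr (_%:C); rewrite mulrAC -expr2 sqr_sqrtr//.
rewrite /sign_pm; case: leP => h; first by rewrite mulr1 ger0_norm.
by rewrite mulrN1 ltr0_norm// opprK.
Qed.

(** The convention that the sign of 0 is 1 matters here: with 0 instead, the square would only be a
    projection. *)
Lemma Umx_sqr x : Umx lam x *m Umx lam x = 1%:M.
Proof.
rewrite /Umx /real_diag mulmx_diag -diag_const_mx; congr diag_mx.
apply/rowP => i; rewrite !mxE -rmorphM/= /sign_pm.
by case: leP => _; rewrite ?mulrNN mulr1.
Qed.

Lemma phi_L2 : L2 (fun x => Umx lam x *m (vmx lam B x *m psi x)).
Proof.
have [mB mlam _ _] := V_diag; have [mpsi _] := psi_L2.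
have [M M0 lM] := eigenvalue_bounded eps_gt0 V_decay V_diag.
have mdiag (d : R -> R) : measurable_fun setT d ->
    measurable_mx (fun x => real_diag (fun i => d (lam x i))).
  move=> md i j.
  suff : measC (fun x : T => ((d (lam x i)) *+ (i == j))%:C).
    rewrite (_ : (fun x : T => _) = fun x => real_diag (fun i => d (lam x i)) i j)//.
    by apply/funext => x; rewrite !mxE rmorphMn.
  apply: measC_real; case: (i == j) => //.
  exact: measurableT_comp (mlam i).
have msign : measurable_fun setT (@sign_pm R).
  apply: measurable_fun_ifT => //.
  exact: measurable_fun_ler.
have msqrt : measurable_fun setT (fun t : R => Num.sqrt `|t|).
  apply: measurableT_comp => //.
  by apply: continuous_measurable_fun; exact: sqrt_continuous.
(* The square root of [|lam|] is at most [1 + |lam|], hence at most [1 + M]; the factor 2 bounds an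
   entry of [B]. *)
apply: (L2_dominated (K := (1 + M) * 2) psi_L2).
  apply: measurable_mxM; first exact: mdiag msign.
  apply: measurable_mxM => //; apply: measurable_mxM => //.
  exact: mdiag msqrt.
move=> x l; rewrite mulmxA; apply: norm1_mulmx_le => i j.
rewrite /Umx /vmx /real_diag mulmxA mulmx_diag mul_diag_mx !mxE -rmorphM/=.
apply: (le_trans (norm1M _ _)).
apply: ler_pM; rewrite ?norm1_ge0 ?(unitary_norm1_le V_diag)//.
rewrite /norm1 /= normr0 addr0 normrM.
have -> : `|sign_pm (lam x i)| = 1.
  by rewrite /sign_pm; case: leP; rewrite ?normrN normr1.
rewrite mul1r ger0_norm ?sqrtr_ge0//.
have := lM x i; have := normr_ge0 (lam x i).
move: `|lam x i| => t t0 tM; apply: le_trans (lerD (lexx 1) tM).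
rewrite -(@ler_pXn2r _ 2)// ?nnegrE ?sqrtr_ge0 ?addr_ge0// sqr_sqrtr//; nra.
Qed.

Lemma phi_ker : ker_T0 (Umx lam) (vmx lam B)
  (fun x => Umx lam x *m (vmx lam B x *m psi x)).
Proof.
(* By [V = v^* U v] the argument of [G0] in [T0 phi] is exactly [V psi]. *)
have E : (fun y => (vmx lam B y)^t*%sesqui *m
    (Umx lam y *m (vmx lam B y *m psi y))) = f.
  by apply/funext => y; rewrite /f -vmx_factorization !mulmxA.
have fin := riesz_ae_fin (density_norm_ge0 f) (integrable_density_norm if1).
split; first exact: phi_L2.
- apply: (@vol_ae_imply R _ _ _ fin) => x fx; rewrite E.
  by have [] := G0_dirac_green (admissible_riesz mf if1 fx).
- apply: (@vol_ae_imply R _ _ _ (vol_ae_and fin (eq_dirac_green_ae weak psi_L2 mf if1))).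
  move=> x [fx psix]; rewrite /T0 E.
  have [_ ->] := G0_dirac_green (admissible_riesz mf if1 fx).
  by rewrite -psix mulmxA Umx_sqr mul1mx mulmxN subrr.
Qed.

Lemma phi_S1_range : S1_range (Umx lam) (vmx lam B)
  (fun x => Umx lam x *m (vmx lam B x *m psi x)).
Proof.
(* An element of the kernel is its own projection, so the difference to be tested is identically
   0. *)
exists (fun x => Umx lam x *m (vmx lam B x *m psi x)); split.
- exact: phi_L2.
- exact: phi_ker.
move=> g _; rewrite /L2dot mxE.
have Z (p : C -> R) : p 0 = 0 ->
    Rintegral (lebesgue3 R) setT (fun x => p (((g x)^t*%sesqui *m
      (Umx lam x *m (vmx lam B x *m psi x) -
       Umx lam x *m (vmx lam B x *m psi x))) 0 0)) = 0.
  move=> p0; rewrite /Rintegral integral0_eq// => x _.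
  by rewrite subrr mulmx0 mxE p0.
by apply: eq_ReIm; rewrite /= Z.
Qed.

End MainTheorem.

Theorem lemma6p2 (R : realType)
  (V B : R3 R -> 'M[R[i]]_4) (lam : R3 R -> 'I_4 -> R) (eps : R)
  (psi : R3 R -> 'cV[R[i]]_4)
  (V_meas : measurable_mx V)
  (V_herm : forall x : R3 R, V x \is hermsymmx)
  (eps_gt0 : 0 < eps)
  (V_decay : exists C : R, forall (x : R3 R) (i j : 'I_4),
     `|V x i j| <= (C * japanese x `^ (- 2 - eps))%:C)
  (V_diag : diagonalizes V B lam)
  (psi_L2 : L2 psi)
  (psi_null : dirac_null V psi) :
  let U := Umx lam in
  let v := vmx lam B in
  let phi := fun x : R3 R => U x *m (v x *m psi x) in
  S1_range U v phi /\ ker_T0 U v phi.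
Proof.
split.
  exact: (phi_S1_range V_meas eps_gt0 V_decay V_diag psi_L2 psi_null).
exact: (phi_ker V_meas eps_gt0 V_decay V_diag psi_L2 psi_null).
Qed.
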